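(* Let $X_1$ be a random vector in $\mathbb R^d$ with $0\in\operatorname{int}\mathcal D_{\mathcal L}$, and let $f:[0,1]\to\mathbb R$ be a non-zero Lipschitz function. Then the sequence $\big(\frac1n\sum_{k=1}^n f(\frac kn)X_k\big)_{n\ge1}$ satisfies the LDP in $\mathbb R^d$ with speed $n$ and the tight rate function $I_f$ defined as the Legendre–Fenchel transform of the convex function $$E_f(\lambda):=\int_0^1K(\lambda f(t))dt,\qquad\lambda\in\mathbb R^d,$$ i.e. $I_f(x)=\sup_{\lambda\in\mathbb R^d}(\lambda\cdot x-E_f(\lambda))$. Moreover, if $\dim(\operatorname{supp}X_1)=d$, then $\nabla E_f$ is an injective function on its domain $\operatorname{int}D_f$, where $D_f:=\frac{\mathcal D_{\mathcal L}}{\max f_+}\cap\frac{-\mathcal D_{\mathcal L}}{\max f_-}$, and $$I_f(x)=\int_0^1 I\big(\nabla K((\nabla E_f)^{-1}(x)f(t))\big)dt,\qquad x\in\nabla E_f(\operatorname{int}D_f);$$ and for $d=1$ this equality extends to $$I_f(x)=M_+(x-\sup E_f')_++M_-(x-\inf E_f')_-+\int_0^1I\Big(K'\big(\overline{(E_f')^{-1}}(x)f(t)\big)\Big)dt,\qquad x\in\mathbb R,$$ where $M_\pm:=\min\big(\frac{I_\infty(1)}{\max f_\pm},\frac{I_\infty(-1)}{\max f_\mp}\big)$ and $K'(\pm I_\infty(\pm1)):=K'(\pm I_\infty(\pm1)\mp)$.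
   Context: $X_1,X_2,\dots$ are i.i.d. random vectors in $\mathbb R^d$. $\mathcal L(u):=\mathbb Ee^{u\cdot X_1}$, $\mathcal D_{\mathcal L}:=\{u:\mathcal L(u)<\infty\}$, $K:=\log\mathcal L$ (finite and smooth on $\operatorname{int}\mathcal D_{\mathcal L}$), $I(v):=\sup_u(u\cdot v-K(u))$, $I_\infty(v):=\sup\{u\cdot v:u\in\mathcal D_{\mathcal L}\}$. $\dim(\operatorname{supp}X_1)$ is the dimension of the affine hull of the support of the law of $X_1$. For real $x$: $x_+:=\max(x,0)$, $x_-:=(-x)_+$, and likewise for functions; $\max f_\pm$ denotes $\max_{t\in[0,1]}f_\pm(t)$. Conventions: $\frac10:=+\infty$ and $\frac C0:=\mathbb R^d$ for any $C\subset\mathbb R^d$ with $0\in\operatorname{int}C$. For $d=1$: $\sup E_f'$, $\inf E_f'$ denote the supremum/infimum of $E_f'$ over its domain $\operatorname{int}D_f$; for a real increasing function $g$ on an interval $(a,b)$ ($-\infty\le a<b\le\infty$), $\bar g$ is its extension to $\mathbb R$ by $\bar g(x):=g(b-)$ for $x\ge b$ and $\bar g(x):=g(a+)$ for $x\le a$ (applied to $g=(E_f')^{-1}$ on $(\inf E_f',\sup E_f')$); $K'(\pm I_\infty(\pm1)\mp)$ denotes the left limit of $K'$ at $I_\infty(1)$ and the right limit at $-I_\infty(-1)$. LDP with tight rate function $\mathcal J$ (lower semi-continuous, compact sub-level sets) and speed $n$: for every Borel $B$, $-\inf_{\operatorname{int}B}\mathcal J\le\liminf\frac1n\log\mathbb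 P(\cdot\in B)\le\limsup\frac1n\log\mathbb P(\cdot\in B)\le-\inf_{\operatorname{cl}B}\mathcal J$. *)

(* Defs.v *)
From HB Require Import structures.
From mathcomp Require Import all_boot all_order all_algebra.
From mathcomp Require Import all_classical all_reals all_analysis.

Set Implicit Arguments.
Unset Strict Implicit.
Unset Printing Implicit Defensive.

Import Order.TTheory GRing.Theory Num.Theory.
Import numFieldNormedType.Exports.

Local Open Scope classical_set_scope.
Local Open Scope ring_scope.

Section LDPdefs.
Context {R : realType} {d : nat}.
Local Notation V := 'rV[R]_d.

Definition dotp (u v : V) : R := \sum_(i < d) u ord0 i * v ord0 i.

Definition borelV : set (set V) := <<s [set A : set V | open A] >>.

(* X_1, X_2, ... (indexed here from 0: X k plays the role of X_{k+1})
   are i.i.d. random vectors in R^d: each is Borel measurable, all have the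
   law of X 0, and they are mutually independent (product rule for every
   finite family of distinct indices). *)
Definition iid_rvecs {dT} {T : measurableType dT} (P : probability T R)
    (X : nat -> T -> V) : Prop :=
  (forall k B, borelV B -> measurable (X k @^-1` B)) /\
  (forall k B, borelV B -> P (X k @^-1` B) = P (X 0%N @^-1` B)) /\
  (forall (s : seq nat) (B : nat -> set V), uniq s ->
     (forall k, borelV (B k)) ->
     P (\bigcap_(k in [set` s]) (X k @^-1` B k)) =
     (\big[*%E/1%E]_(k <- s) P (X k @^-1` B k))%E).

Definition Lap {dT} {T : measurableType dT} (P : probability T R)
    (X1 : T -> V) (u : V) : \bar R :=
  (\int[P]_w (expR (dotp u (X1 w)))%:E)%E.

Definition DL {dT} {T : measurableType dT} (P : probability T R)
    (X1 : T -> V) : set V := [set u | (Lap P X1 u < +oo)%E].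

Definition Kbar {dT} {T : measurableType dT} (P : probability T R)
    (X1 : T -> V) (u : V) : \bar R :=
  match Lap P X1 u with
  | r%:E => (ln r)%:E
  | _ => +oo%E
  end.

(* K as a real function (meaningful on D_L) *)
Definition Kr {dT} {T : measurableType dT} (P : probability T R)
    (X1 : T -> V) (u : V) : R := fine (Kbar P X1 u).

Definition Irate {dT} {T : measurableType dT} (P : probability T R)
    (X1 : T -> V) (v : V) : \bar R :=
  ereal_sup [set ((dotp u v)%:E - Kbar P X1 u)%E | u in [set: V]].

Definition Iinf {dT} {T : measurableType dT} (P : probability T R)
    (X1 : T -> V) (v : V) : \bar R :=
  ereal_sup [set (dotp u v)%:E | u in DL P X1].

Definition Ef {dT} {T : measurableType dT} (P : probability T R)
    (X1 : T -> V) (f : R -> R) (l : V) : \bar R :=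
  (\int[lebesgue_measure]_(t in `[0%R, 1%R]%classic) Kbar P X1 (f t *: l))%E.

Definition Efr {dT} {T : measurableType dT} (P : probability T R)
    (X1 : T -> V) (f : R -> R) (l : V) : R := fine (Ef P X1 f l).

Definition If {dT} {T : measurableType dT} (P : probability T R)
    (X1 : T -> V) (f : R -> R) (x : V) : \bar R :=
  ereal_sup [set ((dotp l x)%:E - Ef P X1 f l)%E | l in [set: V]].

Definition elog (p : \bar R) : \bar R :=
  match p with
  | r%:E => if (0 < r)%R then (ln r)%:E else -oo%E
  | +oo%E => +oo%E
  | -oo%E => -oo%E
  end.

Definition LDP {dT} {T : measurableType dT} (P : probability T R)
    (Z : nat -> T -> V) (J : V -> \bar R) : Prop :=
  (forall x, (0 <= J x)%E) /\
  lower_semicontinuous J /\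
  (forall a : R, compact [set x | (J x <= a%:E)%E]) /\
  (forall B, borelV B ->
     (- ereal_inf (J @` interior B) <=
        limn_einf (fun n => (n%:R^-1)%:E * elog (P (Z n @^-1` B))))%E /\
     (limn_esup (fun n => (n%:R^-1)%:E * elog (P (Z n @^-1` B))) <=
        - ereal_inf (J @` closure B))%E).

Definition grad (F : V -> R) (x : V) : V :=
  \row_(i < d) ('d F x) (delta_mx ord0 i).

Definition supp_law {dT} {T : measurableType dT} (P : probability T R)
    (X1 : T -> V) : set V :=
  [set x | forall U, open U -> U x -> (0 < P (X1 @^-1` U))%E].

Definition full_affine_dim (S : set V) : Prop :=
  exists (x0 : V) (s : seq V), S x0 /\ (forall y, y \in s -> S y) /\
    (\dim (span [seq y - x0 | y <- s]))%VS = d.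

Definition set_div (C : set V) (a : R) : set V :=
  if a == 0 then [set: V] else [set a^-1 *: c | c in C].

Definition max_fpos (f : R -> R) : R :=
  sup [set Num.max (f t) 0 | t in `[0%R, 1%R]%classic].
Definition max_fneg (f : R -> R) : R :=
  sup [set Num.max (- f t) 0 | t in `[0%R, 1%R]%classic].

Definition Df {dT} {T : measurableType dT} (P : probability T R)
    (X1 : T -> V) (f : R -> R) : set V :=
  set_div (DL P X1) (max_fpos f) `&`
  set_div [set - u | u in DL P X1] (max_fneg f).

End LDPdefs.

Section OneDim.
Context {R : realType}.

Definition ediv (a : \bar R) (b : R) : \bar R :=
  if b == 0 then +oo%E else (a * (b^-1)%:E)%E.

Definition epos (x : \bar R) : \bar R := Order.max x 0%E.
Definition eneg (x : \bar R) : \bar R := Order.max (- x)%E 0%E.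

Definition lim_left (g : R -> R) (c : \bar R) : \bar R :=
  match c with
  | r%:E => lim ((g u)%:E @[u --> r^'-])
  | +oo%E => lim ((g u)%:E @[u --> +oo])
  | -oo%E => -oo%E
  end.

Definition lim_right (g : R -> R) (c : \bar R) : \bar R :=
  match c with
  | r%:E => lim ((g u)%:E @[u --> r^'+])
  | -oo%E => lim ((g u)%:E @[u --> -oo])
  | +oo%E => +oo%E
  end.
End OneDim.

Section OneDimLDP.
Context {R : realType} {d : nat} {dT : measure_display}
  {T : measurableType dT} (P : probability T R) (X1 : T -> 'rV[R]_d)
  (f : R -> R).

(* the embedding R -> R^d, x |-> (x, ..., x); a bijection when d = 1 *)
Definition cv (x : R) : 'rV[R]_d := const_mx x.

Definition K1 (u : R) : R := Kr P X1 (cv u).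
Definition K1' : R -> R := derive1 K1.
Definition Ef1 (l : R) : R := Efr P X1 f (cv l).
Definition Ef1' : R -> R := derive1 Ef1.

Definition intDf1 : set R := [set l | interior (Df P X1 f) (cv l)].

Definition supEf' : \bar R := ereal_sup [set (Ef1' l)%:E | l in intDf1].
Definition infEf' : \bar R := ereal_inf [set (Ef1' l)%:E | l in intDf1].

(* (E_f')^{-1} on (inf E_f', sup E_f') *)
Definition Ef1'inv (y : R) : R := xget 0 [set l | intDf1 l /\ Ef1' l = y].

Definition Ef1'inv_bar (x : R) : \bar R :=
  if ((infEf' < x%:E) && (x%:E < supEf'))%E then (Ef1'inv x)%:E
  else if (supEf' <= x%:E)%E then lim_left Ef1'inv supEf'
  else lim_right Ef1'inv infEf'.

Definition Iinf_p : \bar R := Iinf P X1 (cv 1).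
Definition Iinf_m : \bar R := Iinf P X1 (cv (-1)).

Definition K1'ext (u : \bar R) : \bar R :=
  if u == Iinf_p then lim_left K1' u
  else if u == (- Iinf_m)%E then lim_right K1' u
  else (K1' (fine u))%:E.

Definition I1ext (v : \bar R) : \bar R :=
  ereal_sup [set (u%:E * v - Kbar P X1 (cv u))%E | u in [set: R]].

Definition Mplus : \bar R :=
  Order.min (ediv Iinf_p (max_fpos f)) (ediv Iinf_m (max_fneg f)).
Definition Mminus : \bar R :=
  Order.min (ediv Iinf_p (max_fneg f)) (ediv Iinf_m (max_fpos f)).

End OneDimLDP.

(* Main.v *)
(* Everything rests on the good points l, where the paths t |-> f t *: l stay
   inside D_L with uniform exponential moments: there E_f is differentiable,
   with quadratic upper bounds and the convexity lower bound, and Riemann sums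
   of K (f (k/n) l) converge to E_f l at rate 1/n.  Convexity of D_L makes every
   l with E_f l finite a radial limit of good points, so the supremum defining
   I_f may be restricted to them.  The upper bound of the LDP is Chernoff's
   inequality on a finite cover by half-spaces.  For the lower bound the X_k are
   truncated to a cube, where every l is good; the tilt is found by maximising
   l.x - E_M l - 2 del |l|^2, so that its gradient E_M' l is close to x, and
   Chebyshev's exponential bounds under the tilted law replace Cramer's theorem.
   The formula for I_f at a gradient is equality in the Fenchel inequality, both
   for E_f and, along the path, for K.  In dimension one the values of I_f at and
   beyond an endpoint s of the range of E_f' come from sequences l_n increasing
   to M_+ (or decreasing to - M_-): the Legendre values l K' - K increase along
   the rays t |-> f t l_n, so monotone convergence gives I_f(s), and past s the
   function I_f is affine with slope M_+, because E_f is infinite beyond M_+. *)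
Require Import Defs.
From HB Require Import structures.
From mathcomp Require Import all_boot all_order all_algebra.
From mathcomp Require Import all_classical all_reals all_analysis.
From mathcomp Require Import measurable_realfun ring lra.
From mathcomp Require finmap.
Set Implicit Arguments.
Unset Strict Implicit.
Unset Printing Implicit Defensive.
Import Order.TTheory GRing.Theory Num.Theory.
Import numFieldNormedType.Exports.
Import HBNNSimple.
Local Open Scope classical_set_scope.
Local Open Scope ring_scope.

(** * Scalar product and Borel sets of R^d *)

(** A point [x] need not be a gradient of [E_f], which may fail to be steep at the edge of its
    domain. Truncation makes the energy finite everywhere, but the truncated law loses mass: all
    functions are therefore attached to the law restricted to a set [S], without renormalising, and
    the same lemmas serve the cubes and the whole space. The quadratic penalty forces a maximiser to
    exist and confines it to a bounded region, where the truncated energies can be compared with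
    [E_f]. No derivative is computed under an integral sign. For [cgf] and [energy] alike a
    candidate gradient is written down and the function is enclosed between its tangent and the
    tangent plus a multiple of [|h|^2]; this gives differentiability, Lipschitz gradients, constants
    uniform along a path, and the concentration of the tilted law. Along a path [K] may be negative
    and also infinite, so monotone limits are taken after subtracting an integrable minorant. In
    dimension one [K] and [E_f] are two instances of one abstract convex function on a line, and the
    left end is the right end of its reflection. *)

Section DotProduct.
Context {R : realType} {d : nat}.
Local Notation V := 'rV[R]_d.
Implicit Types u v w x : V.

Lemma dotpC u v : dotp u v = dotp v u.
Proof. by apply: eq_bigr => i _; rewrite mulrC. Qed.

Lemma dotpDl u v w : dotp (u + v) w = dotp u w + dotp v w.
Proof. by rewrite -big_split; apply: eq_bigr => i _; rewrite mxE mulrDl. Qed.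

Lemma dotpZl a u w : dotp (a *: u) w = a * dotp u w.
Proof. by rewrite mulr_sumr; apply: eq_bigr => i _; rewrite mxE mulrA. Qed.

Lemma dotpDr u v w : dotp w (u + v) = dotp w u + dotp w v.
Proof. by rewrite dotpC dotpDl 2!(dotpC w). Qed.

Lemma dotpZr a u w : dotp w (a *: u) = a * dotp w u.
Proof. by rewrite dotpC dotpZl (dotpC w). Qed.

Lemma dotpNl u w : dotp (- u) w = - dotp u w.
Proof. by rewrite -scaleN1r dotpZl mulN1r. Qed.

Lemma dotpNr u w : dotp w (- u) = - dotp w u.
Proof. by rewrite dotpC dotpNl dotpC. Qed.

Lemma dotpBl u v w : dotp (u - v) w = dotp u w - dotp v w.
Proof. by rewrite dotpDl dotpNl. Qed.

Lemma dotpBr u v w : dotp w (u - v) = dotp w u - dotp w v.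
Proof. by rewrite dotpDr dotpNr. Qed.

Lemma dotp0l w : dotp 0 w = 0.
Proof. by rewrite -(scale0r 0) dotpZl mul0r. Qed.

Lemma dotp0r w : dotp w 0 = 0.
Proof. by rewrite dotpC dotp0l. Qed.

Lemma dotp_sumr (I : Type) (r : seq I) (F : I -> V) w :
  dotp w (\sum_(i <- r) F i) = \sum_(i <- r) dotp w (F i).
Proof.
elim/big_ind2 : _ => [|x1 y1 x2 y2 <- <-|//]; first by rewrite dotp0r.
by rewrite dotpDr.
Qed.

Lemma dotp_delta i w : dotp (delta_mx 0 i) w = w 0 i.
Proof.
rewrite /dotp (bigD1 i)//= mxE !eqxx mul1r big1 ?addr0// => j ji.
by rewrite mxE (negbTE ji) andbF mul0r.
Qed.

Lemma dotp_ge0 u : 0 <= dotp u u.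
Proof. by apply: sumr_ge0 => i _; rewrite -expr2 sqr_ge0. Qed.

Lemma le_coord u i : `|u 0 i| <= `|u|.
Proof.
by rewrite [leRHS]/Num.norm /= mx_normrE; apply/bigmax_geP; right; exists (0, i).
Qed.

Lemma norm_leP u r : 0 <= r -> (forall i, `|u 0 i| <= r) -> `|u| <= r.
Proof.
move=> r0 ur; rewrite [leLHS]/Num.norm /= mx_normrE; apply/bigmax_leP; split => //.
by move=> [i j] _ /=; rewrite (ord1 i).
Qed.

Lemma norm_ltP u r : 0 < r -> (forall i, `|u 0 i| < r) -> `|u| < r.
Proof.
move=> r0 ur; rewrite [ltLHS]/Num.norm /= mx_normrE; apply/bigmax_ltP; split => //.
by move=> [i j] _ /=; rewrite (ord1 i).
Qed.

(** The norm is the maximum norm, [dotp u u] the Euclidean square; through this comparison the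
    smooth penalty [dotp l l] controls the norm of [l]. *)
Lemma sqr_norm_le_dotp u : `|u| ^+ 2 <= dotp u u.
Proof.
have -> : `|u| ^+ 2 = (Num.sqrt (`|u| ^+ 2)) ^+ 2 by rewrite sqr_sqrtr ?sqr_ge0.
have -> : dotp u u = Num.sqrt (dotp u u) ^+ 2 by rewrite sqr_sqrtr ?dotp_ge0.
rewrite ler_sqr ?nnegrE ?sqrtr_ge0// sqrtr_sqr ger0_norm//.
apply: norm_leP => [|i]; first exact: sqrtr_ge0.
rewrite -sqrtr_sqr ler_wsqrtr// /dotp (bigD1 i)//= expr2 lerDl.
by apply: sumr_ge0 => j _; rewrite -expr2 sqr_ge0.
Qed.

Lemma dotp_eq0 u : (dotp u u == 0) = (u == 0).
Proof.
apply/idP/eqP => [/eqP uu|->]; last by rewrite dotp0l.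
have := sqr_norm_le_dotp u; rewrite uu => u2.
apply/normr0_eq0/eqP; rewrite -sqrf_eq0 eq_le u2 /=; exact: sqr_ge0.
Qed.

(** Each of the [d] terms is at most the product of the maximum norms; this is the origin of the
    factors [d%:R] in all later bounds. *)
Lemma dotp_le u v : `|dotp u v| <= d%:R * `|u| * `|v|.
Proof.
rewrite /dotp; apply: (le_trans (ler_norm_sum _ _ _)).
have -> : d%:R * `|u| * `|v| = \sum_(i < d) `|u| * `|v|.
  by rewrite sumr_const card_ord -mulrA mulr_natl.
by apply: ler_sum => i _; rewrite normrM; apply: ler_pM => //; exact: le_coord.
Qed.

Lemma continuous_dotp u : continuous (dotp u).
Proof.
move=> v.
have := @cvg_big R _ +%R 0 xpredT (@add_continuous R) _ (nbhs v)
  (index_enum 'I_d) (fun i w => u 0 i * w 0 i) (fun i => u 0 i * v 0 i) _.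
by apply => i _; apply: cvgM; [exact: cvg_cst|exact: coord_continuous].
Qed.

Lemma open_dotp u a : open [set x | a < dotp u x].
Proof. by apply: open_comp (@open_gt _ a) => x _; exact: continuous_dotp. Qed.

Lemma borel_open (U : set V) : open U -> borelV U.
Proof. exact: sub_sigma_algebra. Qed.

Lemma borel_setC (B : set V) : borelV B -> borelV (~` B).
Proof.
have [_ h _] := smallest_sigma_algebra [set: V] [set A : set V | open A].
by move=> mB; rewrite -setTD; exact: h.
Qed.

Lemma borel_closed (C : set V) : closed C -> borelV C.
Proof.
by move=> cC; rewrite -(setCK C); apply: borel_setC; apply: borel_open; exact: closed_openC.
Qed.

Lemma borel_setT : borelV [set: V].
Proof. apply: borel_open; exact: openT. Qed.

End DotProduct.

Section Measurability.
Context {R : realType} {d : nat} {dT : measure_display}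
  {T : measurableType dT}.
Local Notation V := 'rV[R]_d.
Local Notation VB := (g_sigma_algebraType [set A : set V | open A]).

(* Rational balls form a countable base of the topology of R^d. *)
Lemma measurable_coords_preimage (Z : T -> V) (B : set V) :
  (forall i, measurable_fun setT (fun w => Z w 0 i)) ->
  borelV B -> measurable (Z @^-1` B).
Proof.
move=> mZ; move: B; apply: smallest_sub.
  split=> [|B mB|F mF].
  - by rewrite preimage_set0.
  - by rewrite setTD preimage_setC; exact: measurableC.
  - by rewrite preimage_bigcup; exact: bigcup_measurable.
move=> U oU.
pose q (a : 'rV[rat]_d) : V := map_mx ratr a.
pose Bl (p : 'rV[rat]_d * nat) := ball (q p.1) (p.2.+1%:R^-1).
have mBl p : measurable (Z @^-1` Bl p).
  have -> : Z @^-1` Bl p = \bigcap_(i : 'I_d)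
      ((fun w => Z w 0 i) @^-1` (ball (q p.1 0 i) (p.2.+1%:R^-1))).
    apply/seteqP; split => w /=.
      by move=> [_ h] i _; exact: h.
    by move=> h; split=> // i j; rewrite (ord1 i); exact: h.
  apply: (@fin_bigcap_measurable _ _ 'I_d setT); first exact: finite_finset.
  move=> i _; rewrite -[X in measurable X]setTI; apply: mZ => //.
  by rewrite ball_itv; exact: measurable_itv.
have -> : Z @^-1` U =
    \bigcup_p (if `[< Bl p `<=` U >] then Z @^-1` Bl p else set0).
  apply/seteqP; split => w /=; last first.
    by move=> [p _]; case: asboolP => // pU /pU.
  move=> Uw; have /nbhs_ballP[e /= e0 eU] : nbhs (Z w) U by exact: open_nbhs_nbhs.
  have [n ne] : exists n : nat, n.+1%:R^-1 < e / 2 :> R.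
    exists (Num.bound (e / 2)^-1).
    rewrite invf_plt ?posrE ?divr_gt0// (lt_le_trans (archi_boundP _))//.
      by rewrite invr_ge0 ltW// divr_gt0.
    by rewrite ler_nat.
  have [a ha] : exists a : 'rV[rat]_d, ball (Z w) n.+1%:R^-1 (q a).
    have h i : exists r : rat, ball (Z w 0 i) n.+1%:R^-1 (ratr r : R).
      have /rat_in_itvoo[r rr] : Z w 0 i - n.+1%:R^-1 < Z w 0 i + n.+1%:R^-1 :> R.
        by rewrite ltrBlDr -addrA ltrDl addr_gt0// invr_gt0.
      by exists r; move: rr; rewrite in_itv /= /ball/= ltr_distlC.
    have {}h i : {r : rat | ball (Z w 0 i) n.+1%:R^-1 (ratr r : R)} by exact/cid.
    exists (\row_i sval (h i)); split => // i j.
    by rewrite (ord1 i) !mxE; exact: (svalP (h j)).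
  exists (a, n) => //; case: asboolP => [_|]; first exact: ball_sym.
  move=> /=; case => y yB; apply: eU.
  apply: le_ball (ball_triangle ha yB).
  by rewrite (splitr e) lerD// ltW.
apply: countable_bigcupT_measurable; first exact: countableP.
by move=> p; case: asboolP.
Qed.

Lemma measurable_comp_borel (Y : T -> V) (phi : V -> R) :
  (forall B, borelV B -> measurable (Y @^-1` B)) ->
  continuous phi -> measurable_fun setT (phi \o Y).
Proof.
move=> mY cphi; apply: (measurability _ (RGenOpens.measurableE R)) => _ [_ [U [oU ->]] <-].
rewrite setTI comp_preimage; apply: mY; apply: borel_open.
by apply: open_comp => // x _; exact: cphi.
Qed.

End Measurability.

(** * Independence *)

Section Independence.
Context {R : realType} {dT : measure_display} {T : measurableType dT}
  (P : probability T R).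

(** The hypothesis on indicators expresses that [H], of mean [c], is independent of [Y]. It passes
    to simple functions by linearity and to nonnegative functions by monotone convergence. *)
Lemma integralM_factor d' (U : measurableType d') (H : T -> R) (Y : T -> U)
    (c : R) (psi : U -> R) :
  measurable_fun setT H -> (forall w, 0 <= H w) -> measurable_fun setT Y ->
  0 <= c ->
  (forall B, measurable B -> \int[P]_w (H w * \1_B (Y w))%:E =
     c%:E * \int[P]_w (\1_B (Y w))%:E)%E ->
  measurable_fun setT psi -> (forall y, 0 <= psi y) ->
  (\int[P]_w (H w * psi (Y w))%:E = c%:E * \int[P]_w (psi (Y w))%:E)%E.
Proof.
move=> mH H0 mY c0 hB mpsi psi0.
have mEpsi : measurable_fun setT (EFin \o psi) by exact/measurable_EFinP.
pose g := nnsfun_approx measurableT mEpsi.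
have gcvg y : ((g n y)%:E @[n --> \oo] --> (psi y)%:E)%E.
  by apply: (cvg_nnsfun_approx measurableT mEpsi) => // x _; rewrite lee_fin.
have gnd y : {homo (fun n => g n y) : n m / (n <= m)%N >-> n <= m}.
  by move=> m n mn; exact/lefP/nd_nnsfun_approx.
have mg n : measurable_fun setT (fun w => g n (Y w)) by exact: measurableT_comp.
have mind r n : measurable_fun setT (fun w => \1_(g n @^-1` [set r]) (Y w) : R).
  by apply: measurableT_comp => //; exact: measurable_indic.
have sum_form n w : g n (Y w) = \sum_(r \in range (g n)) r * \1_(g n @^-1` [set r]) (Y w).
  by rewrite [LHS]fimfunE.
have simple n : (\int[P]_w (H w * g n (Y w))%:E = c%:E * \int[P]_w (g n (Y w))%:E)%E.
  have r0 r : r \in range (g n) -> 0 <= r by rewrite inE => -[y _ <-].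
  transitivity (\sum_(r \in range (g n)) \int[P]_w (r * (H w * \1_(g n @^-1` [set r]) (Y w)))%:E)%E.
    rewrite -ge0_integral_fsum//; last 2 first.
    - by move=> r; apply/measurable_EFinP/measurable_funM => //; exact: measurable_funM.
    - move=> r w _; rewrite lee_fin mulrCA mulr_ge0//.
      exact: (nnfun_muleindic_ge0 (g n) r (Y w)).
    apply: eq_integral => w _; rewrite sum_form mulr_fsumr// fsumEFin//.
    by congr EFin; apply: eq_fsbigr => r _; rewrite mulrCA.
  transitivity (\sum_(r \in range (g n)) c%:E * \int[P]_w (r * (\1_(g n @^-1` [set r]) (Y w)))%:E)%E.
    apply: eq_fsbigr => r rg.
    under eq_integral do rewrite EFinM.
    rewrite ge0_integralZl//; last 3 first.
    - by apply/measurable_EFinP/measurable_funM.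
    - by move=> w _; rewrite lee_fin mulr_ge0.
    - by rewrite lee_fin r0.
    rewrite hB; last by rewrite -[X in measurable X]setTI; exact: (measurable_funP (g n)).
    under [in RHS]eq_integral do rewrite EFinM.
    rewrite ge0_integralZl//; last 2 first.
    - by apply/measurable_EFinP; exact: mind.
    - by rewrite lee_fin r0.
    by rewrite muleCA.
  rewrite -ge0_mule_fsumr; last first.
    move=> r; apply: integral_ge0 => w _; rewrite lee_fin.
    exact: (nnfun_muleindic_ge0 (g n) r (Y w)).
  congr (_ * _)%E; rewrite -ge0_integral_fsum//; last 2 first.
  - by move=> r; apply/measurable_EFinP/measurable_funM.
  - by move=> r w _; rewrite lee_fin; exact: (nnfun_muleindic_ge0 (g n) r (Y w)).
  by apply: eq_integral => w _; rewrite sum_form fsumEFin.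
have lhs : (\int[P]_w (H w * g n (Y w))%:E @[n --> \oo] -->
            \int[P]_w (H w * psi (Y w))%:E)%E.
  rewrite [X in _ --> X](_ : _ = \int[P]_w limn (fun n => (H w * g n (Y w))%:E))%E; last first.
    apply: eq_integral => w _; apply/esym/cvg_lim => //.
    rewrite EFinM; under eq_fun do rewrite EFinM.
    by apply: cvgeZl => //; exact: gcvg.
  apply: cvg_monotone_convergence => //.
  - by move=> n; apply/measurable_EFinP/measurable_funM.
  - by move=> n w _; rewrite lee_fin mulr_ge0.
  - by move=> w _ m n mn; rewrite lee_fin ler_wpM2l// gnd.
have rhs : (\int[P]_w (g n (Y w))%:E @[n --> \oo] --> \int[P]_w (psi (Y w))%:E)%E.
  rewrite [X in _ --> X](_ : _ = \int[P]_w limn (fun n => (g n (Y w))%:E))%E; last first.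
    by apply: eq_integral => w _; apply/esym/cvg_lim => //; exact: gcvg.
  apply: cvg_monotone_convergence => //.
  - by move=> n; apply/measurable_EFinP.
  - by move=> n w _; rewrite lee_fin.
  - by move=> w _ m n mn; rewrite lee_fin gnd.
apply: (cvg_unique _ lhs) => //.
by rewrite (funext simple); apply: cvgeZl.
Qed.

Context {d : nat} (X : nat -> T -> 'rV[R]_d) (iid : iid_rvecs P X).
Local Notation V := 'rV[R]_d.
Local Notation VB := (g_sigma_algebraType [set A : set V | open A]).

Let mX k : measurable_fun setT (X k : T -> VB).
Proof. by move=> _ B mB; rewrite setTI; case: iid => + _; exact. Qed.

Lemma iid_integral (phi : VB -> R) k :
  measurable_fun setT phi -> (forall x, 0 <= phi x) ->
  (\int[P]_w (phi (X k w))%:E = \int[P]_w (phi (X 0%N w))%:E)%E.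
Proof.
move=> mphi phi0.
have h j : (\int[P]_w (phi (X j w))%:E =
    \int[pushforward P (X j : T -> VB)]_x (phi x)%:E)%E.
  rewrite ge0_integral_pushforward//; last by move=> x _; rewrite lee_fin.
  by apply/measurable_EFinP.
rewrite !h; apply: eq_measure_integral => B mB _; rewrite /pushforward.
by case: iid => _ [+ _]; exact.
Qed.

(** Indicators are replaced by general factors one at a time. [Q j] allows any factors below index
    [j] and only indicators from [j] on, so [Q 0] is the product rule of independence. To pass to
    [j + 1], the factors other than the [j]-th are frozen in [H]; the hypothesis of
    [integralM_factor] is then [Q j] with an indicator in place [j]. *)
Lemma indep_integral (n : nat) (phi : nat -> VB -> R) :
  (forall k, measurable_fun setT (phi k)) -> (forall k x, 0 <= phi k x) ->
  (forall k, \int[P]_w (phi k (X 0%N w))%:E < +oo)%E ->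
  (\int[P]_w (\prod_(k < n) phi k (X k w))%:E =
   \prod_(k < n) \int[P]_w (phi k (X 0%N w))%:E)%E.
Proof.
suff Q j : (j <= n)%N -> forall phi : nat -> VB -> R,
    (forall k, measurable_fun setT (phi k)) -> (forall k x, 0 <= phi k x) ->
    (forall k, \int[P]_w (phi k (X 0%N w))%:E < +oo)%E ->
    (forall k, (j <= k)%N -> exists2 B, borelV B & phi k = \1_B) ->
  (\int[P]_w (\prod_(k < n) phi k (X k w))%:E =
   \prod_(k < n) \int[P]_w (phi k (X k w))%:E)%E.
  move=> mphi phi0 phioo.
  (* Factors from index [n] on are set to 1, the indicator of the whole space, so that the indicator
     clause of [Q n] holds. *)
  pose phi' k : VB -> R := if (k < n)%N then phi k else \1_setT.
  transitivity (\int[P]_w (\prod_(k < n) phi' k (X k w))%:E)%E.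
    apply: eq_integral => w _; congr EFin.
    by apply: eq_bigr => -[k kn] _ /=; rewrite /phi' kn.
  rewrite (Q n (leqnn n) phi').
  - apply: eq_bigr => -[k kn] _ /=; rewrite /phi' kn.
    exact: iid_integral.
  - by move=> k; rewrite /phi'; case: ifP.
  - by move=> k x; rewrite /phi'; case: ifP.
  - move=> k; rewrite /phi'; case: ifP => // _.
    under eq_integral do rewrite indicT/=.
    by rewrite integral_cst//= mul1e (le_lt_trans (probability_le1 _ _))// ltry.
  - move=> k kn; exists setT; first exact: borel_setT.
    by rewrite /phi' ltnNge kn.
elim: j => [|j IH] jn {}phi mphi phi0 phioo indphi.
  have [B hB] : exists B : nat -> set V, forall k, borelV (B k) /\ phi k = \1_(B k).
    have h k : exists B, borelV B /\ phi k = \1_B.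
      by have [B ? ?] := indphi k isT; exists B.
    by exists (fun k => sval (cid (h k))) => k; exact: (svalP (cid (h k))).
  have mXB k : measurable (X k @^-1` B k).
    by case: iid => + _; apply; case: (hB k).
  transitivity (P (\bigcap_(k in [set` iota 0 n]) (X k @^-1` B k))).
    rewrite -[RHS]mul1e -[1%E]/(1%:E) -(setTI (\bigcap_(_ in _) _)) setIC.
    rewrite -integral_indic//; last first.
      apply: fin_bigcap_measurable => //; exact: finite_seq.
    rewrite mul1e.
    apply: eq_integral => w _; congr EFin; rewrite indicE.
    case: (boolP (w \in _)) => [|/negP].
      rewrite inE => h; rewrite big1// => k _.
      by rewrite (hB k).2 indicE mem_set//; apply: h => /=; rewrite mem_iota /=.
    rewrite inE => /existsNP[k /not_implyP[/=]]; rewrite mem_iota /= add0n => kn nB.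
    rewrite (bigD1 (Ordinal kn))//= (hB k).2 indicE memNset ?mul0r//.
  case: iid => _ [_ ->]; [|exact: iota_uniq|by move=> k; case: (hB k)].
  rewrite -[in LHS](subn0 n) big_mkord.
  apply: eq_bigr => k _; rewrite (hB k).2.
  by rewrite -(setIT (X k @^-1` B k)) -(integral_indic P measurableT (mXB k)).
pose c : R := \prod_(k < n | (k : nat) != j) fine (\int[P]_w (phi k (X k w))%:E)%E.
pose H w : R := \prod_(k < n | (k : nat) != j) phi k (X k w).
have fin_phi k : (\int[P]_w (phi k (X k w))%:E)%E \is a fin_num.
  by rewrite ge0_fin_numE ?iid_integral//; apply: integral_ge0 => w _; rewrite lee_fin.
have spl (A : nat -> \bar R) : (\prod_(k < n) A k =
    \prod_(k < n | (k : nat) != j) A k * A j)%E.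
  by rewrite (bigD1 (Ordinal jn))//= muleC.
have splR (A : nat -> R) : \prod_(k < n) A k =
    (\prod_(k < n | (k : nat) != j) A k) * A j.
  by rewrite (bigD1 (Ordinal jn))//= mulrC.
have cE : (c%:E = \prod_(k < n | (k : nat) != j) \int[P]_w (phi k (X k w))%:E)%E.
  by rewrite /c -prodEFin; apply: eq_bigr => k _; rewrite fineK.
rewrite (spl (fun k => \int[P]_w (phi k (X k w))%:E)%E) -cE.
under eq_integral do rewrite (splR (fun k => phi k (X k _))).
apply: (@integralM_factor _ VB H (X j)) => //.
- rewrite (_ : H = fun w => \prod_(k < n) if (k : nat) != j then phi k (X k w) else 1).
  by apply: measurable_prod => k _; case: ((k : nat) != j) => //; exact: (measurableT_comp (mphi k) (mX k)).
  by apply/funext => w; rewrite /H big_mkcond.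
- by move=> w; apply: prodr_ge0.
- by apply: prodr_ge0 => k _; rewrite fine_ge0//; apply: integral_ge0 => w _; rewrite lee_fin.
move=> B mB.
pose psi k : VB -> R := if k == j then \1_B else phi k.
transitivity (\int[P]_w (\prod_(k < n) psi k (X k w))%:E)%E.
  apply: eq_integral => w _; rewrite (splR (fun k => psi k (X k w))) /psi eqxx.
  by congr (_ * _)%:E; apply: eq_bigr => k /negbTE ->.
rewrite (IH (ltnW jn)).
- rewrite (spl (fun k => \int[P]_w (psi k (X k w))%:E)%E) /psi eqxx cE.
  by congr (_ * _)%E; apply: eq_bigr => k /negbTE ->.
- by move=> k; rewrite /psi; case: eqP => // _; exact: measurable_indic.
- by move=> k x; rewrite /psi; case: eqP.
- move=> k; rewrite /psi; case: eqP => // _.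
  have mXB : measurable (X 0%N @^-1` B) by case: iid => + _; exact.
  rewrite (_ : (\int[P]_w _)%E = P (X 0%N @^-1` B)); last first.
    by rewrite -(setIT (X 0%N @^-1` B)) -(integral_indic P measurableT mXB).
  by rewrite (le_lt_trans (probability_le1 _ _))// ltry.
- move=> k; rewrite leq_eqVlt /psi => /orP[/eqP <-|jk].
    by rewrite eqxx; exists B.
  by rewrite gtn_eqF//; exact: indphi.
Qed.

End Independence.

(** * Cumulant generating functions of truncated laws *)

Section ExpInequalities.
Context {R : realType}.
Implicit Types z y : R.

Lemma sqr_le_expR y : 0 <= y -> y ^+ 2 <= 4 * expR y.
Proof.
move=> y0; have h : y / 2 <= expR (y / 2) by have := expR_ge1Dx (y / 2); lra.
have -> : y = y / 2 + y / 2 by field.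
rewrite expRD -expr2.
have : (y / 2) ^+ 2 <= expR (y / 2) ^+ 2 by rewrite ler_sqr ?nnegrE ?expR_ge0//; lra.
nra.
Qed.

(** From [e^z - 1 <= z e^z]: used twice when [z >= 0], and combined with [e^z >= 1 + z], multiplied
    by [z], when [z < 0]. *)
Lemma expR_le_quad z : expR z <= 1 + z + z ^+ 2 * expR `|z|.
Proof.
have h : expR z - 1 <= z * expR z.
  have := expR_ge1Dx (- z); rewrite expRN => h.
  have e0 := expR_gt0 z.
  have : (1 - z) * expR z <= (expR z)^-1 * expR z by rewrite ler_pM2r.
  rewrite mulVf ?gt_eqF//; lra.
have e1 := expR_ge1Dx z.
have [z0|z0] := leP 0 z; first by rewrite ger0_norm//; nra.
have : 1 <= expR `|z| by rewrite -expR0 ler_expR.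
have : expR z <= 1 by rewrite -expR0 ler_expR ltW.
nra.
Qed.

End ExpInequalities.

Lemma integral_gt0 {R : realType} d' (U : measurableType d')
    (mu : {measure set U -> \bar R}) (A : set U) (g : U -> R) :
  measurable A -> measurable_fun A g -> (forall x, A x -> 0 <= g x) ->
  (0 < mu (A `&` [set x | (0 < g x)%R]) -> 0 < \int[mu]_(x in A) (g x)%:E)%E.
Proof.
move=> mA mg g0 muA; rewrite lt0e integral_ge0; last by move=> x /g0; rewrite lee_fin.
rewrite andbT; apply/eqP => int0.
have mEg : measurable_fun A (EFin \o g) by exact/measurable_EFinP.
have /(ae_eq_integral_abs mu mA mEg) [N [mN N0 hN]] :
    (\int[mu]_(x in A) `|(EFin \o g) x| = 0)%E.
  rewrite -int0; apply: eq_integral => x; rewrite inE => Ax /=.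
  by rewrite ger0_norm ?g0.
suff : (mu (A `&` [set x | (0 < g x)%R]) <= mu N)%E by rewrite N0 leNgt muA.
apply: le_measure; rewrite ?inE//.
  exact: measurable_fun_ltr.
move=> x [Ax /= gx]; apply: hN => /= /(_ Ax) /eqP; rewrite eqe; apply/negP.
by rewrite gt_eqF.
Qed.

Section ExponentialMoments.
Context {R : realType} {d : nat} {dT : measure_display}
  {T : measurableType dT} (P : probability T R) (X0 : T -> 'rV[R]_d).
Local Notation V := 'rV[R]_d.
Hypothesis mX0 : forall B, borelV B -> measurable (X0 @^-1` B).
Implicit Types (S : set V) (u v h : V) (rho : R).

(** The law is restricted to [S], not conditioned on it: the value at 0 is the probability of [S],
    possibly below one. *)
Definition mgf S u : \bar R :=
  (\int[P]_(w in X0 @^-1` S) (expR (dotp u (X0 w)))%:E)%E.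

Definition cgf S u : R := ln (fine (mgf S u)).

(** The weight dominates [e^((u + h).X)] whenever [d |h| <= rho] and, up to the factor [1 / rho],
    also [|X| e^(u.X)]. Finiteness for some positive [rho] is the quantitative form of [u] being
    interior to the domain. *)
Definition emom S u rho : \bar R :=
  (\int[P]_(w in X0 @^-1` S) (expR (dotp u (X0 w) + rho * `|X0 w|))%:E)%E.

Definition mom1 S u : V :=
  \row_i \int[P]_(w in X0 @^-1` S) (X0 w 0 i * expR (dotp u (X0 w))).

(** The mean of the law tilted by [e^(u.X)]: the candidate for the gradient of [cgf S], which
    [cgf_jensen] and [cgf_upper] confirm. *)
Definition cgrad S u : V := (fine (mgf S u))^-1 *: mom1 S u.

Lemma measurable_dotpX u : measurable_fun setT (fun w => dotp u (X0 w)).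
Proof. exact: (measurable_comp_borel mX0 (@continuous_dotp _ _ u)). Qed.

Lemma measurable_normX : measurable_fun setT (fun w => `|X0 w|).
Proof. exact: (measurable_comp_borel mX0 (@norm_continuous _ _)). Qed.

Lemma measurable_expX u rho :
  measurable_fun setT (fun w => expR (dotp u (X0 w) + rho * `|X0 w|)).
Proof.
apply: measurableT_comp => //; apply: measurable_funD; first exact: measurable_dotpX.
by apply: measurable_funM => //; exact: measurable_normX.
Qed.

Lemma measurable_expX0 u : measurable_fun setT (fun w => expR (dotp u (X0 w))).
Proof. by apply: measurableT_comp => //; exact: measurable_dotpX. Qed.

Let mE D u rho :
  measurable_fun D (fun w => (expR (dotp u (X0 w) + rho * `|X0 w|))%:E).
Proof. by apply: measurable_funTS; apply/measurable_EFinP; exact: measurable_expX. Qed.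

Let eE0 u rho w : (0 <= (expR (dotp u (X0 w) + rho * `|X0 w|))%:E)%E.
Proof. by rewrite lee_fin expR_ge0. Qed.

Lemma emom_ge0 S u rho : (0 <= emom S u rho)%E.
Proof. by apply: integral_ge0 => w _; rewrite lee_fin expR_ge0. Qed.

Lemma mgf_ge0 S u : (0 <= mgf S u)%E.
Proof. by apply: integral_ge0 => w _; rewrite lee_fin expR_ge0. Qed.

Section OneSet.
Variables (S : set V) (bS : borelV S).
Let A := X0 @^-1` S.
Let mA : measurable A. Proof. exact: mX0. Qed.

Lemma integrable_dominated u rho (c : R) (g : T -> R) :
  (emom S u rho < +oo)%E -> measurable_fun setT g ->
  (forall w, `|g w| <= c * expR (dotp u (X0 w) + rho * `|X0 w|)) ->
  P.-integrable A (EFin \o g).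
Proof.
move=> uoo mg gc.
have ie : P.-integrable A
    (EFin \o (fun w => expR (dotp u (X0 w) + rho * `|X0 w|))).
  apply/integrableP; split.
    by apply: measurable_funTS; apply/measurable_EFinP; exact: measurable_expX.
  apply: le_lt_trans uoo; rewrite le_eqVlt; apply/orP; left; apply/eqP.
  by apply: eq_integral => w _ /=; rewrite ger0_norm// expR_ge0.
apply: (le_integrable mA _ _ (integrableZl mA c ie)).
  by apply: measurable_funTS; apply/measurable_EFinP.
move=> w _ /=; rewrite lee_fin (le_trans (gc w))// ler_norm//.
Qed.

Lemma emom_le u v rho r (c : R) : 0 <= c ->
  (forall w, A w -> expR (dotp u (X0 w) + rho * `|X0 w|) <=
             c * expR (dotp v (X0 w) + r * `|X0 w|)) ->
  (emom S u rho <= c%:E * emom S v r)%E.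
Proof.
move=> c0 le; rewrite -(ge0_integralZl P mA (@mE A v r) (fun w _ => eE0 v r w))//.
apply: ge0_le_integral => //.
by apply: measurable_funeM; exact: mE.
Qed.

Lemma emom0 u : emom S u 0 = mgf S u.
Proof. by apply: eq_integral => w _; rewrite mul0r addr0. Qed.

Lemma emom_shift u h rho r : d%:R * `|h| <= r ->
  (emom S (u + h) rho <= emom S u (rho + r))%E.
Proof.
move=> hr; rewrite -[leRHS]mul1e; apply: emom_le => // w _.
rewrite mul1r ler_expR dotpDl.
have := dotp_le h (X0 w); rewrite ler_norml => /andP[_ h1].
have n0 := normr_ge0 (X0 w); nra.
Qed.

(** On the segment the exponent is at most the larger of its values at the two ends, and the larger
    exponential is at most the sum. The bound is crude but uniform in [s]. *)
Lemma emom_segment u v rho (s : R) : 0 <= s <= 1 ->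
  (emom S ((1 - s) *: u + s *: v) rho <= emom S u rho + emom S v rho)%E.
Proof.
move=> s01; rewrite -(ge0_integralD P mA (fun w _ => eE0 u rho w) (@mE A u rho)
  (fun w _ => eE0 v rho w) (@mE A v rho)).
apply: ge0_le_integral => //.
  by apply: emeasurable_funD; exact: mE.
move=> w _; rewrite -EFinD lee_fin dotpDl !dotpZl.
set a := dotp u _; set b := dotp v _.
have [ab|/ltW ba] := leP a b.
  apply: (@le_trans _ _ (expR (b + rho * `|X0 w|))); last by rewrite lerDr expR_ge0.
  by rewrite ler_expR lerD2r; nra.
apply: (@le_trans _ _ (expR (a + rho * `|X0 w|))); last by rewrite lerDl expR_ge0.
by rewrite ler_expR lerD2r; nra.
Qed.

Lemma emom_lty_le u rho r : rho <= r -> (emom S u r < +oo -> emom S u rho < +oo)%E.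
Proof.
move=> rr; apply: le_lt_trans; rewrite -[leRHS]mul1e; apply: emom_le => // w _.
by rewrite mul1r ler_expR lerD2l ler_wpM2r.
Qed.

Lemma mgf_lty u rho : 0 <= rho -> (emom S u rho < +oo -> mgf S u < +oo)%E.
Proof. by move=> r0 h; rewrite -emom0; exact: emom_lty_le h. Qed.

Lemma mgf_gt0 u : (0 < P A -> 0 < mgf S u)%E.
Proof.
move=> PA; apply: integral_gt0 => //.
- by apply: measurable_funTS; exact: measurable_expX0.

- rewrite (_ : _ `&` _ = A)//; apply/seteqP; split => w /=; first by case.
  by move=> Aw; split => //; exact: expR_gt0.
Qed.

Section AtPoint.
Variables (u : V) (rho : R).
Hypotheses (rho0 : 0 < rho) (uoo : (emom S u rho < +oo)%E).

Lemma mgf_fin_num : mgf S u \is a fin_num.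
Proof. by rewrite ge0_fin_numE ?mgf_ge0//; exact: mgf_lty (ltW rho0) uoo. Qed.

Let normX_exp w : `|X0 w| <= rho^-1 * expR (rho * `|X0 w|).
Proof.
rewrite -ler_pdivrMl ?invr_gt0// invrK.
by have := expR_ge1Dx (rho * `|X0 w|); lra.
Qed.

Lemma integrable_exp h : d%:R * `|h| <= rho ->
  P.-integrable A (EFin \o (fun w => expR (dotp (u + h) (X0 w)))).
Proof.
move=> hr; apply: (integrable_dominated uoo (c := 1)).
  exact: measurable_expX0.
move=> w; rewrite mul1r ger0_norm ?expR_ge0// ler_expR dotpDl.
have := dotp_le h (X0 w); rewrite ler_norml => /andP[_ h1].
have n0 := normr_ge0 (X0 w); nra.
Qed.

Lemma integrable_exp0 : P.-integrable A (EFin \o (fun w => expR (dotp u (X0 w)))).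
Proof.
by have := @integrable_exp 0; rewrite addr0; apply; rewrite normr0 mulr0 ltW.
Qed.

Lemma integrable_dotp_exp h :
  P.-integrable A (EFin \o (fun w => dotp h (X0 w) * expR (dotp u (X0 w)))).
Proof.
apply: (integrable_dominated uoo (c := d%:R * `|h| * rho^-1)).
  by apply: measurable_funM; [exact: measurable_dotpX|exact: measurable_expX0].
move=> w; rewrite normrM (ger0_norm (expR_ge0 _)) expRD mulrCA.
rewrite (mulrC (expR (dotp u _))) ler_wpM2r ?expR_ge0//.
rewrite (le_trans (dotp_le _ _))// -!mulrA ler_wpM2l// ler_wpM2l//.
Qed.

Lemma dotp_mom1 h :
  \int[P]_(w in A) (dotp h (X0 w) * expR (dotp u (X0 w))) = dotp h (mom1 S u).
Proof.
have ii (i : 'I_d) : P.-integrable A (EFin \o (fun w => h 0 i * (X0 w 0 i * expR (dotp u (X0 w))))).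
  have := @integrable_dotp_exp (h 0 i *: delta_mx 0 i).
  by under eq_fun do rewrite /= dotpZl dotp_delta -mulrA.
have ii1 (i : 'I_d) : P.-integrable A (EFin \o (fun w => (X0 w 0 i * expR (dotp u (X0 w))))).
  have := @integrable_dotp_exp (delta_mx 0 i).
  by under eq_fun do rewrite /= dotp_delta.
rewrite /Rintegral.
transitivity (fine (\int[P]_(w in A) (\sum_(i < d) (h 0 i * (X0 w 0 i * expR (dotp u (X0 w))))%:E))%E).
  congr fine; apply: eq_integral => w _; rewrite sumEFin; congr EFin.
  by rewrite mulr_suml; apply: eq_bigr => i _; rewrite mulrA.
rewrite integral_sum// -sum_fine; last first.
  by move=> i _; exact: (integrable_fin_num mA (ii i)).
by apply: eq_bigr => i _; rewrite mxE -(RintegralZl _ mA (ii1 i)).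
Qed.

Lemma normr_mom1 : `|mom1 S u| <= rho^-1 * fine (emom S u rho).
Proof.
apply: norm_leP => [|i].
  by rewrite mulr_ge0 ?invr_ge0 ?(ltW rho0)// fine_ge0// emom_ge0.
have ii1 : P.-integrable A (EFin \o (fun w => (X0 w 0 i * expR (dotp u (X0 w))))).
  have := @integrable_dotp_exp (delta_mx 0 i).
  by under eq_fun do rewrite /= dotp_delta.
have ie : P.-integrable A (EFin \o (fun w => expR (dotp u (X0 w) + rho * `|X0 w|))).
  apply: (integrable_dominated uoo (c := 1)); first exact: measurable_expX.
  by move=> w; rewrite mul1r ger0_norm ?expR_ge0.
rewrite mxE (le_trans (le_normr_Rintegral mA ii1))//.
rewrite (_ : fine _ = \int[P]_(w in A) expR (dotp u (X0 w) + rho * `|X0 w|))//.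
rewrite -RintegralZl//; apply: le_Rintegral => //.
- by have := integrable_norm ii1.
- by have := integrableZl mA rho^-1 ie.
move=> w _; rewrite normrM (ger0_norm (expR_ge0 _)) expRD mulrCA mulrC.
rewrite ler_wpM2l ?expR_ge0//.
by rewrite (le_trans _ (normX_exp w))// le_coord.
Qed.

(* [e^z >= e^c (1 + z - c)], integrated against [e^(u.X)]. *)
Lemma mgf_lower v c :
  ((expR c * (fine (mgf S u) * (1 - c) + dotp (v - u) (mom1 S u)))%:E <= mgf S v)%E.
Proof.
have [voo|] := ltP (mgf S v) +oo%E; last by rewrite leye_eq => /eqP ->; exact: leey.
have vfin : mgf S v \is a fin_num by rewrite ge0_fin_numE ?mgf_ge0.
rewrite -(fineK vfin) lee_fin -dotp_mom1 mulrC (mulrC (fine _)).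
have iu := integrable_exp0; have id := integrable_dotp_exp (v - u).
rewrite -[fine (mgf S u)]/(\int[P]_(w in A) expR (dotp u (X0 w))).
rewrite -RintegralZl// -RintegralD//; last exact: (integrableZl mA (1 - c) iu).
rewrite -RintegralZr//; last first.
  exact: (integrableD mA (integrableZl mA (1 - c) iu) id).
apply: le_Rintegral => //.
- have := integrableZr mA (expR c) (integrableD mA (integrableZl mA (1 - c) iu) id).
  exact.
- apply/integrableP; split.
    by apply: measurable_funTS; apply/measurable_EFinP; exact: measurable_expX0.
  apply: le_lt_trans voo; rewrite le_eqVlt; apply/orP; left; apply/eqP.
  by apply: eq_integral => w _ /=; rewrite ger0_norm// expR_ge0.
move=> w _; rewrite -mulrDl.
have -> : dotp v (X0 w) = dotp u (X0 w) + c + (dotp (v - u) (X0 w) - c).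
  by rewrite dotpBl; ring.
rewrite !expRD mulrAC (mulrC _ (expR (dotp u _))) -!mulrA ler_wpM2l ?expR_ge0//.
rewrite mulrC ler_wpM2l ?expR_ge0// -expRD.
by have := expR_ge1Dx (dotp (v - u) (X0 w) - c); lra.
Qed.

(** [expR_le_quad] is integrated with [z = h.X]. Since [|z| <= rho |X| / 2], half of the weight
    [e^(rho |X|)] pays for [e^|z|]; the other half pays for [z^2], because [sqr_le_expR] at
    [rho |X| / 2] gives [|X|^2 <= 16 / rho^2 * e^(rho |X| / 2)]. *)
Lemma mgf_upper h : d%:R * `|h| <= rho / 2 ->
  (mgf S (u + h) <= (fine (mgf S u) + dotp h (mom1 S u) +
     16 * d%:R ^+ 2 / rho ^+ 2 * fine (emom S u rho) * `|h| ^+ 2)%:E)%E.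
Proof.
move=> hr.
have hr' : d%:R * `|h| <= rho by apply: (le_trans hr); move: rho0; lra.
have ih := integrable_exp hr'.
have hfin : mgf S (u + h) \is a fin_num by exact: (integrable_fin_num mA ih).
have ie : P.-integrable A (EFin \o (fun w => expR (dotp u (X0 w) + rho * `|X0 w|))).
  apply: (integrable_dominated uoo (c := 1)); first exact: measurable_expX.
  by move=> w; rewrite mul1r ger0_norm ?expR_ge0.
set C := 16 * d%:R ^+ 2 / rho ^+ 2.
rewrite -(fineK hfin) lee_fin -dotp_mom1 mulrAC.
have iu := integrable_exp0; have id := integrable_dotp_exp h.
rewrite -[fine (mgf S u)]/(\int[P]_(w in A) expR (dotp u (X0 w))).
rewrite -[fine (emom _ _ _)]/(\int[P]_(w in A) expR (dotp u (X0 w) + rho * `|X0 w|)).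
rewrite -[fine (mgf _ _)]/(\int[P]_(w in A) expR (dotp (u + h) (X0 w))).
rewrite -RintegralD// -RintegralZl// -RintegralD//; last 2 first.
- exact: (integrableD mA iu id).
- exact: (integrableZl mA (C * `|h| ^+ 2) ie).
apply: le_Rintegral => //.
  exact: (integrableD mA (integrableD mA iu id) (integrableZl mA (C * `|h| ^+ 2) ie)).
move=> w _; rewrite dotpDl !expRD.
set e := expR (dotp u _); set z := dotp h _; have e0 : 0 < e := expR_gt0 _.
have -> : e + z * e + C * `|h| ^+ 2 * (e * expR (rho * `|X0 w|)) =
   e * (1 + z + C * `|h| ^+ 2 * expR (rho * `|X0 w|)) by ring.
rewrite ler_wpM2l ?(ltW e0)//; apply: (le_trans (expR_le_quad z)).
rewrite lerD2l.
set x := `|X0 w|; have x0 : 0 <= x := normr_ge0 _.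
have zx : `|z| <= d%:R * `|h| * x := dotp_le _ _.
have zx2 : `|z| <= rho / 2 * x by apply: (le_trans zx); rewrite ler_wpM2r.
have z2 : z ^+ 2 <= d%:R ^+ 2 * `|h| ^+ 2 * x ^+ 2.
  by rewrite -real_normK ?num_real// -!exprMn ler_sqr ?nnegrE// !mulr_ge0.
have x2 : x ^+ 2 <= 16 / rho ^+ 2 * expR (rho / 2 * x).
  have h0 : 0 <= rho / 2 * x by rewrite mulr_ge0// divr_ge0// ltW.
  have := sqr_le_expR h0; rewrite !exprMn exprVn => h1.
  rewrite -(@ler_pM2l _ (rho ^+ 2 / 2 ^+ 2)); last by rewrite divr_gt0// exprn_gt0.
  apply: (le_trans h1).
  rewrite le_eqVlt; apply/orP; left; apply/eqP; field.
  by rewrite gt_eqF.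
have -> : rho * x = rho / 2 * x + rho / 2 * x by field.
rewrite expRD.
have ez : expR `|z| <= expR (rho / 2 * x) by rewrite ler_expR.
have -> : C * `|h| ^+ 2 * (expR (rho / 2 * x) * expR (rho / 2 * x)) =
  (d%:R ^+ 2 * `|h| ^+ 2 * (16 / rho ^+ 2 * expR (rho / 2 * x))) * expR (rho / 2 * x).
  by rewrite /C; field; rewrite gt_eqF.
apply: ler_pM; [exact: sqr_ge0|exact: expR_ge0| |exact: ez].
apply: (le_trans z2); rewrite ler_wpM2l// mulr_ge0// exprn_ge0//.
Qed.

Hypothesis PA : (0 < P A)%E.

Lemma fine_mgf_gt0 : 0 < fine (mgf S u).
Proof.
rewrite fine_gt0// mgf_gt0//=.
by have := mgf_fin_num; rewrite ge0_fin_numE ?mgf_ge0.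
Qed.

Lemma expR_cgf : expR (cgf S u) = fine (mgf S u).
Proof. by rewrite lnK// posrE fine_mgf_gt0. Qed.

(** [mgf_lower] holds for every [c]; with [c] the tilted mean of [(v - u).X] its bracket collapses
    to the value at [u]. The exponential form allows an infinite value at [v]. *)
Lemma mgf_jensen v :
  ((expR (cgf S u + dotp (v - u) (cgrad S u)))%:E <= mgf S v)%E.
Proof.
apply: le_trans (mgf_lower v (dotp (v - u) (cgrad S u))).
rewrite expRD expR_cgf lee_fin dotpZr; have := fine_mgf_gt0.
set M := fine _ => M0; rewrite mulrC ler_wpM2l ?expR_ge0// le_eqVlt.
by apply/orP; left; apply/eqP; field; rewrite gt_eqF.
Qed.

Lemma cgf_jensen v : (mgf S v < +oo)%E ->
  cgf S u + dotp (v - u) (cgrad S u) <= cgf S v.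
Proof.
move=> voo; rewrite -[leLHS]expRK ler_ln ?posrE ?expR_gt0//; last first.
  by rewrite fine_gt0// mgf_gt0.
by rewrite -lee_fin fineK ?mgf_jensen// ge0_fin_numE ?mgf_ge0.
Qed.

(** The logarithm is taken through [ln y <= y - 1], with [y] the ratio of the values at [u + h] and
    [u]. *)
Lemma cgf_upper h : d%:R * `|h| <= rho / 2 ->
  cgf S (u + h) <= cgf S u + dotp h (cgrad S u) +
     16 * d%:R ^+ 2 / rho ^+ 2 * fine (emom S u rho) / fine (mgf S u) * `|h| ^+ 2.
Proof.
move=> hr; have := mgf_upper hr; have M0 := fine_mgf_gt0.
have hfin : mgf S (u + h) \is a fin_num.
  apply: (integrable_fin_num mA (@integrable_exp h _)).
  by apply: (le_trans hr); move: rho0; lra.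
rewrite -(fineK hfin) lee_fin dotpZr.
have N0 : 0 < fine (mgf S (u + h)) by rewrite fine_gt0// mgf_gt0// ltey_eq hfin.
set M := fine (mgf S u) in M0 *; set N := fine (mgf S (u + h)) in N0 *.
set C := _ / _ * _; set m := dotp _ _ => h1.
change (ln N <= ln M + M^-1 * m + C / M * `|h| ^+ 2).
have h2 : ln N - ln M <= N / M - 1.
  rewrite -ln_div ?posrE// -[X in ln X](subrKC 1) le_ln1Dx//.
  by rewrite ltrBrDl subrr divr_gt0.
have h3 : N / M - 1 <= M^-1 * m + C / M * `|h| ^+ 2.
  rewrite -(@ler_pM2r _ M)// mulrDl mulNr mul1r mulfVK ?gt_eqF//.
  have -> : (M^-1 * m + C / M * `|h| ^+ 2) * M = m + C * `|h| ^+ 2.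
    by field; rewrite gt_eqF.
  by lra.
lra.
Qed.

Lemma normr_cgrad : `|cgrad S u| <= (fine (mgf S u))^-1 * (rho^-1 * fine (emom S u rho)).
Proof.
rewrite normrZ ger0_norm ?invr_ge0 ?(ltW fine_mgf_gt0)// ler_wpM2l ?normr_mom1//.
by rewrite invr_ge0 ltW// fine_mgf_gt0.
Qed.

End AtPoint.
End OneSet.
End ExponentialMoments.

(** * Lipschitz functions on the unit interval and their Riemann sums *)

Section UnitInterval.
Context {R : realType}.
Implicit Types (g : R -> R) (L delta s t : R).
Local Notation I01 := (`[0%R, 1%R]%classic : set R).
Local Notation leb := (@lebesgue_measure R).

(** The scale [delta] is there because tilted means are shown to be Lipschitz only between nearby
    points, see [cgrad_lip]. *)
Definition locally_lipschitz01 g := exists delta L, [/\ 0 < delta, 0 <= L &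
  forall s t, I01 s -> I01 t -> `|s - t| <= delta -> `|g s - g t| <= L * `|s - t|].

Lemma locally_lipschitz01_within g :
  locally_lipschitz01 g -> {within I01, continuous g}.
Proof.
move=> [delta [L [d0 L0 gL]]]; apply/subspace_continuousP => t It.
apply/cvgrPdist_le => e e0; rewrite near_withinE.
near=> s => Is.
apply: (le_trans (gL t s It Is _)).
  by near: s; apply: cvgr_dist_le => //; exact: cvg_id.
apply: (@le_trans _ _ ((L + 1) * (e / (L + 1)))); last first.
  by rewrite mulrC divfK// gt_eqF// ltr_wpDl.
apply: ler_pM => //; first by rewrite lerDl.
near: s; apply: cvgr_dist_le; first exact: cvg_id.
by rewrite divr_gt0// ltr_wpDl.
Unshelve. all: by end_near. Qed.

Lemma locally_lipschitz01_integrable g :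
  locally_lipschitz01 g -> leb.-integrable I01 (EFin \o g).
Proof.
move=> /locally_lipschitz01_within cg.
by apply: continuous_compact_integrable => //; exact: segment_compact.
Qed.

Lemma lipschitz_locally01 g L : 0 <= L ->
  (forall s t, I01 s -> I01 t -> `|g s - g t| <= L * `|s - t|) ->
  locally_lipschitz01 g.
Proof. by move=> L0 gL; exists 1, L; split => // s t Is It _; exact: gL. Qed.

(** On a cell of length [1/n] the function moves by at most [L/n], so a cell costs [L/n^2] and all
    cells [L/n]; the factor [n] brings this to [L]. An error bounded in [n] becomes a mere constant
    factor after exponentiation. *)
Lemma riemann_sum_lipschitz g L n : 0 <= L ->
  (forall s t, I01 s -> I01 t -> `|g s - g t| <= L * `|s - t|) ->
  `|\sum_(k < n) g (k.+1%:R / n%:R) - n%:R * \int[leb]_(t in I01) g t| <= L.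
Proof.
move=> L0 gL; have [->|n0] := posnP n.
  by rewrite big_ord0 mul0r subr0 normr0.
have ig : leb.-integrable I01 (EFin \o g).
  by apply: locally_lipschitz01_integrable; exact: lipschitz_locally01 gL.
have n0' : 0 < n%:R :> R by rewrite ltr0n.
pose x (m : nat) : R := m%:R / n%:R.
have xn : x n = 1 by rewrite /x divff// gt_eqF.
have x_ge0 m : 0 <= x m by rewrite divr_ge0.
have x_le1 m : (m <= n)%N -> x m <= 1 by move=> mn; rewrite ler_pdivrMr// mul1r ler_nat.
have xS m : x m.+1 = x m + n%:R^-1 by rewrite /x -natr1 mulrDl mul1r.
have xx m : x m <= x m.+1 by rewrite xS lerDl invr_ge0.
have igm m : (m <= n)%N -> leb.-integrable `[0, x m] (EFin \o g).
  move=> mn; apply: integrableS ig => //.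
  by apply: subset_itvl; rewrite bnd_simp x_le1.
suff H m : (m <= n)%N -> `|\sum_(k < m) g (x k.+1) / n%:R -
    \int[leb]_(t in `[0, x m]) g t| <= m%:R * (L / n%:R ^+ 2).
  have := H n (leqnn n); rewrite xn -mulr_suml => h.
  rewrite -(@ler_pM2l _ (n%:R^-1)) ?invr_gt0//.
  rewrite -[X in X * `|_|]ger0_norm ?invr_ge0// -normrM mulrBr mulKf ?gt_eqF// mulrC.
  apply: (le_trans h); rewrite le_eqVlt; apply/orP; left; apply/eqP.
  by field; rewrite gt_eqF.
elim: m => [_|m IH mn].
  rewrite big_ord0 /x mul0r sub0r normrN mul0r.
  rewrite (_ : [set` `[0%R, 0%R]%R] = [set 0]) ?Rintegral_set1 ?normr0//.
  exact: set_itv1.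
have := @Rintegral_itvB _ g (BLeft 0) (BRight (x m.+1)) (x m) (igm _ mn).
rewrite !bnd_simp => /(_ (x_ge0 m) (xx m)) /eqP; rewrite subr_eq => /eqP ->.
rewrite big_ord_recr/=.
have iJ : leb.-integrable `]x m, x m.+1] (EFin \o g).
  apply: integrableS (igm _ mn) => //.
  by apply: subset_itvr; rewrite bnd_simp x_ge0.
have lebJ : leb `]x m, x m.+1]%classic = (n%:R^-1)%:E.
  rewrite lebesgue_measure_itv/= lte_fin xS ltrDl invr_gt0 n0'.
  by rewrite -EFinB addrC addKr.
have intcst (c : R) : \int[leb]_(t in `]x m, x m.+1]) (cst c t) = c / n%:R.
  rewrite Rintegral_cst//; congr (_ * _).
  by rewrite -[RHS]/(fine (n%:R^-1)%:E); congr fine; exact: lebJ.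
have icst (c : R) : leb.-integrable `]x m, x m.+1] (EFin \o cst c).
  have i01 : leb.-integrable I01 (EFin \o cst c).
    apply: locally_lipschitz01_integrable; apply: (@lipschitz_locally01 _ 0) => // *.
    by rewrite subrr normr0 mul0r.
  by apply: integrableS i01 => //; apply: subset_itv; rewrite bnd_simp ?x_ge0 ?x_le1.
have iJc := icst (g (x m.+1)).
have -> : g (x m.+1) / n%:R = \int[leb]_(t in `]x m, x m.+1]) (cst (g (x m.+1)) t).
  by rewrite intcst.
rewrite [X in `|_ - X|]addrC opprD addrACA (le_trans (ler_normD _ _))//.
rewrite -natr1 mulrDl mul1r lerD ?IH ?(ltnW mn)//.
rewrite -RintegralB// (le_trans (le_normr_Rintegral _ _))//.
  have := integrableB _ iJc iJ; exact.
apply: (@le_trans _ _ (\int[leb]_(t in `]x m, x m.+1]) (cst (L / n%:R) t))).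
  apply: le_Rintegral => //.
    exact: (integrable_norm (integrableB _ iJc iJ)).
  move=> t /=; rewrite in_itv /= => /andP[t1 t2].
  have It : I01 t.
    rewrite /= in_itv/= (le_trans (x_ge0 m) (ltW t1)) (le_trans t2)//; exact: x_le1.
  have Ix : I01 (x m.+1) by rewrite /= in_itv /= x_ge0 x_le1.
  apply: (le_trans (gL _ _ Ix It)); rewrite ler_wpM2l//.
  by rewrite ger0_norm ?subr_ge0// xS; move: t1; lra.
rewrite intcst le_eqVlt; apply/orP; left; apply/eqP.
by field; rewrite gt_eqF.
Qed.

End UnitInterval.

Section LinearArithmetic.
Context {R : realType}.
Implicit Types a b c x y z : R.

Lemma ler_half a : 0 < a -> a / 2 <= a. Proof. lra. Qed.

Lemma arith_quarter a b x y : a * y <= b / 4 -> a * x <= a * (2 * y) -> a * x <= b / 2.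
Proof. lra. Qed.

Lemma arith_grad a b c x y z q r :
  a + x <= b -> c + y <= a -> b <= c + (y + z) + q -> q <= r -> x - z <= r.
Proof. lra. Qed.

End LinearArithmetic.

(** * Constants uniform over bounded sets *)

Section UniformBounds.
Context {R : realType} {d : nat} {dT : measure_display}
  {T : measurableType dT} (P : probability T R) (X0 : T -> 'rV[R]_d).
Local Notation V := 'rV[R]_d.
Hypothesis mX0 : forall B, borelV B -> measurable (X0 @^-1` B).
Variables (S : set V) (bS : borelV S).
Hypothesis PS : (0 < P (X0 @^-1` S))%E.
Implicit Types (u v h : V) (rho C : R).

Local Notation mgf := (mgf P X0).
Local Notation cgf := (cgf P X0).
Local Notation emom := (emom P X0).
Local Notation cgrad := (cgrad P X0).

(** The constants are named so that one pair [rho], [C] can serve all points of a path. *)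
Definition quad_at rho C u :=
  [/\ (emom S u rho < +oo)%E, `|cgrad S u| <= C &
   forall h, d%:R * `|h| <= rho / 2 ->
     cgf S (u + h) <= cgf S u + dotp h (cgrad S u) + C * `|h| ^+ 2].

(** The bounds of [normr_cgrad] and [cgf_upper] divide by the moment generating function at [u]. The
    tangent at 0 bounds it below by [c] for all [u] with [|u| <= B], whence the exponential moment
    assumed at 0. *)
Lemma quad_at_unif rho0 rho C B : 0 < rho0 -> (emom S 0 rho0 < +oo)%E ->
  0 < rho ->
  exists C2, 0 <= C2 /\ forall u, `|u| <= B -> (emom S u rho <= C%:E)%E ->
    quad_at rho C2 u.
Proof.
move=> rho00 e0 rho_gt0.
set c := expR (cgf S 0 - d%:R * (B * `|cgrad S 0|)).
have c0 : 0 < c by exact: expR_gt0.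
pose C1 := 16 * d%:R ^+ 2 / rho ^+ 2 * `|C| / c.
pose C3 := c^-1 * (rho^-1 * `|C|).
have C10 : 0 <= C1 by rewrite /C1 !mulr_ge0// ?invr_ge0 ?exprn_ge0// ltW.
have C30 : 0 <= C3 by rewrite /C3 !mulr_ge0// ?invr_ge0 ?exprn_ge0// ltW.
exists (C1 + C3); split; first exact: addr_ge0.
move=> u uB uC.
have uoo : (emom S u rho < +oo)%E by exact: le_lt_trans uC (ltry _).
have efin : emom S u rho \is a fin_num by rewrite ge0_fin_numE ?emom_ge0.
have fe0 : 0 <= fine (emom S u rho) by rewrite fine_ge0 ?emom_ge0.
have feC : fine (emom S u rho) <= `|C|.
  by rewrite -lee_fin fineK// (le_trans uC)// lee_fin ler_norm.
have Mc : c <= fine (mgf S u).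
  rewrite -lee_fin fineK; last exact: (mgf_fin_num mX0 bS rho_gt0 uoo).
  apply: le_trans (mgf_jensen mX0 bS rho00 e0 PS u).
  rewrite lee_fin ler_expR lerD2l subr0.
  have := dotp_le u (cgrad S 0); rewrite ler_norml => /andP[+ _].
  apply: le_trans; rewrite lerN2 -mulrA ler_wpM2l// ler_wpM2r//.
have M0 : 0 < fine (mgf S u) by exact: lt_le_trans Mc.
have iMc : (fine (mgf S u))^-1 <= c^-1 by rewrite lef_pV2 ?posrE.
split => //.
  apply: (le_trans (normr_cgrad mX0 bS rho_gt0 uoo PS)).
  rewrite ler_wpDl// /C3; apply: ler_pM => //.
  - by rewrite invr_ge0 ltW.
  - by rewrite mulr_ge0// invr_ge0 ltW.
  - by rewrite ler_wpM2l// invr_ge0 ltW.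
move=> h hr; apply: (le_trans (cgf_upper mX0 bS rho_gt0 uoo PS hr)).
rewrite lerD2l ler_wpM2r ?sqr_ge0// ler_wpDr// /C1; apply: ler_pM => //.
- by rewrite !mulr_ge0// ?invr_ge0// ?exprn_ge0// ltW.
- by rewrite invr_ge0 ltW.
- by rewrite ler_wpM2l// !mulr_ge0// ?invr_ge0// ?exprn_ge0// ltW.
Qed.

Section Quad.
Variables (rho C : R) (rho0 : 0 < rho).

Lemma cgf_lip u v : quad_at rho C u -> quad_at rho C v ->
  `|cgf S u - cgf S v| <= d%:R * C * `|u - v|.
Proof.
move=> [u1 u2 _] [v1 v2 _].
have half a b : (emom S a rho < +oo)%E -> (emom S b rho < +oo)%E -> `|cgrad S a| <= C ->
    cgf S a - cgf S b <= d%:R * C * `|a - b|.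
  move=> a1 b1 ga.
  have := cgf_jensen mX0 bS rho0 a1 PS (mgf_lty mX0 bS (ltW rho0) b1).
  rewrite -opprB dotpNl => h.
  have := dotp_le (a - b) (cgrad S a); rewrite ler_norml => /andP[_ h2].
  have h3 : d%:R * `|a - b| * `|cgrad S a| <= d%:R * C * `|a - b|.
    by rewrite mulrAC ler_wpM2r// ler_wpM2l.
  by rewrite (le_trans _ h3)// (le_trans _ h2)// lerBlDl -lerBlDr.
rewrite ler_norml half// lerNl opprB distrC half//.
Qed.

(** A convex function with quadratic upper bounds has a Lipschitz gradient: the quadratic bound at
    [u] and the tangent at [v] are compared at [v + e], and the tangent at [u] is taken at [v]. What
    remains is [e.(cgrad v - cgrad u) <= C |v - u + e|^2]. *)
Lemma cgrad_lip u v : quad_at rho C u -> quad_at rho C v ->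
  d%:R * `|u - v| <= rho / 4 -> `|cgrad S u - cgrad S v| <= 4 * C * `|u - v|.
Proof.
move=> [u1 u2 u3] [v1 v2 v3] uv.
have C0 : 0 <= C by exact: le_trans u2.
set del := `|u - v|.
have [del0|del0] := eqVneq del 0.
  have /eqP : u - v = 0 by exact: normr0_eq0.
  by rewrite subr_eq0 => /eqP ->; rewrite subrr normr0 -/del del0 mulr0.
have delp : 0 < del by rewrite lt_def del0 normr_ge0.
apply: norm_leP => [|i]; first by rewrite mulr_ge0// ?mulr_ge0// ltW.
have key (s : R) : `|s| = 1 -> s * ((cgrad S v - cgrad S u) 0 i) <= 4 * C * del.
  move=> s1.
  (* A coordinate step as long as [|u - v|]: then [|v - u + e|] is at most twice that length, the
     range allowed by [rho / 4], and division by the length leaves the constant [4 C]. *)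
  pose e : V := (del * s) *: delta_mx 0 i.
  have ne : `|e| <= del.
    rewrite normrZ normrM s1 mulr1 (ger0_norm (ltW delp)) -[leRHS]mulr1.
    rewrite ler_wpM2l ?(ltW delp)//; apply: norm_leP => // j.
    by rewrite mxE; case: (_ && _); rewrite ?normr1 ?normr0.
  have nw : `|v - u + e| <= 2 * del.
    by apply: (le_trans (ler_normD _ _)); rewrite distrC -/del mulr_natl mulr2n lerD2l.
  have hr : d%:R * `|v - u + e| <= rho / 2.
    have h : d%:R * `|v - u + e| <= d%:R * (2 * del) by rewrite ler_wpM2l.
    exact: arith_quarter uv h.
  have up := u3 _ hr.
  have woo : (mgf S (u + (v - u + e)) < +oo)%E.
    apply: (@mgf_lty _ _ _ _ _ _ mX0 _ bS _ 0) => //.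
    apply: le_lt_trans (emom_shift P mX0 bS u 0 hr) _.
    by rewrite add0r; apply: (emom_lty_le mX0 bS) u1; exact: ler_half.
  have lo := cgf_jensen mX0 bS rho0 v1 PS woo.
  have lo2 := cgf_jensen mX0 bS rho0 u1 PS (mgf_lty mX0 bS (ltW rho0) v1).
  have e1 : u + (v - u + e) - v = e.
    by rewrite (addrA u) subrKC addrAC subrr add0r.
  rewrite e1 in lo; rewrite dotpDl in up.
  have nw2 : `|v - u + e| ^+ 2 <= 4 * del ^+ 2.
    have : `|v - u + e| ^+ 2 <= (2 * del) ^+ 2 by rewrite ler_sqr ?nnegrE// mulr_ge0// ltW.
    by rewrite exprMn -natrX.
  have h1 : dotp e (cgrad S v) - dotp e (cgrad S u) <= C * (4 * del ^+ 2).
    have h : C * `|v - u + e| ^+ 2 <= C * (4 * del ^+ 2) by rewrite ler_wpM2l.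
    exact: arith_grad lo lo2 up h.
  move: h1; rewrite -dotpBr /e dotpZl dotp_delta => h1.
  rewrite -(@ler_pM2l _ del)//.
  by rewrite mulrA (le_trans h1)// le_eqVlt; apply/orP; left; apply/eqP; ring.
have k1 := key 1 (normr1 _); have k2 := key (-1) (normrN1 _).
rewrite mul1r in k1; rewrite mulN1r in k2.
have -> : cgrad S u - cgrad S v = - (cgrad S v - cgrad S u) by rewrite opprB.
by rewrite mxE normrN ler_norml k1 andbT lerNl.
Qed.

End Quad.
End UniformBounds.

(** * The energy E_f along good paths *)

Section Integrable01.
Context {R : realType}.
Implicit Types (g : R -> R) (c : R).
Local Notation I01 := (`[0%R, 1%R]%classic : set R).
Local Notation leb := (@lebesgue_measure R).

Lemma integrable01Zl c g : leb.-integrable I01 (EFin \o g) ->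
  leb.-integrable I01 (EFin \o (fun t => c * g t)).
Proof. by move=> ig; apply: (integrableZl _ c ig). Qed.

Lemma integrable01D g1 g2 : leb.-integrable I01 (EFin \o g1) ->
  leb.-integrable I01 (EFin \o g2) ->
  leb.-integrable I01 (EFin \o (fun t => g1 t + g2 t)).
Proof. by move=> i1 i2; apply: (integrableD _ i1 i2). Qed.

Lemma integrable01_cst c : leb.-integrable I01 (EFin \o cst c).
Proof.
apply: locally_lipschitz01_integrable; apply: (@lipschitz_locally01 _ _ 0) => // *.
by rewrite subrr normr0 mul0r.
Qed.

Lemma Rintegral01_cst c : \int[leb]_(t in I01) (cst c t) = c.
Proof.
by rewrite Rintegral_cst//= lebesgue_measure_itv/= lte_fin ltr01 sube0 mulr1.
Qed.

End Integrable01.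

Lemma ler_dist_prod {R : realDomainType} (x y a b X B L M e : R) :
  `|x| <= X -> `|b| <= B -> `|a - b| <= L * e -> `|x - y| <= M * e ->
  `|x * a - y * b| <= (X * L + M * B) * e.
Proof.
move=> xX bB ab xy.
have -> : x * a - y * b = x * (a - b) + (x - y) * b by ring.
rewrite (le_trans (ler_normD _ _))// [leRHS]mulrDl !normrM.
rewrite -[X * L * e]mulrA [M * B * e]mulrAC.
by rewrite lerD// ler_pM.
Qed.

Lemma coordB {R : realType} {d : nat} (u v : 'rV[R]_d) i :
  (u - v) 0 i = u 0 i - v 0 i.
Proof. by rewrite !mxE. Qed.

Section Energy.
Context {R : realType} {d : nat} {dT : measure_display}
  {T : measurableType dT} (P : probability T R) (X0 : T -> 'rV[R]_d).
Local Notation V := 'rV[R]_d.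
Local Notation I01 := (`[0%R, 1%R]%classic : set R).
Local Notation leb := (@lebesgue_measure R).
Hypothesis mX0 : forall B, borelV B -> measurable (X0 @^-1` B).
Variables (S : set V) (bS : borelV S).
Hypothesis PS : (0 < P (X0 @^-1` S))%E.
Hypothesis adm0 : exists2 r : R, 0 < r & (emom P X0 S 0 r < +oo)%E.
Variables (f : R -> R) (Lf : R).
Hypothesis fL : forall s t, I01 s -> I01 t -> `|f s - f t| <= Lf * `|s - t|.
Implicit Types (l h u v : V) (rho C : R).

Local Notation mgf := (mgf P X0).
Local Notation cgf := (cgf P X0).
Local Notation emom := (emom P X0).
Local Notation cgrad := (cgrad P X0).
Local Notation quad_at := (quad_at P X0 S).

Definition good l := exists rho C, 0 < rho /\
  forall t, I01 t -> (emom S (f t *: l) rho <= C%:E)%E.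

Definition energy l : R := \int[leb]_(t in I01) cgf S (f t *: l).

(** The formal derivative under the integral sign, as a candidate only; [energy_jensen] and
    [energy_upper] enclose [energy] around it. *)
Definition energy_grad l : V :=
  \row_i \int[leb]_(t in I01) (f t * cgrad S (f t *: l) 0 i).

Let I0 : I01 0. Proof. by rewrite /= in_itv/= lexx ler01. Qed.
Let I1 : I01 1. Proof. by rewrite /= in_itv/= lexx ler01. Qed.

Let Lf0 : 0 <= Lf.
Proof. by have := fL I1 I0; rewrite subr0 normr1 mulr1; exact: le_trans. Qed.

Let F := `|f 0| + Lf.
Let F0 : 0 <= F. Proof. by rewrite addr_ge0. Qed.
Let fF t : I01 t -> `|f t| <= F.
Proof.
move=> It; have h := fL It I0.
rewrite -(subrK (f 0) (f t)) (le_trans (ler_normD _ _))// addrC lerD2l.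
apply: (le_trans h); rewrite -[leRHS]mulr1 ler_wpM2l//.
by move: It; rewrite /= in_itv/= subr0 => /andP[t0 t1]; rewrite ger0_norm.
Qed.

Lemma good0 : good 0.
Proof.
have [r r0 roo] := adm0.
exists r, (fine (emom S 0 r)); split => // t _.
by rewrite scaler0 fineK// ge0_fin_numE// emom_ge0.
Qed.

Lemma good_quad l : good l -> exists rho C, [/\ 0 < rho, 0 <= C &
  forall t, I01 t -> quad_at rho C (f t *: l)].
Proof.
move=> [rho [C [rho0 gl]]]; have [r r0 roo] := adm0.
have [C2 [C20 h]] := quad_at_unif mX0 bS PS C (F * `|l|) r0 roo rho0.
exists rho, C2; split => // t It; apply: h; last exact: gl.
by rewrite normrZ ler_wpM2r// fF.
Qed.

Let lip_path l s t : I01 s -> I01 t ->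
  `|f s *: l - f t *: l| <= Lf * `|l| * `|s - t|.
Proof.
move=> Is It; rewrite -scalerBl normrZ mulrAC ler_wpM2r//; exact: fL.
Qed.

Lemma cgf_path_lip l : good l -> exists2 L, 0 <= L &
  forall s t, I01 s -> I01 t ->
    `|cgf S (f s *: l) - cgf S (f t *: l)| <= L * `|s - t|.
Proof.
move=> /good_quad[rho [C [rho0 C0 q]]]; exists (d%:R * C * (Lf * `|l|)).
  by rewrite !mulr_ge0.
move=> s t Is It; apply: (le_trans (cgf_lip mX0 bS PS rho0 (q _ Is) (q _ It))).
rewrite -(mulrA (d%:R * C)) ler_wpM2l ?mulr_ge0//; exact: lip_path.
Qed.

Lemma cgf_path_integrable l : good l ->
  leb.-integrable I01 (EFin \o (fun t => cgf S (f t *: l))).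
Proof.
move=> /cgf_path_lip[L L0 h]; apply: locally_lipschitz01_integrable.
exact: (lipschitz_locally01 L0 h).
Qed.

Lemma cgrad_path_lip l i : good l ->
  locally_lipschitz01 (fun t => cgrad S (f t *: l) 0 i).
Proof.
move=> /good_quad[rho [C [rho0 C0 q]]].
(* Times at distance [rho / 4 / D] have path points within the range of [cgrad_lip]; the summand 1
   keeps [D] positive. *)
pose D := d%:R * (Lf * `|l|) + 1.
have D0 : 0 < D by rewrite ltr_wpDl// !mulr_ge0.
exists (rho / 4 / D), (4 * C * (Lf * `|l|)); split.
- by rewrite !divr_gt0.
- by rewrite !mulr_ge0.
move=> s t Is It st.
rewrite -coordB.
apply: (le_trans (le_coord _ _)).
have hp : d%:R * `|f s *: l - f t *: l| <= rho / 4.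
  apply: (@le_trans _ _ (D * `|s - t|)); last by rewrite mulrC -ler_pdivlMr.
  apply: (@le_trans _ _ (d%:R * (Lf * `|l| * `|s - t|))).
    by rewrite ler_wpM2l//; exact: lip_path.
  by rewrite mulrA ler_wpM2r// lerDl.
apply: (le_trans (cgrad_lip mX0 bS PS rho0 (q _ Is) (q _ It) hp)).
rewrite -(mulrA (4 * C)) ler_wpM2l ?mulr_ge0//; exact: lip_path.
Qed.

Lemma fcgrad_path_lip l i : good l ->
  locally_lipschitz01 (fun t => f t * cgrad S (f t *: l) 0 i).
Proof.
move=> gl; have [rho [C [rho0 C0 q]]] := good_quad gl.
have [delta [L [d0 L0 h]]] := cgrad_path_lip i gl.
exists delta, (F * L + Lf * C); split => //; first by rewrite addr_ge0 ?mulr_ge0.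
move=> s t Is It st.
apply: ler_dist_prod; [exact: fF| |exact: h|exact: fL].
by case: (q t It) => _ + _; apply: le_trans; exact: le_coord.
Qed.

Lemma fcgrad_path_integrable l h : good l ->
  leb.-integrable I01 (EFin \o (fun t => f t * dotp h (cgrad S (f t *: l)))).
Proof.
move=> gl.
have -> : EFin \o (fun t => f t * dotp h (cgrad S (f t *: l))) =
    (fun t => \sum_(i < d) (h 0 i * (f t * cgrad S (f t *: l) 0 i))%:E)%E.
  apply/funext => t; rewrite sumEFin /= mulr_sumr; congr EFin.
  by apply: eq_bigr => i _; rewrite mulrCA.
apply: integrable_sum => // i _.
exact: (integrable01Zl (h 0 i) (locally_lipschitz01_integrable (fcgrad_path_lip i gl))).
Qed.

Lemma dotp_energy_grad l h : good l ->
  dotp h (energy_grad l) = \int[leb]_(t in I01) (f t * dotp h (cgrad S (f t *: l))).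
Proof.
move=> gl.
have ii i := locally_lipschitz01_integrable (fcgrad_path_lip i gl).
rewrite /Rintegral.
transitivity (fine (\int[leb]_(t in I01)
   (\sum_(i < d) (h 0 i * (f t * cgrad S (f t *: l) 0 i))%:E))%E).
  rewrite integral_sum//; last first.
    by move=> i; exact: (integrable01Zl (h 0 i) (ii i)).
  rewrite -sum_fine; last first.
    move=> i _; apply: integrable_fin_num => //.
    exact: (integrable01Zl (h 0 i) (ii i)).
  apply: eq_bigr => i _; rewrite mxE.
  by rewrite -(RintegralZl (h 0 i) _ (ii i)).
congr fine; apply: eq_integral => t _; rewrite sumEFin mulr_sumr; congr EFin.
by apply: eq_bigr => i _; rewrite mulrCA.
Qed.

Lemma energy_riemann l : good l -> exists C, forall n,
  `|\sum_(k < n) cgf S (f (k.+1%:R / n%:R) *: l) - n%:R * energy l| <= C.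
Proof. by move=> /cgf_path_lip[L L0 h]; exists L => n; exact: (riemann_sum_lipschitz n L0 h). Qed.

Lemma energy_affine_integrable l h : good l ->
  leb.-integrable I01 (EFin \o (fun t => cgf S (f t *: l) + f t * dotp h (cgrad S (f t *: l)))).
Proof.
move=> gl; exact: integrable01D (cgf_path_integrable gl) (fcgrad_path_integrable h gl).
Qed.

Lemma energy_affine l h : good l -> energy l + dotp h (energy_grad l) =
  \int[leb]_(t in I01) (cgf S (f t *: l) + f t * dotp h (cgrad S (f t *: l))).
Proof.
move=> gl; rewrite dotp_energy_grad// /energy -RintegralD//.
- exact: cgf_path_integrable.
- exact: fcgrad_path_integrable.
Qed.

Lemma cgf_path_jensen l l' t : good l -> I01 t ->
  ((expR (cgf S (f t *: l) + f t * dotp (l' - l) (cgrad S (f t *: l))))%:E <=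
   mgf S (f t *: l'))%E.
Proof.
move=> /good_quad[rho [C [rho0 C0 q]]] It; have [q1 _ _] := q t It.
by rewrite -dotpZl scalerBr; exact: (mgf_jensen mX0 bS rho0 q1 PS).
Qed.

Lemma good_mgf_lty l t : good l -> I01 t -> (mgf S (f t *: l) < +oo)%E.
Proof.
move=> /good_quad[rho [C [rho0 C0 q]]] It; have [q1 _ _] := q t It.
exact: (mgf_lty mX0 bS (ltW rho0) q1).
Qed.

Lemma energy_jensen l l' : good l -> good l' ->
  energy l + dotp (l' - l) (energy_grad l) <= energy l'.
Proof.
move=> gl gl'; rewrite energy_affine//; apply: le_Rintegral => //.
- exact: energy_affine_integrable.
- exact: cgf_path_integrable.
move=> t It; have [rho [C [rho0 C0 q]]] := good_quad gl; have [q1 _ _] := q t It.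
rewrite -dotpZl scalerBr; apply: (cgf_jensen mX0 bS rho0 q1 PS).
exact: good_mgf_lty.
Qed.

Let shift_small r h t : I01 t -> `|h| <= r / 2 / (d%:R * F + 1) ->
  d%:R * `|f t *: h| <= r / 2.
Proof.
have D0 : 0 < d%:R * F + 1 by rewrite ltr_wpDl// mulr_ge0.
move=> It; rewrite ler_pdivlMr// => hd; apply: (le_trans _ hd).
rewrite normrZ mulrA mulrC ler_wpM2l//.
by rewrite (@le_trans _ _ (d%:R * F))//; [rewrite ler_wpM2l// fF|rewrite lerDl].
Qed.

Lemma good_shift l : good l -> exists2 delta, 0 < delta &
  forall h, `|h| <= delta -> good (l + h).
Proof.
have D0 : 0 < d%:R * F + 1 by rewrite ltr_wpDl// mulr_ge0.
move=> [r [C [r0 gl]]]; exists (r / 2 / (d%:R * F + 1)); first by rewrite !divr_gt0.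
move=> h hd; exists (r / 2), C; split; first by rewrite divr_gt0.
move=> t It; rewrite scalerDr.
apply: (le_trans (emom_shift P mX0 bS _ (r / 2) (shift_small It hd))).
by rewrite -splitr; exact: gl.
Qed.

Lemma energy_upper l : good l -> exists delta C, [/\ 0 < delta, 0 <= C &
  forall h, `|h| <= delta -> good (l + h) /\
    energy (l + h) <= energy l + dotp h (energy_grad l) + C * `|h| ^+ 2].
Proof.
move=> gl; have [rho [C [rho0 C0 q]]] := good_quad gl.
have [r r0 gs] := good_shift gl.
have D0 : 0 < d%:R * F + 1 by rewrite ltr_wpDl// mulr_ge0.
exists (Num.min r (rho / 2 / (d%:R * F + 1))), (C * F ^+ 2); split.
- by rewrite lt_min r0 !divr_gt0.
- by rewrite mulr_ge0// exprn_ge0.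
move=> h; rewrite le_min => /andP[hr hd].
have hf t : I01 t -> d%:R * `|f t *: h| <= rho / 2 by move=> It; exact: shift_small.
have gh := gs h hr.
split => //.
rewrite -(Rintegral01_cst (C * F ^+ 2 * `|h| ^+ 2)).
rewrite energy_affine// -RintegralD//; last 2 first.
- exact: energy_affine_integrable.
- exact: integrable01_cst.
apply: le_Rintegral => //.
- exact: cgf_path_integrable.
- exact: (integrable01D (energy_affine_integrable h gl) (integrable01_cst (C * F ^+ 2 * `|h| ^+ 2))).
move=> t It; have [_ _ q3] := q t It.
rewrite scalerDr (le_trans (q3 _ (hf t It)))// dotpZl lerD2l/=.
rewrite -mulrA ler_wpM2l// normrZ exprMn ler_wpM2r ?sqr_ge0//.
by rewrite ler_sqr ?nnegrE// fF.
Qed.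

End Energy.

(** * Truncation *)

Section EreaNear.
Context {R : realType} {I : Type} {F : set_system I} {FF : Filter F}.
Local Open Scope ereal_scope.

Lemma cvge_near_gt (u : I -> \bar R) (a l : \bar R) :
  u x @[x --> F] --> l -> a < l -> \forall x \near F, a < u x.
Proof.
move=> h al; apply: (h [set y | a < y]); apply: open_nbhs_nbhs; split => //.
exact: open_ereal_gt_ereal.
Qed.

Lemma cvge_near_lt (u : I -> \bar R) (a l : \bar R) :
  u x @[x --> F] --> l -> l < a -> \forall x \near F, u x < a.
Proof.
move=> h al; apply: (h [set y | y < a]); apply: open_nbhs_nbhs; split => //.
exact: open_ereal_lt_ereal.
Qed.

End EreaNear.

(** * Integrals of extended-valued functions with an integrable minorant *)

Section LowerBoundedIntegral.
Context {R : realType} d' (U : measurableType d')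
  (mu : {measure set U -> \bar R}) (D : set U) (mD : measurable D).
Variables (a : U -> R) (h : U -> \bar R).
Hypotheses (ia : mu.-integrable D (EFin \o a)) (mh : measurable_fun D h)
  (ah : forall x, D x -> ((a x)%:E <= h x)%E).
Local Open Scope ereal_scope.

Let ma : measurable_fun D (EFin \o a) := measurable_int mu ia.

Let neg_le : \int[mu]_(x in D) h^\- x <= \int[mu]_(x in D) (EFin \o a)^\- x.
Proof.
apply: ge0_le_integral => //; try exact: measurable_funeneg.
move=> x Dx; apply: (@funeneg_le _ _ D (EFin \o a) h); last by rewrite inE.
by move=> y; rewrite inE; exact: ah.
Qed.

Let neg_lty : \int[mu]_(x in D) h^\- x < +oo.
Proof. exact: le_lt_trans neg_le (integral_funeneg_lt_pinfty mD ia). Qed.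

(** The minorant bounds the negative part of [h], so positive and negative parts can be compared
    separately. This serves [Kbar] along a path, which is infinite outside the domain and may be
    negative inside. *)
Lemma le_integral_lower : \int[mu]_(x in D) (a x)%:E <= \int[mu]_(x in D) h x.
Proof.
rewrite [leLHS]integralE [leRHS]integralE; apply: leeB; last exact: neg_le.
apply: ge0_le_integral => //; try exact: measurable_funepos.
move=> x Dx; apply: (@funepos_le _ _ D (EFin \o a) h); last by rewrite inE.
by move=> y; rewrite inE; exact: ah.
Qed.

Lemma integrable_lower : \int[mu]_(x in D) h x < +oo -> mu.-integrable D h.
Proof.
move=> hoo; apply/integrableP; split => //.
have n0 : 0 <= \int[mu]_(x in D) h^\- x by apply: integral_ge0.
have nfin : \int[mu]_(x in D) h^\- x \is a fin_num by rewrite ge0_fin_numE.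
have pfin : \int[mu]_(x in D) h^\+ x < +oo.
  move: hoo; rewrite integralE => hoo.
  by rewrite -(subeK (\int[mu]_(x in D) h^\+ x) nfin) lte_add_pinfty.
have -> : \int[mu]_(x in D) `|h x| = \int[mu]_(x in D) h^\+ x + \int[mu]_(x in D) h^\- x.
  rewrite -ge0_integralD//; [|exact: measurable_funepos|exact: measurable_funeneg].
  by apply: eq_integral => x _; rewrite -[LHS]/((abse \o h) x) fune_abse.
exact: lte_add_pinfty.
Qed.

(** Valid for infinite values too: were the integral of [h] finite, [h] would be integrable, and so
    would [h - a]. It reduces monotone limits to nonnegative integrands. *)
Lemma integralD_lower : \int[mu]_(x in D) h x =
  \int[mu]_(x in D) (h x - (a x)%:E) + \int[mu]_(x in D) (a x)%:E.
Proof.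
have mha : measurable_fun D (fun x => h x - (a x)%:E) by exact: emeasurable_funB.
have ha0 x : D x -> 0 <= h x - (a x)%:E by move=> Dx; rewrite sube_ge0 ?ah.
have hE x : h x = (h x - (a x)%:E) + (a x)%:E by rewrite subeK.
have [hoo|] := ltP (\int[mu]_(x in D) (h x - (a x)%:E)) +oo.
  have i1 : mu.-integrable D (fun x => h x - (a x)%:E).
    apply/integrableP; split => //; apply: le_lt_trans hoo.
    rewrite le_eqVlt; apply/orP; left; apply/eqP; apply: eq_integral => x.
    by rewrite inE => Dx; rewrite gee0_abs ?ha0.
  by rewrite -integralD//; apply: eq_integral => x _; rewrite -hE.
rewrite leye_eq => /eqP hoo; rewrite hoo addye; last first.
  have := integrable_fin_num mD ia; by rewrite fin_numE => /andP[].
have [hlt|] := ltP (\int[mu]_(x in D) h x) +oo; last by rewrite leye_eq => /eqP.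
have ih := integrable_lower hlt.
have := integrable_fin_num mD (integrableB mD ih ia).
by rewrite [X in X \is a fin_num](_ : _ = +oo).
Qed.

End LowerBoundedIntegral.

Section Truncation.
Context {R : realType} {d : nat} {dT : measure_display}
  {T : measurableType dT} (P : probability T R) (X0 : T -> 'rV[R]_d).
Local Notation V := 'rV[R]_d.
Hypothesis mX0 : forall B, borelV B -> measurable (X0 @^-1` B).
Implicit Types (S : set V) (l h u v : V) (rho C : R) (M N : nat).

Local Notation mgf := (mgf P X0).
Local Notation cgf := (cgf P X0).
Local Notation emom := (emom P X0).

Lemma mgf0 S : borelV S -> mgf S 0 = P (X0 @^-1` S).
Proof.
move=> bS; transitivity (\int[P]_(w in X0 @^-1` S) 1%:E)%E.
  by apply: eq_integral => w _; rewrite dotp0l expR0.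
by rewrite integral_cst ?mul1e//; exact: mX0.
Qed.

Definition cube M : set V := [set x | `|x| <= M%:R].

Lemma borel_cube M : borelV (cube M).
Proof.
apply: borel_closed.
exact: (@closed_comp _ _ (fun x : V => `|x|) [set x | x <= M%:R]
  (fun x _ => @norm_continuous _ _ x) (@closed_le R M%:R)).
Qed.

Lemma cube_emom M u r : 0 <= r ->
  (emom (cube M) u r <= (expR ((d%:R * `|u| + r) * M%:R))%:E)%E.
Proof.
move=> r0.
apply: (@le_trans _ _ ((expR ((d%:R * `|u| + r) * M%:R))%:E * emom (cube M) 0 0)%E).
  apply: (emom_le P mX0 (borel_cube M)); first exact: expR_ge0.
  move=> w /= wM; rewrite dotp0l mul0r addr0 expR0 mulr1 ler_expR mulrDl lerD//.
    have := dotp_le u (X0 w); rewrite ler_norml => /andP[_ h].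
    by apply: (le_trans h); rewrite ler_wpM2l// mulr_ge0.
  by rewrite ler_wpM2l.
rewrite emom0 mgf0; last exact: borel_cube.
rewrite -[leRHS]mule1 lee_wpmul2l ?lee_fin ?expR_ge0 ?probability_le1//.
exact: (mX0 (borel_cube M)).
Qed.

Lemma cube_adm0 M : exists2 r : R, 0 < r & (emom (cube M) 0 r < +oo)%E.
Proof.
by exists 1 => //; apply: le_lt_trans (cube_emom M 0 ler01) _; exact: ltry.
Qed.

Lemma cube_good (f : R -> R) (F : R) M l :
  (forall t, `[0%R, 1%R]%classic t -> `|f t| <= F) -> good P X0 (cube M) f l.
Proof.
move=> fF; exists 1, (expR ((d%:R * (F * `|l|) + 1) * M%:R)); split => // t It.
apply: (le_trans (cube_emom M _ ler01)); rewrite lee_fin ler_expR ler_wpM2r//.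
by rewrite lerD2r ler_wpM2l// normrZ ler_wpM2r// fF.
Qed.

Lemma cube_mono M N : (M <= N)%N -> cube M `<=` cube N.
Proof. by move=> MN x /= xM; apply: (le_trans xM); rewrite ler_nat. Qed.

Lemma mgf_mono S S' u : borelV S -> borelV S' -> S `<=` S' ->
  (mgf S u <= mgf S' u)%E.
Proof.
move=> bS bS' SS'; apply: ge0_subset_integral => //; try exact: mX0.
- by apply: measurable_funTS; apply/measurable_EFinP; exact: measurable_expX0.
- by move=> w /= /SS'.
Qed.

Lemma mgf_cube_cvg u : mgf (cube M) u @[M --> \oo] --> Lap P X0 u.
Proof.
rewrite (_ : Lap P X0 u = \int[P]_(w in \bigcup_M (X0 @^-1` cube M)) (expR (dotp u (X0 w)))%:E)%E.
  apply: ge0_nondecreasing_set_cvg_integral.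
  - by move=> M N MN; apply/subsetPset => w; exact: cube_mono.
  - by move=> M; apply: mX0; exact: borel_cube.
  - by move=> M; apply: measurable_funTS; apply/measurable_EFinP; exact: measurable_expX0.
  - by move=> M w _; rewrite lee_fin expR_ge0.
rewrite /Lap; congr integral; apply/seteqP; split => // w _.
exists (Num.bound `|X0 w|) => //=.
by rewrite /cube /= ltW// archi_boundP.
Qed.

Lemma Lap_gt0 u : (0 < Lap P X0 u)%E.
Proof.
apply: (mgf_gt0 (S := setT) mX0 borel_setT).
by rewrite preimage_setT probability_setT lte01.
Qed.

(** The logarithm in [cgf (cube M)] has its meaning only when the cube carries mass; the truncation
    arguments start from such an [M0]. *)
Lemma cube_prob_gt0 : exists M0, forall M, (M0 <= M)%N -> (0 < P (X0 @^-1` cube M))%E.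
Proof.
have := @mgf_cube_cvg 0; rewrite (_ : Lap P X0 0 = 1%E); last first.
  by rewrite -[LHS]/(mgf setT 0) mgf0 ?preimage_setT ?probability_setT//; exact: borel_setT.
move=> h; have [M0 _ hM] : \forall M \near \oo, (0 < mgf (cube M) 0)%E.
  by apply: (cvge_near_gt h); rewrite lte01.
exists M0 => M M0M; have := hM M M0M; rewrite mgf0//; exact: borel_cube.
Qed.

Lemma mgf_cube_fin M u : mgf (cube M) u \is a fin_num.
Proof.
rewrite ge0_fin_numE ?mgf_ge0//.
apply: (mgf_lty mX0 (borel_cube M) ler01).
by apply: le_lt_trans (cube_emom M u ler01) _; exact: ltry.
Qed.

Lemma mgf_cube_gt0 M u : (0 < P (X0 @^-1` cube M))%E -> 0 < fine (mgf (cube M) u).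
Proof.
move=> PM; rewrite fine_gt0// (mgf_gt0 mX0 (borel_cube M))//=.
by have := mgf_cube_fin M u; rewrite ge0_fin_numE ?mgf_ge0.
Qed.

Lemma cgf_cube_mono M N u : (0 < P (X0 @^-1` cube M))%E -> (M <= N)%N ->
  cgf (cube M) u <= cgf (cube N) u.
Proof.
move=> PM MN; have sMN := mgf_mono u (borel_cube M) (borel_cube N) (cube_mono MN).
have f0 := mgf_cube_gt0 u PM.
have fMN : fine (mgf (cube M) u) <= fine (mgf (cube N) u).
  by rewrite fine_le ?mgf_cube_fin.
by rewrite ler_ln ?posrE// (lt_le_trans f0).
Qed.

Lemma Kbar_fin u : (Lap P X0 u < +oo)%E -> Kbar P X0 u = (cgf setT u)%:E.
Proof.
move=> uoo; have : Lap P X0 u \is a fin_num.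
  by rewrite ge0_fin_numE// ltW// Lap_gt0.
rewrite -[cgf setT u]/(ln (fine (Lap P X0 u))) /Kbar.
by case: (Lap P X0 u).
Qed.

Lemma Kbar_infty u : Lap P X0 u = +oo%E -> Kbar P X0 u = +oo%E.
Proof. by rewrite /Kbar => ->. Qed.

(** Outside the domain both sides are the default value 0, as [fine] of infinity and as [ln 0]. *)
Lemma Kr_cgf u : Kr P X0 u = cgf setT u.
Proof.
have [uoo|] := ltP (Lap P X0 u) +oo%E; first by rewrite /Kr Kbar_fin.
rewrite leye_eq => /eqP uoo; rewrite /Kr Kbar_infty//=.
by rewrite -[cgf setT u]/(ln (fine (Lap P X0 u))) uoo/= ln0.
Qed.

Lemma Kbar_lower u (r : R) : ((expR r)%:E <= Lap P X0 u)%E -> (r%:E <= Kbar P X0 u)%E.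
Proof.
rewrite /Kbar; case: (Lap P X0 u) => [s| |//]; last by move=> _; exact: leey.
by rewrite !lee_fin => rs; rewrite -[r]expRK ler_ln ?posrE ?expR_gt0// (lt_le_trans (expR_gt0 r)).
Qed.

Lemma cgf_cube_cvg u : (cgf (cube M) u)%:E @[M --> \oo] --> Kbar P X0 u.
Proof.
have [M0 PM] := cube_prob_gt0; have h := @mgf_cube_cvg u.
have [uoo|] := ltP (Lap P X0 u) +oo%E.
  rewrite Kbar_fin//.
  have f0 : 0 < fine (Lap P X0 u) by rewrite fine_gt0// Lap_gt0.
  have hf : fine (mgf (cube M) u) @[M --> \oo] --> fine (Lap P X0 u).
    by apply: fine_cvg; rewrite fineK// ge0_fin_numE// ltW// Lap_gt0.
  apply/fine_cvgP; split; first by near=> M.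
  exact: (cvg_comp _ _ hf (continuous_ln f0)).
rewrite leye_eq => /eqP uoo; rewrite Kbar_infty//; apply/cvgeyPge => A.
move: h; rewrite uoo => /cvgeyPge/(_ (expR A)) h.
near=> M; rewrite lee_fin -[A]expRK ler_ln ?posrE ?expR_gt0//; last first.
  by apply: mgf_cube_gt0; apply: PM; near: M; exact: nbhs_infty_ge.
by rewrite -lee_fin fineK ?mgf_cube_fin//; near: M.
Unshelve. all: by end_near. Qed.

Section Path.
Variables (f : R -> R) (Lf : R).
Local Notation I01 := (`[0%R, 1%R]%classic : set R).
Local Notation leb := (@lebesgue_measure R).
Hypothesis fL : forall s t, I01 s -> I01 t -> `|f s - f t| <= Lf * `|s - t|.

Lemma lipschitz01_bound : exists F, 0 <= F /\ forall t, I01 t -> `|f t| <= F.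
Proof.
have I0 : I01 0 by rewrite /= in_itv/= lexx ler01.
have I1 : I01 1 by rewrite /= in_itv/= lexx ler01.
have Lf0 : 0 <= Lf.
  by have := fL I1 I0; rewrite subr0 normr1 mulr1; exact: le_trans.
exists (`|f 0| + Lf); split; first exact: addr_ge0.
move=> t It; have h := fL It I0.
rewrite -(subrK (f 0) (f t)) (le_trans (ler_normD _ _))// addrC lerD2l.
apply: (le_trans h); rewrite -[leRHS]mulr1 ler_wpM2l//.
by move: It; rewrite /= in_itv/= subr0 => /andP[t0 t1]; rewrite ger0_norm.
Qed.

Lemma cube_good_path M l : good P X0 (cube M) f l.
Proof. by have [F [_ fF]] := lipschitz01_bound; exact: cube_good fF. Qed.

Local Notation energy M := (energy P X0 (cube M) f).

Lemma cube_path_integrable M l : (0 < P (X0 @^-1` cube M))%E ->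
  leb.-integrable I01 (EFin \o (fun t => cgf (cube M) (f t *: l))).
Proof.
move=> PM; apply: (cgf_path_integrable mX0 (borel_cube M) PM (cube_adm0 M) fL).
exact: cube_good_path.
Qed.

(** [Kbar] may jump to infinity along the path, but it is the pointwise limit of its truncated
    versions, which are Lipschitz in [t]. *)
Lemma measurable_Kbar_path l : measurable_fun I01 (fun t => Kbar P X0 (f t *: l)).
Proof.
have [M0 PM] := cube_prob_gt0.
apply: (@emeasurable_fun_cvg _ _ _ _ (fun M t => (cgf (cube (M + M0)%N) (f t *: l))%:E)).
  by move=> M; apply: (measurable_int leb); apply: cube_path_integrable; apply: PM; rewrite leq_addl.
by move=> t It; have := @cgf_cube_cvg (f t *: l); rewrite -(cvg_shiftn M0).
Qed.

Lemma cgf_cube_le_Kbar M u : (0 < P (X0 @^-1` cube M))%E ->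
  ((cgf (cube M) u)%:E <= Kbar P X0 u)%E.
Proof.
move=> PM; apply: Kbar_lower.
rewrite lnK ?posrE ?mgf_cube_gt0// fineK ?mgf_cube_fin//.
exact: (@mgf_mono _ setT u (borel_cube M) borel_setT (@subsetT _ _)).
Qed.

Lemma energy_cube_fin M l : (0 < P (X0 @^-1` cube M))%E ->
  ((energy M l)%:E = \int[leb]_(t in I01) (cgf (cube M) (f t *: l))%:E)%E.
Proof.
move=> PM; rewrite fineK//; apply: integrable_fin_num => //.
exact: cube_path_integrable.
Qed.

Lemma energy_cube_mono M N l : (0 < P (X0 @^-1` cube M))%E -> (M <= N)%N ->
  energy M l <= energy N l.
Proof.
move=> PM MN.
have PN : (0 < P (X0 @^-1` cube N))%E.
  apply: (lt_le_trans PM); apply: le_measure; rewrite ?inE.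
  - exact: (mX0 (borel_cube M)).
  - exact: (mX0 (borel_cube N)).
  - by move=> w; exact: cube_mono.
apply: le_Rintegral => //.
- exact: (cube_path_integrable _ PM).
- exact: (cube_path_integrable _ PN).
- by move=> t _; exact: cgf_cube_mono.
Qed.

Lemma energy_cube_le_Ef M l : (0 < P (X0 @^-1` cube M))%E ->
  ((energy M l)%:E <= Ef P X0 f l)%E.
Proof.
move=> PM; rewrite energy_cube_fin//; apply: le_integral_lower => //.
- exact: cube_path_integrable.
- exact: measurable_Kbar_path.
- by move=> t _; exact: cgf_cube_le_Kbar.
Qed.

(** Monotone convergence, after subtracting the first truncation [k0] of positive mass: it is
    integrable and makes all integrands nonnegative. The limit may be infinite. *)
Lemma energy_cube_cvg l : (energy M l)%:E @[M --> \oo] --> Ef P X0 f l.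
Proof.
have [M0 PM] := cube_prob_gt0; rewrite -(cvg_shiftn M0).
have PM0 M : (0 < P (X0 @^-1` cube (M + M0)))%E by apply: PM; rewrite leq_addl.
have P0 := PM0 0%N.
pose k0 t := cgf (cube (0 + M0)) (f t *: l).
have ik0 : leb.-integrable I01 (EFin \o k0) by exact: cube_path_integrable.
have k0_le t : I01 t -> ((k0 t)%:E <= Kbar P X0 (f t *: l))%E.
  by move=> _; exact: cgf_cube_le_Kbar.
rewrite /Ef (integralD_lower _ ik0 (measurable_Kbar_path l) k0_le)//.
have mcgf M : measurable_fun I01 (EFin \o (fun t => cgf (cube (M + M0)) (f t *: l))).
  by apply: (measurable_int leb); exact: cube_path_integrable.
pose g M t := ((cgf (cube (M + M0)) (f t *: l))%:E - (k0 t)%:E)%E.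
rewrite (_ : (fun M => _) = (fun M => \int[leb]_(t in I01) g M t + \int[leb]_(t in I01) (k0 t)%:E)%E); last first.
  apply/funext => M; rewrite energy_cube_fin//.
  apply: integralD_lower => //; first exact: mcgf.
  by move=> t _; rewrite lee_fin; apply: cgf_cube_mono => //; rewrite leq_add2r.
apply: cvgeD.
- by rewrite fin_num_adde_defl// integrable_fin_num.
- rewrite (_ : (\int[leb]_(t in I01) (_ - _))%E = (\int[leb]_(t in I01) limn (g ^~ t))%E); last first.
    apply: eq_integral => t _; apply/esym/cvg_lim => //.
    apply: cvgeB => //; last exact: cvg_cst.
      exact: fin_num_adde_defl.
    by have := @cgf_cube_cvg (f t *: l); rewrite -(cvg_shiftn M0).
  apply: cvg_monotone_convergence => //.
  - by move=> M; apply: emeasurable_funB; [exact: mcgf|exact: (measurable_int leb ik0)].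
  - move=> M t _; rewrite /g -EFinB lee_fin subr_ge0.
    by apply: cgf_cube_mono => //; rewrite leq_add2r.
  - move=> t _ M N MN; rewrite /g -!EFinB lee_fin lerD2r.
    by apply: cgf_cube_mono => //; rewrite leq_add2r.
- exact: cvg_cst.
Qed.

End Path.
End Truncation.

(** * The domain of E_f *)

Section MaxPos.
Context {R : realType}.
Local Notation I01 := (`[0%R, 1%R]%classic : set R).
Variables (f : R -> R) (F : R).
Hypothesis fF : forall t, I01 t -> `|f t| <= F.

Let I0 : I01 0. Proof. by rewrite /= in_itv/= lexx ler01. Qed.

Let hs : has_sup [set Num.max (f t) 0 | t in I01].
Proof.
split; first by exists (Num.max (f 0) 0), 0.
exists F => _ [t It <-]; rewrite ge_max (le_trans _ (fF It)) ?ler_norm//=.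
exact: le_trans (fF I0).
Qed.

Lemma max_fpos_ge0 : 0 <= max_fpos f.
Proof.
apply: (@le_trans _ _ (Num.max (f 0) 0)); first by rewrite le_max lexx orbT.
by apply: ub_le_sup; [case: hs|exists 0].
Qed.

Lemma le_max_fpos t : I01 t -> f t <= max_fpos f.
Proof.
move=> It; apply: (@le_trans _ _ (Num.max (f t) 0)); first by rewrite le_max lexx.
by apply: ub_le_sup; [case: hs|exists t].
Qed.

Lemma lt_max_fpos c : 0 <= c -> c < max_fpos f -> exists2 t, I01 t & c < f t.
Proof.
move=> c0 cm; have e0 : 0 < max_fpos f - c by rewrite subr_gt0.
have [_ [t It <-]] := sup_adherent e0 hs.
rewrite -/(max_fpos f) opprB addrC subrK lt_max => /orP[|c0']; first by exists t.
by move: c0'; rewrite ltNge c0.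
Qed.

End MaxPos.

Section SetDiv.
Context {R : realType} {d : nat}.
Local Notation V := 'rV[R]_d.
Implicit Types (C : set V) (a : R) (l : V).

Lemma interior_scale_preimage C a l : interior C (a *: l) -> \forall y \near l, C (a *: y).
Proof. by move=> h; exact: (@scaler_continuous _ V a l). Qed.

Lemma interior_set_div C a l : 0 <= a -> interior C 0 ->
  interior (set_div C a) l <-> interior C (a *: l).
Proof.
move=> a0 C0; rewrite /set_div; case: eqVneq => [->|an0].
  by rewrite scale0r; split => // _; exact: filterT.
have aK y : a^-1 *: (a *: y) = y :> V by rewrite scalerA mulVf ?scale1r.
split => [h|/interior_scale_preimage].
  have := @interior_scale_preimage [set a^-1 *: c | c in C] a^-1 (a *: l).
  rewrite aK => /(_ h); apply: filterS => y [c Cc].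
  by move=> /(scalerI (invr_neq0 an0)) <-.
by apply: filterS => y Cy; exists (a *: y); rewrite ?aK.
Qed.

Lemma interior_opp C l : interior [set - u | u in C] l <-> interior C (- l).
Proof.
have eN y : - y = -1 *: y :> V by rewrite scaleN1r.
split => [h|].
  have := @interior_scale_preimage [set - u | u in C] (-1) (- l).
  rewrite -eN opprK => /(_ h); apply: filterS => y; rewrite -eN => -[c Cc].
  by move=> /oppr_inj <-.
rewrite eN => /interior_scale_preimage; apply: filterS => y Cy.
by exists (-1 *: y) => //; rewrite -eN opprK.
Qed.

End SetDiv.

Lemma segment_weight {R : realType} (x p q : R) :
  0 < p + q -> - q <= x -> x <= p -> let s := (x + q) / (p + q) in
  0 <= s <= 1 /\ x = s * p - (1 - s) * q.
Proof.
move=> pq0 qx xp /=; split; last by field; rewrite gt_eqF.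
by rewrite divr_ge0 ?(ltW pq0) ?ler_pdivrMr//=; lra.
Qed.

Lemma segment_degenerate {R : realType} (x p q : R) :
  0 <= p -> 0 <= q -> p + q = 0 -> - q <= x -> x <= p -> x = p.
Proof. lra. Qed.

Section FullMoments.
Context {R : realType} {d : nat} {dT : measure_display}
  {T : measurableType dT} (P : probability T R) (X0 : T -> 'rV[R]_d).
Local Notation V := 'rV[R]_d.
Hypothesis mX0 : forall B, borelV B -> measurable (X0 @^-1` B).
Hypothesis int0 : interior (DL P X0) 0.
Implicit Types (l h u v : V) (rho C : R).

Local Notation mgfT := (mgf P X0 setT).
Local Notation cgfT := (cgf P X0 setT).
Local Notation emomT := (emom P X0 setT).

Lemma probT_gt0 : (0 < P (X0 @^-1` setT))%E.
Proof. by rewrite preimage_setT probability_setT lte01. Qed.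

(** The maximum norm of a nonzero [x] equals [x_i] or [- x_i] for some [i], so the left side is one
    of [2 d] exponentials. The first term covers [x = 0], hence also [d = 0]. *)
Lemma expR_norm_le u rho (x : V) : 0 <= rho ->
  expR (dotp u x + rho * `|x|) <= expR (dotp u x) +
   \sum_(i < d) (expR (dotp (u + rho *: delta_mx 0 i) x) +
                 expR (dotp (u - rho *: delta_mx 0 i) x)).
Proof.
move=> rho0.
have s0 (i : 'I_d) : 0 <= expR (dotp (u + rho *: delta_mx 0 i) x) +
   expR (dotp (u - rho *: delta_mx 0 i) x) by rewrite addr_ge0 ?expR_ge0.
have [->|xn0] := eqVneq `|x| 0.
  by rewrite mulr0 addr0 lerDl; apply: sumr_ge0 => i _; exact: s0.
have [[k i] /= xi] := mx_norm_neq0 xn0.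
apply: ler_wpDl; first exact: expR_ge0.
rewrite (bigD1 i)//= ler_wpDr//; first by apply: sumr_ge0 => j _; exact: s0.
rewrite !dotpDl dotpNl !dotpZl dotp_delta [`|x|]xi (ord1 k).
have [xi0|xi0] := leP 0 (x 0 i).
  by rewrite ger0_norm// lerDl expR_ge0.
by rewrite ltr0_norm// mulrN lerDr expR_ge0.
Qed.

Lemma interior_emom u : interior (DL P X0) u ->
  exists2 rho, 0 < rho & (emomT u rho < +oo)%E.
Proof.
move=> /nbhs_ballP[e /= e0 eD].
pose rho := e / 2; have rho0 : 0 < rho by rewrite divr_gt0.
have hD v : `|v| <= rho -> (mgfT (u + v) < +oo)%E.
  move=> vr; apply: eD; rewrite -ball_normE /ball_/= opprD addNKr normrN.
  by rewrite (le_lt_trans vr)// /rho ltr_pdivrMr// ltr_pMr// ltr1n.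
have nd (i : 'I_d) (s : R) : `|s| = 1 -> `|(s * rho) *: (delta_mx 0 i : V)| <= rho.
  move=> s1; rewrite normrZ normrM s1 mul1r (ger0_norm (ltW rho0)) -[leRHS]mulr1.
  rewrite ler_wpM2l ?(ltW rho0)//; apply: norm_leP => // j.
  by rewrite mxE; case: (_ && _); rewrite ?normr1 ?normr0.
have mE v : measurable_fun setT (fun w => (expR (dotp v (X0 w)))%:E).
  by apply/measurable_EFinP; exact: measurable_expX0.
have mS (i : 'I_d) : measurable_fun setT (fun w =>
   ((expR (dotp (u + rho *: delta_mx 0 i) (X0 w)))%:E +
    (expR (dotp (u - rho *: delta_mx 0 i) (X0 w)))%:E)%E).
  exact: emeasurable_funD.
have S0 (i : 'I_d) w : (0 <= (expR (dotp (u + rho *: delta_mx 0 i) (X0 w)))%:E +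
    (expR (dotp (u - rho *: delta_mx 0 i) (X0 w)))%:E)%E.
  by rewrite adde_ge0 ?lee_fin ?expR_ge0.
exists rho => //.
apply: (@le_lt_trans _ _ (\int[P]_w ((expR (dotp u (X0 w)))%:E +
  \sum_(i < d) ((expR (dotp (u + rho *: delta_mx 0 i) (X0 w)))%:E +
    (expR (dotp (u - rho *: delta_mx 0 i) (X0 w)))%:E)))%E).
  apply: ge0_le_integral => //.
  - by rewrite preimage_setT.
  - by apply: measurable_funTS; apply/measurable_EFinP; exact: measurable_expX.
  - by apply: emeasurable_funD => //; exact: emeasurable_sum.
  move=> w _; have := expR_norm_le u (X0 w) (ltW rho0).
  rewrite -lee_fin => /le_trans; apply.
  by rewrite EFinD -sumEFin; apply: leeD => //.
rewrite ge0_integralD//; last 2 first.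
- by move=> w _; apply: sume_ge0.
- exact: emeasurable_sum.
rewrite lte_add_pinfty//.
  by have := hD 0; rewrite addr0 normr0; apply; exact: ltW.
rewrite ge0_integral_sum//; apply: lte_sum_pinfty => i _.
rewrite ge0_integralD//.
rewrite lte_add_pinfty//.
  by have := hD (rho *: delta_mx 0 i); apply; have := nd i 1 (normr1 _); rewrite mul1r.
have := hD (- (rho *: delta_mx 0 i)); apply.
by have := nd i (-1) (normrN1 _); rewrite mulN1r scaleNr.
Qed.

Lemma adm0T : exists2 r : R, 0 < r & (emomT 0 r < +oo)%E.
Proof. exact: interior_emom. Qed.

Lemma DL_convex u v (s : R) : 0 <= s <= 1 -> DL P X0 u -> DL P X0 v ->
  DL P X0 ((1 - s) *: u + s *: v).
Proof.
move=> s01 Du Dv; rewrite /DL /= -[Lap _ _ _]/(mgfT _) -emom0.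
apply: le_lt_trans (emom_segment P mX0 borel_setT u v 0 s01) _.
by rewrite !emom0; apply: lte_add_pinfty; [exact: Du|exact: Dv].
Qed.

(** By convexity the domain contains the ball about 0 shrunk by [1 - s] and moved to [s v]; here [v]
    may lie on the boundary. *)
Lemma interior_DL_scale v (s : R) : 0 <= s < 1 -> DL P X0 v ->
  interior (DL P X0) (s *: v).
Proof.
move=> /andP[s0 s1] Dv.
have s10 : 0 < 1 - s by rewrite subr_gt0.
have /nbhs_ballP[e /= e0 eD] := int0.
apply/nbhs_ballP; exists ((1 - s) * e); first exact: mulr_gt0.
rewrite -ball_normE => y; rewrite /ball_/= distrC => yv.
have hy : DL P X0 ((1 - s)^-1 *: (y - s *: v)).
  apply: eD; rewrite -ball_normE /ball_/= sub0r normrN normrZ.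
  by rewrite ger0_norm ?invr_ge0 ?(ltW s10)// mulrC ltr_pdivrMr// mulrC.
have -> : y = (1 - s) *: ((1 - s)^-1 *: (y - s *: v)) + s *: v.
  by rewrite scalerA divff ?gt_eqF// scale1r subrK.
by apply: DL_convex => //; rewrite s0 ltW.
Qed.

Section Path.
Variables (f : R -> R) (Lf : R).
Local Notation I01 := (`[0%R, 1%R]%classic : set R).
Local Notation leb := (@lebesgue_measure R).
Hypothesis fL : forall s t, I01 s -> I01 t -> `|f s - f t| <= Lf * `|s - t|.

Local Notation good := (good P X0 setT f).
Local Notation energy := (energy P X0 setT f).
Local Notation energy_grad := (energy_grad P X0 setT f).
Local Notation a := (max_fpos f).
Local Notation b := (max_fneg f).

(** The interior of [D_f] with the division conventions unfolded: [a] and [- b] bound the values of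
    [f], and a vanishing factor leaves the true statement that 0 is interior. *)
Definition intD l := interior (DL P X0) (a *: l) /\ interior (DL P X0) (- (b *: l)).

Let fNL : forall s t, I01 s -> I01 t -> `|- f s - - f t| <= Lf * `|s - t|.
Proof. by move=> s t Is It; rewrite -opprD normrN; exact: fL. Qed.

Lemma a_ge0 : 0 <= a.
Proof. by have [F [_ fF]] := lipschitz01_bound fL; exact: max_fpos_ge0 fF. Qed.

Lemma b_ge0 : 0 <= b.
Proof. by have [F [_ fF]] := lipschitz01_bound fNL; exact: max_fpos_ge0 fF. Qed.

Lemma f_le_a t : I01 t -> f t <= a.
Proof. by have [F [_ fF]] := lipschitz01_bound fL; exact: (le_max_fpos fF). Qed.

Lemma f_ge_b t : I01 t -> - b <= f t.
Proof.
have [F [_ fF]] := lipschitz01_bound fNL => It.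
by rewrite lerNl; exact: (le_max_fpos fF).
Qed.

Lemma interior_Df l : interior (Df P X0 f) l <-> intD l.
Proof.
have nC0 : interior [set - u | u in DL P X0] 0 by apply/interior_opp; rewrite oppr0.
rewrite /Df interiorI /intD; split=> -[h1 h2]; split.
- exact: (iffLR (interior_set_div l a_ge0 int0) h1).
- exact: (iffLR (interior_opp _ _) (iffLR (interior_set_div l b_ge0 nC0) h2)).
- exact: (iffRL (interior_set_div l a_ge0 int0) h1).
- exact: (iffRL (interior_set_div l b_ge0 nC0) (iffRL (interior_opp _ _) h2)).
Qed.

(** As [- b <= f t <= a], the point [f t *: l] lies on the segment from [- (b *: l)] to [a *: l], so
    the sum of the moments at its ends bounds all moments along the path. If [a + b = 0] the segment
    is a single point. *)
Lemma intD_good l : intD l -> good l.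
Proof.
move=> [/interior_emom[r r0 ra] /interior_emom[q q0 qb]].
pose rho := Num.min r q.
have rho0 : 0 < rho by rewrite lt_min r0.
have ea : (emomT (a *: l) rho < +oo)%E by apply: (emom_lty_le mX0 borel_setT) ra; rewrite ge_min lexx.
have eb : (emomT (- (b *: l)) rho < +oo)%E by apply: (emom_lty_le mX0 borel_setT) qb; rewrite ge_min lexx orbT.
exists rho, (fine (emomT (- (b *: l)) rho) + fine (emomT (a *: l) rho)); split => // t It.
have fina : emomT (a *: l) rho \is a fin_num by rewrite ge0_fin_numE; [exact: ea|exact: emom_ge0].
have finb : emomT (- (b *: l)) rho \is a fin_num by rewrite ge0_fin_numE; [exact: eb|exact: emom_ge0].
have -> : (fine (emomT (- (b *: l)) rho) + fine (emomT (a *: l) rho))%:E =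
    (emomT (- (b *: l)) rho + emomT (a *: l) rho)%E.
  by rewrite EFinD; congr (_ + _)%E; [exact: fineK finb|exact: fineK fina].
have a0 := a_ge0; have b0 := b_ge0; have fa := f_le_a It; have fb := f_ge_b It.
have [ab0|ab0] := eqVneq (a + b) 0.
  have -> : f t *: l = a *: l by rewrite (segment_degenerate a0 b0 ab0 fb fa).
  by rewrite leeDr// emom_ge0.
have abp : 0 < a + b by rewrite lt_def ab0 addr_ge0.
pose s := (f t + b) / (a + b).
have [s01 fs] := segment_weight abp fb fa.
have -> : f t *: l = (1 - s) *: (- (b *: l)) + s *: (a *: l).
  by rewrite scalerN !scalerA -scaleNr -scalerDl addrC -fs.
exact: (emom_segment P mX0 borel_setT _ _ _ s01).
Qed.

Lemma Ef_good l : good l -> Ef P X0 f l = (energy l)%:E.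
Proof.
move=> gl; rewrite /Ef fineK; last first.
  by apply: integrable_fin_num => //; exact: (cgf_path_integrable mX0 borel_setT probT_gt0 adm0T fL).
apply: eq_integral => t; rewrite inE => It; rewrite Kbar_fin//.
exact: (good_mgf_lty mX0 borel_setT probT_gt0 adm0T fL gl It).
Qed.

Lemma Kbar_path_lower l l' t : good l -> I01 t ->
  ((cgfT (f t *: l) + f t * dotp (l' - l) (cgrad P X0 setT (f t *: l)))%:E
   <= Kbar P X0 (f t *: l'))%E.
Proof.
move=> gl It; apply: Kbar_lower => //.
exact: (cgf_path_jensen mX0 borel_setT probT_gt0 adm0T fL l' gl It).
Qed.

Lemma Ef_jensen l l' : good l ->
  ((energy l + dotp (l' - l) (energy_grad l))%:E <= Ef P X0 f l')%E.
Proof.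
move=> gl; rewrite (energy_affine mX0 borel_setT probT_gt0 adm0T fL)//.
have ia := energy_affine_integrable mX0 borel_setT probT_gt0 adm0T fL (l' - l) gl.
rewrite fineK; last exact: integrable_fin_num ia.
apply: le_integral_lower => //; first exact: (measurable_Kbar_path P mX0 fL _).
by move=> t It; exact: Kbar_path_lower.
Qed.

Lemma good0T : good 0.
Proof. by apply: good0; exact: adm0T. Qed.

Lemma energyT0 : energy 0 = 0.
Proof.
transitivity (\int[leb]_(t in I01) (cst 0 t : R)); last exact: Rintegral01_cst.
congr Rintegral; apply/funext => t.
rewrite scaler0 -[cgfT 0]/(ln (fine (mgfT 0))) (mgf0 P mX0 borel_setT).
by rewrite preimage_setT probability_setT/= ln1.
Qed.

Lemma Ef_integrable l : (Ef P X0 f l < +oo)%E ->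
  leb.-integrable I01 (fun t => Kbar P X0 (f t *: l)).
Proof.
have ia := energy_affine_integrable mX0 borel_setT probT_gt0 adm0T fL (l - 0) good0T.
move=> Eoo; apply: (integrable_lower _ ia) => //.
  exact: (measurable_Kbar_path P mX0 fL _).
by move=> t It; apply: Kbar_path_lower => //; exact: good0T.
Qed.

(** A finite integral makes [Kbar] finite for almost every [t], while by continuity [f > c] on an
    interval around [t0], clipped to the unit interval, of positive length; some [t] satisfies
    both. *)
Lemma Ef_finite_DL l (t0 c : R) : (Ef P X0 f l < +oo)%E -> I01 t0 -> c < f t0 ->
  exists t, [/\ I01 t, c < f t & DL P X0 (f t *: l)].
Proof.
move=> /Ef_integrable il It0 cf.
have [N [mN N0 hN]] : {ae leb, forall t, I01 t -> Kbar P X0 (f t *: l) \is a fin_num}.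
  exact: integrable_ae.
have [e e0 he] : exists2 e, 0 < e & forall t, I01 t -> `|t0 - t| < e -> c < f t.
  have Lp : 0 < `|Lf| + 1 by rewrite ltr_wpDl.
  exists ((f t0 - c) / (`|Lf| + 1)); first by rewrite divr_gt0// subr_gt0.
  move=> t It; rewrite ltr_pdivlMr// => te.
  have h1 := fL It0 It.
  have h2 : Lf * `|t0 - t| <= `|t0 - t| * (`|Lf| + 1).
    rewrite mulrC ler_wpM2l// (le_trans (ler_norm _))// lerDl//.
  have h3 := ler_norm (f t0 - f t).
  have : f t0 - f t < f t0 - c by rewrite (le_lt_trans h3)// (le_lt_trans h1)// (le_lt_trans h2).
  by rewrite ltrD2l ltrN2.
apply: contrapT => /forallNP h.
pose J := `](Num.max 0 (t0 - e)), (Num.min 1 (t0 + e))[%classic : set R.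
have JN : J `<=` N.
  move=> t; rewrite /J /= in_itv/= gt_max lt_min => /andP[/andP[t1 t2] /andP[t3 t4]].
  have It : I01 t by rewrite /= in_itv/= !ltW.
  apply: hN => /= /(_ It) fin.
  apply: (h t); split => //; first by apply: he => //; rewrite distrC ltr_distl t2.
  rewrite /DL/= ltNge leye_eq; apply/negP => /eqP Loo.
  by move: fin; rewrite Kbar_infty.
have : (leb J <= leb N)%E.
  by apply: le_measure; rewrite ?inE//; exact: measurable_itv.
rewrite N0 lebesgue_measure_itv/= lte_fin leNgt => /negP; apply.
have lt0 : Num.max 0 (t0 - e) < Num.min 1 (t0 + e).
  move: It0; rewrite /= in_itv/= => /andP[t00 t01].
  rewrite gt_max !lt_min ltr01/=; apply/andP; split; first lra.
  by apply/andP; split; lra.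
by rewrite lt0 -EFinB lte_fin subr_gt0.
Qed.

(** The maximum [a] may be attained only on a null set of times, so a time with [f t > s' a] is
    used, where [s'] lies strictly between [s] and 1. Then [(s a) l] is [f t *: l] scaled by a
    factor below 1, which makes it interior. *)
Lemma Ef_finite_scale l (s : R) : (Ef P X0 f l < +oo)%E -> 0 <= s < 1 ->
  interior (DL P X0) ((s * a) *: l).
Proof.
move=> Eoo /andP[s0 s1].
have [a0|an0] := eqVneq a 0; first by rewrite a0 mulr0 scale0r.
have ap : 0 < a by rewrite lt_def an0 a_ge0.
pose s' := (s + 1) / 2.
have s'0 : 0 < s' by rewrite /s'; lra.
have s'1 : s' < 1 by rewrite /s'; lra.
have [F [_ fF]] := lipschitz01_bound fL.
have [t0 It0 ft0] : exists2 t, I01 t & s' * a < f t.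
  apply: (lt_max_fpos fF); first by rewrite mulr_ge0 ?ltW.
  by rewrite -[ltRHS]mul1r ltr_pM2r.
have [t [It ft Dt]] := Ef_finite_DL Eoo It0 ft0.
have ft_gt0 : 0 < f t by apply: le_lt_trans ft; rewrite mulr_ge0 ?ltW.
have -> : (s * a) *: l = (s * a / f t) *: (f t *: l).
  by rewrite scalerA divfK// gt_eqF.
apply: interior_DL_scale => //; apply/andP; split.
  by apply: divr_ge0; [apply: mulr_ge0 => //; exact: ltW|exact: ltW].
rewrite ltr_pdivrMr// mul1r; apply: le_lt_trans ft.
by rewrite ler_pM2r// /s'; lra.
Qed.

End Path.

Lemma EfN (f : R -> R) l : Ef P X0 (fun t => - f t) (- l) = Ef P X0 f l.
Proof. by apply: eq_integral => t _; rewrite scaleNr scalerN opprK. Qed.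

Section Path2.
Variables (f : R -> R) (Lf : R).
Local Notation I01 := (`[0%R, 1%R]%classic : set R).
Hypothesis fL : forall s t, I01 s -> I01 t -> `|f s - f t| <= Lf * `|s - t|.

Let fNL : forall s t, I01 s -> I01 t -> `|- f s - - f t| <= Lf * `|s - t|.
Proof. by move=> s t Is It; rewrite -opprD normrN; exact: fL. Qed.

Lemma Ef_finite_intD l (s : R) : (Ef P X0 f l < +oo)%E -> 0 <= s < 1 -> intD f (s *: l).
Proof.
move=> Eoo s01; split.
  by rewrite scalerA mulrC; exact: (Ef_finite_scale fL).
have -> : - (max_fneg f *: (s *: l)) = (s * max_fneg f) *: (- l).
  by rewrite scalerA mulrC scalerN.
have E' : (Ef P X0 (fun t => - f t)%R (- l)%R < +oo)%E by rewrite EfN.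
exact: (Ef_finite_scale fNL E' s01).
Qed.

(** Convexity on the ray: the tangent at [s l] is taken at [l] and at 0, where the energy vanishes,
    and the two bounds are combined with weights [s] and [1 - s]. *)
Lemma energy_scale_le l (s e : R) : Ef P X0 f l = e%:E -> 0 <= s < 1 ->
  energy P X0 setT f (s *: l) <= s * e.
Proof.
move=> El s01.
have gs : good P X0 setT f (s *: l).
  by apply: (intD_good fL); apply: Ef_finite_intD => //; rewrite El ltry.
have := Ef_jensen fL l gs; rewrite El lee_fin.
have := Ef_jensen fL 0 gs; rewrite (Ef_good fL (good0T f)) energyT0 lee_fin.
rewrite sub0r dotpNl dotpBl !dotpZl.
move: (energy _ _ _ _ _) (dotp l _) s01 => E D /andP[s0 s1] h1 h2; nra.
Qed.

Lemma If_gt_intD (x : V) (alpha : R) : (alpha%:E < If P X0 f x)%E ->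
  exists l, intD f l /\ alpha < dotp l x - energy P X0 setT f l.
Proof.
move=> /ereal_sup_gt[_ [l _ <-]] h.
have [e El] : exists e, Ef P X0 f l = e%:E.
  have := Ef_jensen fL l (good0T f); move: h.
  by case: (Ef P X0 f l) => [e _ _| |]//; exists e.
have av : alpha < dotp l x - e by move: h; rewrite El -EFinB lte_fin.
set v := dotp l x - e in av.
(* The value at [s l] will be at least [s v]. Zero works when [alpha] is negative, in particular
   when [v <= 0]; otherwise [s] is the midpoint of [alpha / v] and 1. *)
have [s [s01 sv]] : exists s : R, 0 <= s < 1 /\ alpha < s * v.
  have [v0|v0] := leP v 0.
    by exists 0; rewrite lexx ltr01 mul0r; split => //; exact: lt_le_trans av v0.
  have [a0|a0] := ltP alpha 0; first by exists 0; rewrite lexx ltr01 mul0r.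
  exists ((alpha / v + 1) / 2); have h1 : alpha / v < 1 by rewrite ltr_pdivrMr// mul1r.
  have h0 : 0 <= alpha / v by rewrite divr_ge0// ltW.
  split; first by apply/andP; split; lra.
  by rewrite -ltr_pdivrMr//; lra.
exists (s *: l); split; first by apply: Ef_finite_intD => //; rewrite El ltry.
apply: (lt_le_trans sv); rewrite dotpZl /v mulrBr lerD2l lerN2.
exact: energy_scale_le.
Qed.

Lemma If_ge l (x : V) : good P X0 setT f l ->
  ((dotp l x - energy P X0 setT f l)%:E <= If P X0 f x)%E.
Proof.
by move=> gl; apply: ereal_sup_ubound; exists l => //; rewrite (Ef_good fL gl) EFinB.
Qed.

Lemma If_ge0 x : (0 <= If P X0 f x)%E.
Proof.
have := If_ge x (good0T f); rewrite dotp0l energyT0 subr0; exact.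
Qed.

End Path2.
End FullMoments.

(** * Large deviations *)

Lemma tilt_exponent {R : realType} (m q s e E E' c : R) :
  m * E' <= m * (E + q + s * (e / 2)) ->
  - (m * (q + s * e)) + (m * E' + c) <= c + (m * E - m * (s * e / 2)).
Proof. lra. Qed.

Lemma tilt_absorb {R : realType} (a b q p : R) :
  a * b <= q * p + a * (b / 2) -> b / 2 * a <= p * q.
Proof. lra. Qed.

Section WeightedSums.
Context {R : realType} {d : nat} {dT : measure_display}
  {T : measurableType dT} (P : probability T R) (X : nat -> T -> 'rV[R]_d).
Local Notation V := 'rV[R]_d.
Local Notation VB := (g_sigma_algebraType [set A : set V | open A]).
Local Notation I01 := (`[0%R, 1%R]%classic : set R).
Hypothesis iid : iid_rvecs P X.
Variables (f : R -> R) (Lf : R).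
Hypothesis fL : forall s t, I01 s -> I01 t -> `|f s - f t| <= Lf * `|s - t|.
Implicit Types (S : set V) (l h x y z : V) (n : nat).

Lemma iid_measurable k B : borelV B -> measurable (X k @^-1` B).
Proof. by case: iid => + _; exact. Qed.

Let mX0 B : borelV B -> measurable (X 0%N @^-1` B) := @iid_measurable 0%N B.

Local Notation mgf := (mgf P (X 0%N)).
Local Notation cgf := (cgf P (X 0%N)).
Local Notation good := (good P (X 0%N)).
Local Notation energy := (energy P (X 0%N)).
Local Notation energy_grad := (energy_grad P (X 0%N)).

Definition wsum n w : V := n%:R^-1 *: \sum_(k < n) (f (k.+1%:R / n%:R) *: X k w).

Lemma measurable_wsum n B : borelV B -> measurable (wsum n @^-1` B).
Proof.
apply: measurable_coords_preimage => i.
rewrite (_ : (fun w => _) = fun w => n%:R^-1 * \sum_(k < n) (f (k.+1%:R / n%:R) * X k w 0 i)).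
  apply: measurable_funM => //; apply: measurable_sum => k; apply: measurable_funM => //.
  exact: (measurable_comp_borel (@iid_measurable k) (@coord_continuous _ _ _ 0 i)).
apply/funext => w; rewrite /wsum mxE summxE; congr (_ * _).
by apply: eq_bigr => k _; rewrite mxE.
Qed.

Lemma dotp_wsum n l w : (0 < n)%N ->
  \sum_(k < n) dotp (f (k.+1%:R / n%:R) *: l) (X k w) = n%:R * dotp l (wsum n w).
Proof.
move=> n0; rewrite /wsum dotpZr mulrA divff ?mul1r ?pnatr_eq0 -?lt0n// dotp_sumr.
by apply: eq_bigr => k _; rewrite dotpZl dotpZr.
Qed.

(** The unnormalised density of the tilted law of the first [n] vectors, all confined to [S]; kept
    as a weight under [P], it plays the part of a change of measure. *)
Definition tilt S l n w : R :=
  \prod_(k < n) (\1_S (X k w) * expR (dotp (f (k.+1%:R / n%:R) *: l) (X k w))).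

Lemma tilt_ge0 S l n w : 0 <= tilt S l n w.
Proof. by apply: prodr_ge0 => k _; rewrite mulr_ge0// expR_ge0. Qed.

Lemma tiltD S l h n w : (0 < n)%N ->
  tilt S (l + h) n w = tilt S l n w * expR (n%:R * dotp h (wsum n w)).
Proof.
move=> n0; rewrite -dotp_wsum// expR_sum -big_split/=; apply: eq_bigr => k _.
by rewrite -mulrA -expRD scalerDr dotpDl.
Qed.

Lemma tilt_le S l n w : (0 < n)%N -> tilt S l n w <= expR (n%:R * dotp l (wsum n w)).
Proof.
move=> n0; rewrite -dotp_wsum// expR_sum; apply: ler_prod => k _.
rewrite mulr_ge0 ?expR_ge0//= -[leRHS]mul1r ler_wpM2r ?expR_ge0//.
Qed.

Lemma tiltT l n w : (0 < n)%N -> tilt setT l n w = expR (n%:R * dotp l (wsum n w)).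
Proof.
move=> n0; rewrite -dotp_wsum// expR_sum; apply: eq_bigr => k _.
by rewrite indicT mul1r.
Qed.

Lemma measurable_tilt S l n : borelV S -> measurable_fun setT (tilt S l n).
Proof.
move=> bS; apply: measurable_prod => k _; apply: measurable_funM.
  rewrite (_ : (fun w => _) = \1_(X k @^-1` S))//.
  by apply: measurable_indic; exact: iid_measurable.
exact: (measurable_expX0 (@iid_measurable k)).
Qed.

Section OneSet.
Variables (S : set V) (bS : borelV S).
Hypothesis PS : (0 < P (X 0%N @^-1` S))%E.
Hypothesis adm0 : exists2 r : R, 0 < r & (emom P (X 0%N) S 0 r < +oo)%E.

Let phi u (x : VB) : R := \1_S x * expR (dotp u x).

Let mphi u : measurable_fun setT (phi u).
Proof.
apply: measurable_funM; first exact: measurable_indic.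
have mid (B : set V) : borelV B -> measurable ((@id VB) @^-1` B) by [].
exact: (measurable_expX0 mid).
Qed.

Let phi_int u : (\int[P]_w (phi u (X 0%N w))%:E = mgf S u)%E.
Proof.
rewrite -[mgf S u]/(\int[P]_(w in X 0%N @^-1` S) (expR (dotp u (X 0%N w)))%:E)%E.
rewrite [RHS]integral_mkcond; apply: eq_integral => w _.
rewrite /phi /patch indicE.
have -> : (w \in X 0%N @^-1` S) = (X 0%N w \in S) by [].
by case: (_ \in S); rewrite ?mul1r ?mul0r.
Qed.

Lemma tilt_node n (k : 'I_n) : I01 (k.+1%:R / n%:R).
Proof.
have n0 : (0 < n)%N by exact: leq_ltn_trans (ltn_ord k).
rewrite /= in_itv/= divr_ge0//= ler_pdivrMr ?ltr0n// mul1r ler_nat; exact: ltn_ord.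
Qed.

Lemma tilt_integral l n : good S f l ->
  (\int[P]_w (tilt S l n w)%:E =
   (expR (\sum_(k < n) cgf S (f (k.+1%:R / n%:R) *: l)))%:E)%E.
Proof.
move=> gl.
(* [indep_integral] asks for finite integrals at all indices, but goodness speaks only of the nodes
   [k < n]; the other factors are set to 0. *)
pose ph (k : nat) : VB -> R := if (k < n)%N then phi (f (k.+1%:R / n%:R) *: l) else cst 0.
have mgf_fin (k : 'I_n) : (mgf S (f (k.+1%:R / n%:R) *: l) < +oo)%E.
  exact: (good_mgf_lty mX0 bS PS adm0 fL gl (tilt_node k)).
transitivity (\int[P]_w (\prod_(k < n) ph k (X k w))%:E)%E.
  apply: eq_integral => w _; congr EFin; apply: eq_bigr => -[k kn] _ /=.
  by rewrite /ph kn.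
rewrite (indep_integral iid).
- rewrite expR_sum -prodEFin; apply: eq_bigr => k _; rewrite /ph ltn_ord phi_int.
  rewrite lnK ?fineK//; last rewrite posrE fine_gt0// mgf_fin andbT.
    by rewrite ge0_fin_numE ?mgf_ge0.
  exact: mgf_gt0.
- by move=> k; rewrite /ph; case: ifP => // _; exact: mphi.
- move=> k x; rewrite /ph; case: ifP => // _.
  by rewrite /phi mulr_ge0 ?expR_ge0.
- move=> k; rewrite /ph; case: ifP => kn; last by rewrite integral0 ltry.
  by rewrite phi_int; exact: (mgf_fin (Ordinal kn)).
Qed.

(** The Riemann error is bounded in [n], so the total tilted mass is [e^(n energy)] up to constant
    factors, invisible at exponential speed. *)
Lemma tilt_integral_bounds l : good S f l -> exists C, forall n,
  ((expR (n%:R * energy S f l - C))%:E <= \int[P]_w (tilt S l n w)%:E <=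
   (expR (n%:R * energy S f l + C))%:E)%E.
Proof.
move=> gl; have [C hC] := energy_riemann mX0 bS PS adm0 fL gl.
exists C => n; rewrite tilt_integral// !lee_fin !ler_expR.
by have := hC n; rewrite ler_distl.
Qed.

End OneSet.

Lemma markov_tilt S l n B (c : R) : borelV S -> measurable B -> 0 <= c ->
  (forall w, B w -> c <= tilt S l n w) ->
  (c%:E * P B <= \int[P]_w (tilt S l n w)%:E)%E.
Proof.
move=> bS mB c0 cB.
rewrite -integral_cst//.
apply: (@le_trans _ _ (\int[P]_(w in B) (tilt S l n w)%:E)%E).
  apply: ge0_le_integral => //.
  - by apply: measurable_funTS; apply/measurable_EFinP; exact: measurable_tilt.
apply: ge0_subset_integral => //.
- by apply/measurable_EFinP; exact: measurable_tilt.
- by move=> w _; rewrite lee_fin tilt_ge0.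
Qed.

Section Upper.
Hypothesis int0 : interior (DL P (X 0%N)) 0.

Lemma chernoff_upper l (alpha : R) : good setT f l ->
  exists C, forall n, (0 < n)%N ->
  (P (wsum n @^-1` [set z | energy setT f l + alpha < dotp l z]%R) <=
   (expR (C - n%:R * alpha))%:E)%E.
Proof.
move=> gl.
have [C hC] := tilt_integral_bounds borel_setT (probT_gt0 P (X 0%N)) (adm0T mX0 int0) gl.
exists C => n n0; set B := wsum n @^-1` _.
have mB : measurable B by apply: measurable_wsum; apply: borel_open; exact: open_dotp.
set E := energy setT f l in B mB hC *.
have cB w : B w -> expR (n%:R * (E + alpha)) <= tilt setT l n w.
  by move=> /= Bw; rewrite tiltT// ler_expR ler_wpM2l// ltW.
have := markov_tilt borel_setT mB (expR_ge0 _) cB.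
have /andP[_ h] := hC n => /le_trans /(_ h) {}h.
have Pfin : P B \is a fin_num by exact: fin_num_measure.
rewrite -(fineK Pfin) lee_fin -(@ler_pM2l _ (expR (n%:R * (E + alpha)))) ?expR_gt0//.
rewrite -expRD -lee_fin EFinM fineK//; apply: (le_trans h).
by rewrite lee_fin ler_expR; lra.
Qed.

End Upper.

Section Lower.
Variables (S : set V) (bS : borelV S).
Hypothesis PS : (0 < P (X 0%N @^-1` S))%E.
Hypothesis adm0 : exists2 r : R, 0 < r & (emom P (X 0%N) S 0 r < +oo)%E.

Let dir (s : R) (j : 'I_d * bool) : V := (s * (-1) ^+ j.2) *: delta_mx 0 j.1.

Let normr_dir s j : 0 <= s -> `|dir s j| <= s.
Proof.
move=> s0; rewrite normrZ normrM normrX normrN1 expr1n mulr1 ger0_norm//.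
rewrite -[leRHS]mulr1 ler_wpM2l//; apply: norm_leP => // k.
by rewrite mxE; case: (_ && _); rewrite ?normr1 ?normr0.
Qed.

(* If [|Z_n - y| >= e], some exponential tilt in a direction [+-s e_i] exceeds 1. *)
Let tilt_split l y (e s : R) n w : (0 < n)%N -> 0 < e -> 0 <= s ->
  tilt S l n w <=
    expR (n%:R * (dotp l y + d%:R * `|l| * e)) * \1_(wsum n @^-1` ball y e) w +
    \sum_(j : 'I_d * bool) expR (- (n%:R * (dotp (dir s j) y + s * e))) *
        tilt S (l + dir s j) n w.
Proof.
move=> n0 e0 s0.
have sum0 (A : pred ('I_d * bool)) : 0 <= \sum_(j | A j)
    expR (- (n%:R * (dotp (dir s j) y + s * e))) * tilt S (l + dir s j) n w.
  by apply: sumr_ge0 => j _; rewrite mulr_ge0 ?expR_ge0 ?tilt_ge0.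
rewrite indicE; case: (boolP (w \in _)) => [|/negP]; rewrite inE/= -ball_normE /ball_/= => wB.
  rewrite mulr1 ler_wpDr// ?(sum0 predT)// (le_trans (tilt_le _ _ _ n0))//.
  rewrite ler_expR ler_wpM2l// -lerBlDl -dotpBr.
  apply: (le_trans (ler_norm _)); apply: (le_trans (dotp_le _ _)).
  by rewrite ler_wpM2l ?mulr_ge0// distrC ltW.
rewrite mulr0 add0r.
have /negP := wB; rewrite -leNgt => {}wB.
have [i hi] : exists i, e <= `|(wsum n w - y) 0 i|.
  apply: contrapT => /forallNP hN; move: wB; rewrite leNgt => /negP; apply.
  rewrite distrC; apply: norm_ltP => // i; rewrite ltNge; apply/negP; exact: hN.
pose b := ((wsum n w - y) 0 i < 0).
rewrite (bigD1 (i, b))//= ler_wpDr ?sum0//.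
rewrite tiltD// mulrCA -expRD -[leLHS]mulr1 ler_wpM2l ?tilt_ge0// -expR0 ler_expR.
rewrite addrC -mulrBr mulr_ge0// opprD addrA -dotpBr dotpZl dotp_delta -mulrA -mulrBr mulr_ge0//.
rewrite subr_ge0 (le_trans hi)// /b; case: ltP => h.
  by rewrite expr1 mulN1r ltr0_norm.
by rewrite expr0 mul1r ger0_norm.
Qed.

Let tilt_split_integral l y (e s : R) n : (0 < n)%N -> 0 < e -> 0 <= s ->
  (\int[P]_w (tilt S l n w)%:E <=
    (expR (n%:R * (dotp l y + d%:R * `|l| * e)))%:E * P (wsum n @^-1` ball y e) +
    \sum_(j : 'I_d * bool) (expR (- (n%:R * (dotp (dir s j) y + s * e))))%:E *
        \int[P]_w (tilt S (l + dir s j) n w)%:E)%E.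
Proof.
move=> n0 e0 s0.
have mB : measurable (wsum n @^-1` ball y e).
  by apply: measurable_wsum; apply: borel_open; exact: ball_open.
have mt h : measurable_fun setT (fun w => (tilt S h n w)%:E).
  by apply/measurable_EFinP; exact: measurable_tilt.
have mi : measurable_fun setT (fun w => (\1_(wsum n @^-1` ball y e) w : R)%:E).
  by apply/measurable_EFinP; exact: measurable_indic.
have -> : P (wsum n @^-1` ball y e) =
    (\int[P]_w (\1_(wsum n @^-1` ball y e) w)%:E)%E.
  by rewrite integral_indic// setIT.
rewrite -ge0_integralZl//.
under [in leRHS]eq_bigr => j _.
  rewrite -ge0_integralZl//; last by move=> w _; rewrite lee_fin tilt_ge0.
  over.
have t0 j w : (0 <= (expR (- (n%:R * (dotp (dir s j) y + s * e))))%:E *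
    (tilt S (l + dir s j) n w)%:E)%E.
  by rewrite mule_ge0 ?lee_fin ?expR_ge0 ?tilt_ge0.
have mtj j : measurable_fun setT (fun w => ((expR (- (n%:R * (dotp (dir s j) y + s * e))))%:E *
    (tilt S (l + dir s j) n w)%:E)%E) by exact: measurable_funeM.
rewrite -ge0_integral_sum// -ge0_integralD//; last 3 first.
- exact: measurable_funeM.
- by move=> w _; apply: sume_ge0.
- exact: emeasurable_sum.
apply: ge0_le_integral => //.
- by move=> w _; rewrite lee_fin tilt_ge0.
- by apply: emeasurable_funD; [exact: measurable_funeM|exact: emeasurable_sum].
move=> w _; have := tilt_split l y w n0 e0 s0; rewrite -lee_fin => /le_trans; apply.
by rewrite EFinD EFinM -sumEFin.
Qed.

Hypothesis allgood : forall l, good S f l.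

(** In the integrated splitting the left side is of order [e^(n E)]. Since [y] is the gradient at
    [l], the energy at [l + dir] exceeds [E + dir.y] by at most [C s^2 <= s e / 2], so each of the
    side terms is at most a constant times [e^(n E - n s e / 2)]. They are negligible, and the ball
    must carry the rest. *)
Lemma tilted_lower l y (e : R) : 0 < e -> y = energy_grad S f l ->
  exists c : R, 0 < c /\ \forall n \near \oo,
   ((c * expR (n%:R * (energy S f l - dotp l y - d%:R * `|l| * e)))%:E <=
    P (wsum n @^-1` ball y e))%E.
Proof.
move=> e0 yE.
have [del [C [del0 C0 upper]]] := energy_upper mX0 bS PS adm0 fL (allgood l).
(* Small enough for the quadratic error [C s^2] to use at most half of the linear gain [s e]. *)
pose s := Num.min del (e / 2 / (C + 1)).
have s0 : 0 < s by rewrite lt_min del0/= !divr_gt0// ltr_wpDl.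
have Cs : C * s <= e / 2.
  apply: (@le_trans _ _ ((C + 1) * (e / 2 / (C + 1)))).
    by apply: ler_pM => //; [exact: ltW|rewrite lerDl|rewrite ge_min lexx orbT].
  by rewrite mulrC divfK// gt_eqF// ltr_wpDl.
have [C1 hC1] := tilt_integral_bounds bS PS adm0 (allgood l).
pose Cj j := sval (cid (tilt_integral_bounds bS PS adm0 (allgood (l + dir s j)))).
have hCj j := svalP (cid (tilt_integral_bounds bS PS adm0 (allgood (l + dir s j)))).
set E := energy S f l in hC1 upper *.
pose D := \sum_(j : 'I_d * bool) expR (Cj j).
have D0 : 0 <= D by apply: sumr_ge0 => j _; exact: expR_ge0.
exists (expR (- C1) / 2); split; first by rewrite divr_gt0// expR_gt0.
(* From [N] on the side terms take at most half of the guaranteed mass [e^(- C1)]; the other half is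
   the constant of the lemma. *)
have [N hN] : exists N : nat, forall n, (N <= n)%N ->
    D * expR (- (n%:R * (s * e / 2))) <= expR (- C1) / 2.
  pose a := s * e / 2; have a0 : 0 < a by rewrite !divr_gt0// mulr_gt0.
  pose K := 2 * D * expR C1 / a; have K0 : 0 <= K by rewrite divr_ge0 ?mulr_ge0 ?expR_ge0// ltW.
  exists (Num.bound K) => n Kn.
  have h1 : 2 * D * expR C1 <= n%:R * a.
    rewrite -ler_pdivrMr//; apply: (le_trans (ltW (archi_boundP K0))).
    by rewrite ler_nat.
  have h2 : n%:R * a <= expR (n%:R * a).
    by apply: (le_trans _ (expR_ge1Dx _)); rewrite lerDr.
  have e1 := expR_gt0 (n%:R * a); have e2 := expR_gt0 C1.
  rewrite !expRN ler_pdivrMr//.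
  have -> : (expR C1)^-1 / 2 * expR (n%:R * a) = expR (n%:R * a) / (2 * expR C1).
    by field; rewrite gt_eqF.
  rewrite ler_pdivlMr ?mulr_gt0// (le_trans _ h2)// (le_trans _ h1)//.
  by rewrite mulrCA mulrA.
near=> n.
have n0 : (0 < n)%N by near: n; exact: nbhs_infty_gt.
have nN : (N <= n)%N by near: n; exact: nbhs_infty_ge.
have split := tilt_split_integral l y n0 e0 (ltW s0).
have /andP[lo _] := hC1 n.
have mB : measurable (wsum n @^-1` ball y e).
  by apply: measurable_wsum; apply: borel_open; exact: ball_open.
have Pfin : P (wsum n @^-1` ball y e) \is a fin_num by exact: fin_num_measure.
set p := fine (P (wsum n @^-1` ball y e)).
have pE : P (wsum n @^-1` ball y e) = p%:E by rewrite fineK.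
rewrite pE lee_fin.
have sumle : (\sum_(j : 'I_d * bool) (expR (- (n%:R * (dotp (dir s j) y + s * e))))%:E *
    \int[P]_w (tilt S (l + dir s j) n w)%:E <=
    (expR (n%:R * E) * (D * expR (- (n%:R * (s * e / 2)))))%:E)%E.
  rewrite mulrCA mulr_suml -sumEFin; apply: lee_sum => j _.
  have /andP[_ up] := hCj j n.
  apply: (@le_trans _ _ ((expR (- (n%:R * (dotp (dir s j) y + s * e))))%:E *
     (expR (n%:R * energy S f (l + dir s j) + Cj j))%:E)%E).
    by rewrite lee_wpmul2l// lee_fin expR_ge0.
  rewrite -EFinM lee_fin -!expRD ler_expR.
  have dd : `|dir s j| <= del by rewrite (le_trans (normr_dir j (ltW s0)))// ge_min lexx.
  have [_ Eup] := upper (dir s j) dd.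
  rewrite -yE in Eup.
  have h1 : C * `|dir s j| ^+ 2 <= s * (e / 2).
    apply: (@le_trans _ _ (C * s ^+ 2)).
      by rewrite ler_wpM2l// ler_sqr ?nnegrE ?normr_dir// ltW.
    by rewrite expr2 mulrA mulrC ler_wpM2l// ltW.
  have n0' : 0 <= n%:R :> R by [].
  have := ler_wpM2l n0' (le_trans Eup (lerD (lexx _) h1)).
  by move: (energy _ _ _) (dotp (dir s j) y) n%:R (Cj j) => E' q m c; exact: tilt_exponent.
have h : expR (n%:R * E - C1) <=
    expR (n%:R * (dotp l y + d%:R * `|l| * e)) * p + expR (n%:R * E) * (expR (- C1) / 2).
  rewrite -lee_fin; apply: (le_trans lo); apply: (le_trans split).
  rewrite pE -EFinM EFinD leeD2l//; apply: (le_trans sumle).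
  by rewrite lee_fin ler_wpM2l ?expR_ge0// hN.
move: h; set q := dotp l y + _; rewrite expRD => h.
have -> : n%:R * (E - dotp l y - d%:R * `|l| * e) = n%:R * E - n%:R * q.
  by rewrite /q; ring.
rewrite expRD [expR (- (n%:R * q))]expRN mulrA ler_pdivrMr ?expR_gt0//.
exact: tilt_absorb h.
Unshelve. all: by end_near. Qed.

End Lower.
End WeightedSums.

(** * From exponential estimates to limits of logarithms *)

Section LogRates.
Context {R : realType}.
Implicit Types (u : (\bar R)^nat) (p : nat -> \bar R) (b : \bar R).

Lemma limn_esup_near_le u b : (\forall n \near \oo, (u n <= b)%E) -> (limn_esup u <= b)%E.
Proof.
move=> [N _ hN]; rewrite limn_esup_lim; apply: lime_le; first exact: is_cvg_esups.
exists N => // n /= Nn; apply: ge_ereal_sup => _ [m /= nm <-].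
by apply: hN => /=; exact: leq_trans nm.
Qed.

Lemma limn_einf_near_ge u b : (\forall n \near \oo, (b <= u n)%E) -> (b <= limn_einf u)%E.
Proof.
move=> [N _ hN]; rewrite limn_einf_lim; apply: lime_ge; first exact: is_cvg_einfs.
exists N => // n /= Nn; apply: le_ereal_inf_tmp => _ [m /= nm <-].
by apply: hN => /=; exact: leq_trans nm.
Qed.

Lemma ln_over_n_small (K eta : R) : 0 < eta -> \forall n \near \oo, `|ln K| / n%:R <= eta.
Proof.
move=> eta0; near=> n.
have n0 : 0 < n%:R :> R by rewrite ltr0n; near: n; exact: nbhs_infty_gt.
rewrite ler_pdivrMr// -ler_pdivrMl// mulrC.
apply: (le_trans (ltW (archi_boundP _))); first by rewrite divr_ge0// ltW.
by rewrite ler_nat; near: n; exact: nbhs_infty_ge.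
Unshelve. all: by end_near. Qed.

Lemma rate_upper p (K alpha : R) : 0 < K -> (forall n, (0 <= p n)%E) ->
  (forall n, (0 < n)%N -> (p n <= (K * expR (- (n%:R * alpha)))%:E)%E) ->
  (limn_esup (fun n => (n%:R^-1)%:E * elog (p n)) <= (- alpha)%:E)%E.
Proof.
move=> K0 p0 h; apply/lee_addgt0Pr => eta eta0; apply: limn_esup_near_le; near=> n.
have n0 : (0 < n)%N by near: n; exact: nbhs_infty_gt.
have n0' : 0 < n%:R :> R by rewrite ltr0n.
have := h n n0; have := p0 n; case: (p n) => [q| |//]; last by rewrite leye_eq.
rewrite !lee_fin => q0 hq /=; case: ifP => [q1|_]; last first.
  by rewrite gt0_muleNy ?leNye// lte_fin invr_gt0.
rewrite -EFinM -EFinD lee_fin.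
have : ln q <= ln K + - (n%:R * alpha).
  by rewrite -[X in _ + X]expRK -lnM ?posrE ?expR_gt0// ler_ln ?posrE// mulr_gt0 ?expR_gt0.
have lnK : `|ln K| / n%:R <= eta by near: n; exact: ln_over_n_small.
rewrite ler_pdivrMr// in lnK.
move=> hln; rewrite mulrC ler_pdivrMr//; apply: (le_trans hln).
have := ler_norm (ln K); lra.
Unshelve. all: by end_near. Qed.

Lemma rate_lower p (c beta : R) : 0 < c ->
  (\forall n \near \oo, ((c * expR (- (n%:R * beta)))%:E <= p n)%E) ->
  ((- beta)%:E <= limn_einf (fun n => (n%:R^-1)%:E * elog (p n)))%E.
Proof.
move=> c0 h; apply/lee_subgt0Pr => eta eta0; apply: limn_einf_near_ge; near=> n.
have n0 : (0 < n)%N by near: n; exact: nbhs_infty_gt.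
have n0' : 0 < n%:R :> R by rewrite ltr0n.
have : ((c * expR (- (n%:R * beta)))%:E <= p n)%E by near: n.
have ce : 0 < c * expR (- (n%:R * beta)) by rewrite mulr_gt0 ?expR_gt0.
case: (p n) => [q| |//] hq /=; last by rewrite gt0_muley ?leey// lte_fin invr_gt0.
rewrite lee_fin in hq; have q0 : 0 < q by exact: lt_le_trans hq.
rewrite q0 -EFinM -EFinB lee_fin.
have : ln c + - (n%:R * beta) <= ln q.
  by rewrite -[X in _ + X]expRK -lnM ?posrE ?expR_gt0// ler_ln ?posrE.
have lnc : `|ln c| / n%:R <= eta by near: n; exact: ln_over_n_small.
rewrite ler_pdivrMr// in lnc.
move=> hln; rewrite [leRHS]mulrC ler_pdivlMr//; apply: (le_trans _ hln).
have := ler_norm (- ln c); rewrite normrN; lra.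
Unshelve. all: by end_near. Qed.

End LogRates.

Section QuadraticGrowth.
Context {R : realType}.
Implicit Types a c del t : R.

Lemma quad_growth a c del : 0 <= a -> 0 < del ->
  exists2 r : R, 0 < r & forall t, r < t -> a * t + c < del * t ^+ 2.
Proof.
(* The summand 1 forces [t > 1], so that [a t + c <= (a + |c|) t]. *)
move=> a0 del0; pose r := (a + `|c|) / del + 1.
have r1 : 1 <= r by rewrite lerDr divr_ge0 ?addr_ge0// ltW.
exists r => [|t rt]; first exact: lt_le_trans r1.
have t1 : 1 < t by exact: le_lt_trans rt.
have h : a + `|c| < del * t.
  rewrite mulrC -ltr_pdivrMr//; apply: le_lt_trans rt; rewrite lerDl//.
have := ler_norm c; have := normr_ge0 c; nra.
Qed.

Lemma sqr_scale16 a c : 16 * a * (a * c) = (4 * a) ^+ 2 * c.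
Proof. ring. Qed.

End QuadraticGrowth.

(** * The tilt for the lower bound *)

Section Tilting.
Context {R : realType} {d : nat} {dT : measure_display}
  {T : measurableType dT} (P : probability T R) (X0 : T -> 'rV[R]_d).
Local Notation V := 'rV[R]_d.
Local Notation I01 := (`[0%R, 1%R]%classic : set R).
Hypothesis mX0 : forall B, borelV B -> measurable (X0 @^-1` B).
Hypothesis int0 : interior (DL P X0) 0.
Variables (f : R -> R) (Lf : R).
Hypothesis fL : forall s t, I01 s -> I01 t -> `|f s - f t| <= Lf * `|s - t|.
Implicit Types (l h x y z : V) (M : nat).

Local Notation energy M := (energy P X0 (cube M) f).
Local Notation energy_grad M := (energy_grad P X0 (cube M) f).
Local Notation cube_pos M := (0 < P (X0 @^-1` cube M))%E.

Lemma energy_cube_jensen M l l' : cube_pos M ->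
  energy M l + dotp (l' - l) (energy_grad M l) <= energy M l'.
Proof.
move=> PM; apply: (energy_jensen mX0 (borel_cube M) PM (cube_adm0 P mX0 M) fL).
- exact: (cube_good_path P mX0 fL).
- exact: (cube_good_path P mX0 fL).
Qed.

Lemma energy_cube_upper M l : cube_pos M -> exists delta C, [/\ 0 < delta, 0 <= C &
  forall h, `|h| <= delta ->
    energy M (l + h) <= energy M l + dotp h (energy_grad M l) + C * `|h| ^+ 2].
Proof.
move=> PM.
have [del [C [d0 C0 h]]] := energy_upper mX0 (borel_cube M) PM (cube_adm0 P mX0 M) fL
  (cube_good_path P mX0 fL M l).
by exists del, C; split => // k /h[].
Qed.

Lemma energy_cube_continuous M : cube_pos M -> continuous (energy M).
Proof.
move=> PM l; have [del [C [d0 C0 up]]] := energy_cube_upper l PM.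
apply: (iffRL (@cvgrPdist_le _ _ _ (nbhs l) (nbhs_filter l) _ _)) => e e0.
pose D := d%:R * `|energy_grad M l| + C.
have D0 : 0 <= D by rewrite addr_ge0// mulr_ge0.
have D1 : 0 < D + 1 by rewrite ltr_wpDl.
apply/nbhs_ballP; exists (Num.min (Num.min del 1) (e / (D + 1))).
  by rewrite /= !lt_min d0 ltr01 divr_gt0.
move=> k; rewrite -ball_normE /ball_/= !lt_min => /andP[/andP[k1 k2] k3].
pose h := k - l; have kE : k = l + h by rewrite addrC subrK.
have hn : `|h| = `|l - k| by rewrite distrC.
have lo := energy_cube_jensen l k PM.
have hd : `|h| <= del by rewrite hn ltW.
have := up h hd; rewrite -kE -/h in lo * => hi.
have dp := dotp_le h (energy_grad M l).
have h2 : C * `|h| ^+ 2 <= C * `|h|.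
  by rewrite ler_wpM2l// expr2 -[leRHS]mulr1 ler_wpM2l// hn ltW.
have key : (D + 1) * `|h| <= e.
  by rewrite mulrC -ler_pdivlMr// hn ltW.
rewrite distrC; apply: le_trans key.
have DhE : (D + 1) * `|h| = d%:R * `|h| * `|energy_grad M l| + C * `|h| + `|h|.
  by rewrite /D; ring.
rewrite DhE; have h0 := normr_ge0 h.
have h20 : 0 <= C * `|h| ^+ 2 by rewrite mulr_ge0// sqr_ge0.
move: lo hi dp h2 h0 h20; rewrite !ler_norml.
move: (energy M k) (energy M l) (dotp h (energy_grad M l)) (C * `|h| ^+ 2) (C * `|h|)
  (d%:R * `|h| * `|energy_grad M l|) `|h|.
by move=> A B Q W W' W'' n lo hi /andP[q1 q2] h2 h0 h20; apply/andP; split; lra.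
Qed.

Lemma energy_cube0 M : cube_pos M -> energy M 0 <= 0.
Proof.
move=> PM; rewrite -lee_fin; apply: (le_trans (energy_cube_le_Ef mX0 fL 0 PM)).
by rewrite (Ef_good mX0 int0 fL (good0T mX0 int0 f)) energyT0.
Qed.

(** The minorant comes from the tangent at 0 of the smaller truncation, hence is the same for all
    larger [N]. *)
Lemma energy_cube_linear_lower M N l : cube_pos M -> (M <= N)%N ->
  energy M 0 - d%:R * `|energy_grad M 0| * `|l| <= energy N l.
Proof.
move=> PM MN; apply: le_trans (energy_cube_mono mX0 fL l PM MN).
apply: le_trans (energy_cube_jensen 0 l PM); rewrite subr0 lerD2l.
have := dotp_le l (energy_grad M 0); rewrite ler_norml => /andP[+ _].
by rewrite mulrAC.
Qed.

(* Compactness replaces the pointwise limit [energy M --> Ef] by a bound uniform in [l]. *)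
Lemma uniform_truncation x (beta del : R) : (If P X0 f x < beta%:E)%E -> 0 < del ->
  exists M, cube_pos M /\
    forall l, dotp l x - energy M l - del * dotp l l < beta.
Proof.
move=> Ib del0.
have beta0 : 0 < beta.
  by rewrite -lte_fin; apply: le_lt_trans Ib; exact: (If_ge0 mX0 int0 fL).
have [M0 PM] := cube_prob_gt0 P mX0.
have PM0 := PM M0 (leqnn _).
have [r r0 hr] := @quad_growth R (d%:R * `|x| + d%:R * `|energy_grad M0 0|)
  (- energy M0 0) del (addr_ge0 (mulr_ge0 (ler0n _ _) (normr_ge0 _)) (mulr_ge0 (ler0n _ _) (normr_ge0 _))) del0.
(* Outside the ball of radius [r] the penalty beats the linear terms, for all [M >= M0] at once. *)
have far M l : (M0 <= M)%N -> r < `|l| -> dotp l x - energy M l - del * dotp l l < beta.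
  move=> M0M rl; have := hr _ rl; have := energy_cube_linear_lower l PM0 M0M.
  have := dotp_le l x; rewrite ler_norml => /andP[_].
  have : del * `|l| ^+ 2 <= del * dotp l l by rewrite ler_wpM2l ?sqr_norm_le_dotp// ltW.
  move: (energy M l) (energy M0 0) `|l| `|x| (dotp l x) (dotp l l) `|_ : V| beta0.
  by move=> A B n m D E g b0 h1 h2 h3 h4; nra.
pose K : set V := [set l | `|l| <= r].
have cK : compact K.
  apply: bounded_closed_compact.
    by exists r; split; [exact: num_real|move=> s rs l /= lr; exact: le_trans (ltW rs)].
  exact: (@closed_comp _ _ (fun l : V => `|l|) [set t | t <= r]
    (fun l _ => @norm_continuous _ _ l) (@closed_le R r)).
have := iffLR (compact_near_coveringP K) cK nat \oo
  (fun M l => dotp l x - energy M l - del * dotp l l < beta) _.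
move=> /(_ _)[].
(* At [l0] some truncation [M2] already satisfies the bound. Its tangent at [l0] carries the bound
   to nearby [l], and monotonicity in [M] to all larger truncations, as the covering form of
   compactness requires. *)
- move=> l0 Kl0.
  have hl0 : ((dotp l0 x - beta)%:E < Ef P X0 f l0)%E.
    have : ((dotp l0 x)%:E - Ef P X0 f l0 < beta%:E)%E.
      by apply: le_lt_trans Ib; apply: ereal_sup_ubound; exists l0.
    case: (Ef P X0 f l0) => [e| |]//=; rewrite -?EFinB ?lte_fin ?ltry//; lra.
  have cv := @energy_cube_cvg _ _ _ _ P X0 mX0 f Lf fL l0.
  have [M1 _ hM1] := cvge_near_gt cv hl0.
  pose M2 := maxn M0 M1.
  have PM2 : cube_pos M2 by apply: PM; exact: leq_maxl.
  have h2 : dotp l0 x - beta < energy M2 l0.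
    by rewrite -lte_fin; apply: hM1 => /=; exact: leq_maxr.
  have nb : \forall l \near l0, dotp l x - (energy M2 l0 + dotp (l - l0) (energy_grad M2 l0)) < beta.
    pose G := energy_grad M2 l0.
    have : nbhs l0 [set l | dotp (x - G) l < beta + energy M2 l0 - dotp l0 G].
      apply: open_nbhs_nbhs; split.
        apply: (open_comp _ (@open_lt R _)) => l _; exact: continuous_dotp.
      rewrite /= dotpBl (dotpC x) (dotpC G); move: h2.
      by move: (dotp _ _) (dotp _ _) (energy _ _) => A B C; lra.
    apply: filterS => l /=; rewrite -/G dotpBl [in dotp (l - l0) G]dotpBl (dotpC x) (dotpC G).
    by move: (dotp _ _) (dotp _ _) (dotp _ _) (energy _ _) => A B C D; lra.
  exists ([set l | dotp l x - (energy M2 l0 + dotp (l - l0) (energy_grad M2 l0)) < beta],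
     [set M | (M2 <= M)%N]); first by split => //=; exact: nbhs_infty_ge.
  move=> [l M] [/= hl M2M].
  have h3 := energy_cube_jensen l0 l PM2.
  have h4 := energy_cube_mono mX0 fL l PM2 M2M.
  have h5 : 0 <= del * dotp l l by rewrite mulr_ge0 ?dotp_ge0// ltW.
  move: hl h3 h4 h5.
  move: (energy M2 l0) (energy M2 l) (energy M l) (dotp _ _) (dotp l x) (del * _).
  by move=> A B C D E F; lra.
move=> N _ hN; exists (maxn M0 N); split; first by apply: PM; exact: leq_maxl.
move=> l; have [lr|rl] := leP `|l| r; last by apply: far => //; exact: leq_maxl.
by apply: (hN (maxn M0 N) (leq_maxr _ _)).
Qed.

(* Maximise [l.x - energy M l - 2 del |l|^2]; at the maximiser the gradient is
   [x - 4 del l], which is close to [x]. *)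
Lemma exists_tilt x (beta e : R) : (If P X0 f x < beta%:E)%E -> 0 < e ->
  exists M l, [/\ cube_pos M, `|energy_grad M l - x| < e &
    dotp l (energy_grad M l) - energy M l < beta].
Proof.
move=> Ib e0.
have beta0 : 0 < beta.
  by rewrite -lte_fin; apply: le_lt_trans Ib; exact: (If_ge0 mX0 int0 fL).
(* Chosen so that [|4 del l|^2 <= 16 del (del l.l) < 16 del beta = e^2] once [del l.l < beta] is
   known. *)
pose del := e ^+ 2 / (16 * beta).
have del0 : 0 < del by rewrite divr_gt0 ?exprn_gt0// mulr_gt0.
have [M [PM hM]] := uniform_truncation Ib del0.
(* The penalty is twice that of [hM]: at a maximiser [psi l >= 0], and the second copy of [del l.l]
   is then bounded by [beta]. *)
pose psi l := dotp l x - energy M l - 2 * del * dotp l l.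
have cpsi : continuous psi.
  move=> l.
  have c1 : {for l, continuous (fun k => dotp k x)}.
    rewrite (_ : (fun k => dotp k x) = dotp x); last by apply/funext => k; exact: dotpC.
    exact: continuous_dotp.
  have c2 : {for l, continuous (energy M)} by exact: energy_cube_continuous.
  have c3 : {for l, continuous (fun k : V => dotp k k)}.
    have := @cvg_big R _ +%R 0 xpredT (@add_continuous R) _ (nbhs l)
      (index_enum 'I_d) (fun i w => w 0 i * w 0 i) (fun i => l 0 i * l 0 i) _.
    by apply => i _; apply: cvgM; exact: coord_continuous.
  have c4 : {for l, continuous (fun k : V => 2 * del * dotp k k)}.
    exact: (@cvgM _ _ (nbhs l) _ _ _ _ _ (@cvg_cst _ (2 * del) _ (nbhs l) _) c3).
  exact: (@cvgB _ _ _ (nbhs l) _ _ _ _ _ (@cvgB _ _ _ (nbhs l) _ _ _ _ _ c1 c2) c4).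
have [r r0 hr] := @quad_growth R (d%:R * `|x| + d%:R * `|energy_grad M 0|)
  0 (2 * del) (addr_ge0 (mulr_ge0 (ler0n _ _) (normr_ge0 _)) (mulr_ge0 (ler0n _ _) (normr_ge0 _)))
  (mulr_gt0 (ltr0n _ 2) del0).
pose K : set V := [set l | `|l| <= r].
have cK : compact K.
  apply: bounded_closed_compact.
    by exists r; split; [exact: num_real|move=> s rs l /= lr; exact: le_trans (ltW rs)].
  exact: (@closed_comp _ _ (fun l : V => `|l|) [set t | t <= r]
    (fun l _ => @norm_continuous _ _ l) (@closed_le R r)).
have K0 : K 0 by rewrite /K /= normr0 ltW.
have [l _ lmax] : exists2 l, l \in K & forall k, k \in K -> psi k <= psi l.
  apply: compact_EVT_max => //; first by exists 0.
  exact: continuous_subspaceT.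
have psi0 : psi 0 = - energy M 0 by rewrite /psi !dotp0l mulr0 subr0 sub0r.
have {}lmax k : psi k <= psi l.
  have [kr|rk] := leP `|k| r; first by apply: lmax; rewrite inE.
  apply: le_trans (lmax 0 _); last by rewrite inE.
  rewrite psi0 /psi; have := hr _ rk; have := energy_cube_linear_lower k PM (leqnn M).
  have := dotp_le k x; rewrite ler_norml => /andP[_].
  have : 2 * del * `|k| ^+ 2 <= 2 * del * dotp k k.
    by rewrite ler_wpM2l ?sqr_norm_le_dotp// mulr_ge0// ltW.
  move: (energy M k) (energy M 0) `|k| `|x| (dotp k x) (dotp k k) `|_ : V|.
  by move=> A B n m D E g h1 h2 h3 h4; nra.
have lval : 0 <= psi l.
  by apply: le_trans (lmax 0); rewrite psi0 oppr_ge0; exact: energy_cube0.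
pose G := energy_grad M l.
have [v vdef] : exists v, v = x - G - (4 * del) *: l by eexists.
have v0 : v = 0.
  apply/eqP; rewrite -dotp_eq0; apply: contrapT => /negP vv.
  have vp : 0 < dotp v v by rewrite lt_def vv dotp_ge0.
  have [dl [C [dl0 C0 up]]] := energy_cube_upper l PM.
  (* A step along [v] gains [s |v|^2] to first order and loses at most [s^2 (C + 2 del) |v|^2], in
     Euclidean lengths. For this [s] the gain prevails, against maximality; the first bound keeps
     the step in the range of [up]. *)
  pose s := Num.min (dl / (`|v| + 1)) (1 / (C + 2 * del + 1)).
  have s0 : 0 < s.
    rewrite lt_min !divr_gt0// ?ltr_wpDl// addr_ge0// mulr_ge0// ltW//.
  have sd : `|s *: v| <= dl.
    rewrite normrZ gtr0_norm// (@le_trans _ _ (s * (`|v| + 1)))//.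
      by rewrite ler_wpM2l ?(ltW s0)// lerDl.
    by rewrite -ler_pdivlMr ?ltr_wpDl// ge_min lexx.
  have := lmax (l + s *: v); rewrite /psi.
  have := up _ sd.
  rewrite !(dotpDl, dotpDr, dotpZl, dotpZr) (dotpC v l).
  have n2 : C * `|s *: v| ^+ 2 <= C * (s ^+ 2 * dotp v v).
    rewrite ler_wpM2l// normrZ exprMn gtr0_norm// ler_wpM2l ?sqr_ge0//.
    exact: sqr_norm_le_dotp.
  have vE : dotp v v = dotp v x - dotp v G - 4 * del * dotp l v.
    by rewrite {2}vdef dotpBr dotpBr dotpZr (dotpC v l).
  have sC : s * (C + 2 * del + 1) <= 1.
    rewrite -ler_pdivlMr ?ge_min ?lexx ?orbT//.
    by rewrite ltr_wpDl// addr_ge0// mulr_ge0// ltW.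
  rewrite -/G; move: n2 vE; clearbody G.
  move: (energy M (l + s *: v)) (energy M l) (C * `|_| ^+ 2) (dotp l v) (dotp v G) (dotp v x) (dotp l l) (dotp l x).
  move: (dotp v v) vp sC s0 => w w0 sC s0.
  move=> E' E Q lv vG vx ll lx h1 h2 h3 h4.
  have h5 : s * w <= s * (s * (C + 2 * del) * w) by nra.
  have h6 : w <= s * (C + 2 * del) * w by move: h5; rewrite ler_pM2l.
  have h7 : 1 <= s * (C + 2 * del) by move: h6; rewrite -[X in X <= _]mul1r ler_pM2r.
  have : s <= 0 by lra.
  by rewrite leNgt s0.
have GE : G = x - (4 * del) *: l.
  by apply/esym/eqP; rewrite -subr_eq0 addrAC -vdef; apply/eqP.
have hl := hM l.
have dl : del * dotp l l < beta.
  by move: hl lval; rewrite /psi; move: (energy M l) (dotp l x) (dotp l l) => A B C; nra.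
exists M, l; split => //.
  rewrite -/G GE addrAC subrr add0r normrN -ltr_sqr ?nnegrE ?normr_ge0 ?(ltW e0)//.
  have h1 : `|(4 * del) *: l| ^+ 2 <= 16 * del * (del * dotp l l).
    have d4 : 0 < 4 * del by rewrite pmulr_rgt0.
    rewrite sqr_scale16 normrZ exprMn (gtr0_norm d4).
    by rewrite ler_wpM2l ?sqr_ge0 ?sqr_norm_le_dotp.
  apply: (le_lt_trans h1).
  have -> : e ^+ 2 = 16 * del * beta by rewrite /del; field; rewrite gt_eqF.
  by rewrite ltr_pM2l// pmulr_rgt0.
rewrite -/G GE dotpBr dotpZr; have := dotp_ge0 l; move: hl.
by move: (energy M l) (dotp l x) (dotp l l) => A B C; nra.
Qed.

End Tilting.

Lemma ler_normDl {R : realDomainType} (x y : R) : x <= `|x| + `|y|.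
Proof. by rewrite (le_trans (ler_norm x))// lerDl. Qed.

Lemma ler_normDr {R : realDomainType} (x y : R) : x <= `|y| + `|x|.
Proof. by rewrite addrC ler_normDl. Qed.

Lemma arith_rate {R : realDomainType} (a b q E : R) :
  a <= b - (q - E) -> - b <= E - q - a.
Proof. lra. Qed.

(** * The large deviation principle *)

Section LDPProof.
Context {R : realType} {d : nat} {dT : measure_display}
  {T : measurableType dT} (P : probability T R) (X : nat -> T -> 'rV[R]_d).
Local Notation V := 'rV[R]_d.
Local Notation I01 := (`[0%R, 1%R]%classic : set R).
Hypothesis iid : iid_rvecs P X.
Hypothesis int0 : interior (DL P (X 0%N)) 0.
Variables (f : R -> R) (Lf : R).
Hypothesis fL : forall s t, I01 s -> I01 t -> `|f s - f t| <= Lf * `|s - t|.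
Implicit Types (l h x y z : V) (n : nat).

Let mX0 B : borelV B -> measurable (X 0%N @^-1` B) := @iid_measurable _ _ _ _ _ _ iid 0%N B.

Local Notation I := (If P (X 0%N) f).
Local Notation Z := (wsum X f).
Local Notation good := (good P (X 0%N) setT f).
Local Notation energyT := (energy P (X 0%N) setT f).

(** For good [l], [I] exceeds [alpha] on this half-space by the definition of the supremum, and
    Chernoff's inequality bounds its probability by a multiple of [e^(- n alpha)]. Semicontinuity,
    compactness and the upper bound all come from these sets. *)
Let U (alpha : R) l : set V := [set z | energyT l + alpha < dotp l z].

Let openU alpha l : open (U alpha l).
Proof. exact: open_dotp. Qed.

Lemma If_lsc : lower_semicontinuous I.
Proof.
move=> x a aI; have [l [Dl h]] := If_gt_intD mX0 int0 fL aI.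
exists (U a l); first by apply: open_nbhs_nbhs; split => //; rewrite /U /=; move: h; move: (dotp _ _) (energyT _) => A B; lra.
move=> y; rewrite /U /= => hy.
apply: lt_le_trans (If_ge mX0 int0 fL y (intD_good mX0 fL Dl)).
by rewrite lte_fin; move: hy; move: (dotp _ _) (energyT _) => A B; lra.
Qed.

(* The good half-spaces [U alpha (+-s e_i)] cover the complement of a large ball. *)
Lemma far_cover (alpha : R) : exists r : R, exists Ls : seq V,
  (forall l, l \in Ls -> good l) /\
  forall z, r < `|z| -> exists2 l, l \in Ls & U alpha l z.
Proof.
have [del d0 hd] := good_shift mX0 borel_setT fL (good0T mX0 int0 f).
pose e (b : bool) (i : 'I_d) : V := (del * (-1) ^+ b) *: delta_mx 0 i.
have ge b i : good (e b i).
  have := hd (e b i); rewrite add0r; apply.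
  rewrite normrZ normrM normrX normrN1 expr1n mulr1 gtr0_norm//.
  rewrite -[leRHS]mulr1 ler_wpM2l ?(ltW d0)//; apply: norm_leP => // k.
  by rewrite mxE; case: (_ && _); rewrite ?normr1 ?normr0.
pose K := \sum_(i < d) (`|energyT (e true i) + alpha| + `|energyT (e false i) + alpha|).
have Kb b i : energyT (e b i) + alpha <= K.
  rewrite /K (bigD1 i)//= ler_wpDr//; first by apply: sumr_ge0 => j _; rewrite addr_ge0.
  by case: b; [exact: ler_normDl|exact: ler_normDr].
have K0 : 0 <= K by apply: sumr_ge0 => j _; rewrite addr_ge0.
exists (K / del), ([seq e true i | i <- enum 'I_d] ++ [seq e false i | i <- enum 'I_d]).
split.
  by move=> l; rewrite mem_cat => /orP[] /mapP[i _ ->]; exact: ge.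
move=> z Kz.
have [i hi] : exists i, K / del < `|z 0 i|.
  apply: contrapT => /forallNP hN; move: Kz; rewrite ltNge => /negP; apply.
  by apply: norm_leP => [|i]; rewrite ?divr_ge0 ?(ltW d0)// leNgt; apply/negP; exact: hN.
exists (e (z 0 i < 0) i).
  by rewrite mem_cat; case: (_ < _); apply/orP; [left|right]; apply: map_f; rewrite mem_enum.
rewrite /U /=; apply: (le_lt_trans (Kb _ _)).
rewrite /e dotpZl dotp_delta -mulrA mulrC -ltr_pdivrMr//; apply: (lt_le_trans hi).
case: ltP => h; first by rewrite expr1 mulN1r ltr0_norm.
by rewrite expr0 mul1r ger0_norm.
Qed.

Lemma I_compact (a : R) : compact [set x | (I x <= a%:E)%E].
Proof.
apply: bounded_closed_compact.
  have [r [Ls [gL hL]]] := far_cover a.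
  exists r; split; first exact: num_real.
  move=> s rs x /= Ia; apply: contrapT => /negP; rewrite -ltNge => sx.
  have [l lL] := hL x (lt_trans rs sx).
  rewrite /U /= => h; move: Ia; apply/negP; rewrite -ltNge.
  apply: lt_le_trans (If_ge mX0 int0 fL x (gL l lL)).
  by rewrite lte_fin; move: h; move: (dotp _ _) (energyT _) => A B; lra.
rewrite -[X in closed X]setCK; apply: open_closedC.
rewrite (_ : ~` _ = [set x | (a%:E < I x)%E]).
  by move/lower_semicontinuousP : If_lsc; exact.
by apply/seteqP; split => x /=; rewrite ltNge => /negP.
Qed.

Lemma union_upper (alpha : R) (Ls : seq V) : (forall l, l \in Ls -> good l) ->
  exists2 K : R, 0 < K & forall n, (0 < n)%N ->
   (P (Z n @^-1` \big[setU/set0]_(l <- Ls) U alpha l) <= (K * expR (- (n%:R * alpha)))%:E)%E.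
Proof.
elim: Ls => [_|l Ls IH gL].
  exists 1 => // n n0; rewrite big_nil preimage_set0 measure0 lee_fin mul1r.
  exact: expR_ge0.
have [K K0 hK] := IH (fun k kL => gL k (mem_behead (s := l :: Ls) kL)).
have [C hC] := chernoff_upper iid fL int0 alpha (gL l (mem_head _ _)).
exists (expR C + K); first by rewrite addr_gt0 ?expR_gt0.
move=> n n0; rewrite big_cons preimage_setU.
have mU : measurable (Z n @^-1` U alpha l).
  by apply: (measurable_wsum iid); apply: borel_open; exact: openU.
have mUs : measurable (Z n @^-1` \big[setU/set0]_(l <- Ls) U alpha l).
  apply: (measurable_wsum iid); apply: borel_open; rewrite -bigcup_seq; apply: bigcup_open => k _.
  exact: openU.
apply: (le_trans (measureU2 P mU mUs)).
rewrite mulrDl EFinD leeD ?hK//.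
by rewrite -expRD; exact: hC.
Qed.

(** [far_cover] plays the part of exponential tightness: its finite family takes care of the points
    outside a large ball, and what remains of the closure is compact. *)
Lemma LDP_upper (B : set V) (alpha : R) : borelV B ->
  (forall z, closure B z -> (alpha%:E < I z)%E) ->
  (limn_esup (fun n => (n%:R^-1)%:E * elog (P (Z n @^-1` B))) <= (- alpha)%:E)%E.
Proof.
move=> bB hB.
have [r [Ls [gL hL]]] := far_cover alpha.
pose K : set V := closure B `&` [set x | `|x| <= r].
have cK : compact K.
  apply: bounded_closed_compact.
    exists r; split; first exact: num_real.
    by move=> s rs x [_ /= xr]; exact: le_trans (ltW rs).
  apply: closedI; first exact: closed_closure.
  exact: (@closed_comp _ _ (fun l : V => `|l|) [set t | t <= r]
    (fun l _ => @norm_continuous _ _ l) (@closed_le R r)).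
have [D Dgood KD] : exists2 D : seq V, (forall l, l \in D -> good l) &
    forall z, K z -> exists2 l, l \in D & U alpha l z.
  have := cK; rewrite compact_cover => /(_ V [set l | good l] (U alpha)).
  case=> [l _|z [/hB Bz _]|D DG KD]; first exact: openU.
    have [l [Dl h]] := If_gt_intD mX0 int0 fL Bz.
    exists l; first exact: (intD_good mX0 fL Dl).
    by rewrite /U /=; move: h; move: (dotp _ _) (energyT _) => A1 B1; lra.
  exists (finmap.enum_fset D).
    by move=> l lD; have := DG l lD; rewrite inE.
  by move=> z /KD[l lD Uz]; exists l.
have gLD l : l \in Ls ++ D -> good l by rewrite mem_cat => /orP[/gL|/Dgood].
have [M M0 hM] := union_upper alpha gLD.
apply: (@rate_upper _ _ M) => // n n0.
apply: le_trans (hM n n0); apply: le_measure; rewrite ?inE.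
- exact: (measurable_wsum iid).
- apply: (measurable_wsum iid); apply: borel_open; rewrite -bigcup_seq; apply: bigcup_open => k _.
  exact: openU.
move=> w /= Bw; rewrite -bigcup_seq.
have [zr|rz] := leP `|Z n w| r.
  have [l lD Uz] : exists2 l, l \in D & U alpha l (Z n w).
    by apply: KD; split => //; exact: subset_closure.
  by exists l => //=; rewrite mem_cat lD orbT.
by have [l lL Uz] := hL _ rz; exists l => //=; rewrite mem_cat lL.
Qed.

Lemma LDP_lower (B : set V) x (beta : R) : borelV B -> interior B x ->
  (I x < beta%:E)%E ->
  ((- beta)%:E <= limn_einf (fun n => (n%:R^-1)%:E * elog (P (Z n @^-1` B))))%E.
Proof.
move=> bB /nbhs_ballP[e /= e0 eB] Ib.
have e20 : 0 < e / 2 by rewrite divr_gt0.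
have [M [l [PM yx lb]]] := exists_tilt mX0 int0 fL Ib e20.
set y := energy_grad _ _ _ _ l in yx lb.
set E := energy _ _ _ _ l in lb.
(* The radius keeps the ball about [y] inside [B], and the loss [d |l| a] within the gap between
   [beta] and [l.y - E]. *)
pose a := Num.min (e / 2) ((beta - (dotp l y - E)) / (d%:R * `|l| + 1)).
have D0 : 0 < d%:R * `|l| + 1 by rewrite ltr_wpDl// mulr_ge0.
have a0 : 0 < a by rewrite lt_min e20 divr_gt0// subr_gt0.
have [c [c0 hc]] := tilted_lower iid fL (borel_cube M) PM (cube_adm0 P mX0 M)
  (cube_good_path P mX0 fL M) a0 (erefl y).
apply: (@rate_lower _ _ c) => //; near=> n.
apply: (@le_trans _ _ (P (Z n @^-1` ball y a))); last first.
  apply: le_measure; rewrite ?inE.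
  - by apply: (measurable_wsum iid); apply: borel_open; exact: ball_open.
  - exact: (measurable_wsum iid).
  move=> w /= wy; apply: eB.
  rewrite -ball_normE /ball_/= distrC -(subrK y (Z n w)) -addrA.
  apply: (le_lt_trans (ler_normD _ _)); rewrite [ltRHS]splitr ltr_leD ?ltW//.
  move: wy; rewrite -ball_normE /ball_/= distrC => /lt_le_trans; apply.
  by rewrite ge_min lexx.
have : ((c * expR (n%:R * (E - dotp l y - d%:R * `|l| * a)))%:E <= P (Z n @^-1` ball y a))%E.
  by near: n.
apply: le_trans; rewrite lee_fin ler_wpM2l ?(ltW c0)// ler_expR -mulrN ler_wpM2l//.
have h : (d%:R * `|l| + 1) * a <= beta - (dotp l y - E).
  by rewrite mulrC -ler_pdivlMr// ge_min lexx orbT.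
have h2 : d%:R * `|l| * a <= (d%:R * `|l| + 1) * a by rewrite ler_wpM2r ?(ltW a0)// lerDl.
exact: arith_rate (le_trans h2 h).
Unshelve. all: by end_near. Qed.

Lemma LDP_weighted : LDP P Z I.
Proof.
split; first exact: (If_ge0 mX0 int0 fL).
split; first exact: If_lsc.
split; first exact: I_compact.
move=> B bB; split.
- rewrite leeNl; apply: le_ereal_inf_tmp => _ [x Bx <-].
  rewrite leeNl.
  have [Ioo|] := ltP (I x) +oo%E; last first.
    by rewrite leye_eq => /eqP ->; exact: leNye.
  have Ifin : I x \is a fin_num by rewrite ge0_fin_numE// (If_ge0 mX0 int0 fL).
  rewrite -(fineK Ifin); apply/lee_subgt0Pr => eps eps0.
  rewrite -EFinN -EFinB -opprD; apply: (LDP_lower bB Bx).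
  by rewrite -[X in (X < _)%E](fineK Ifin) lte_fin ltrDl.
- set m := ereal_inf _.
  have hm z : closure B z -> (m <= I z)%E by move=> Bz; apply: ereal_inf_lbound; exists z.
  have m0 : (0 <= m)%E.
    by apply: le_ereal_inf_tmp => _ [x _ <-]; exact: (If_ge0 mX0 int0 fL).
  case: m m0 hm => [m _ hm| _ hm|//].
    apply/lee_addgt0Pr => eps eps0; rewrite -EFinN -EFinD.
    have -> : - m + eps = - (m - eps) by rewrite opprB addrC.
    apply: LDP_upper => // z /hm; apply: lt_le_trans.
    by rewrite lte_fin ltrBlDr ltrDl.
  (* With an infinite infimum the upper bound holds at every level [a], which leaves only the value
     [-oo]. *)
  have hL a : (limn_esup (fun n => (n%:R^-1)%:E * elog (P (Z n @^-1` B))) <= (- a)%:E)%E.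
    by apply: LDP_upper => // z /hm; apply: lt_le_trans; exact: ltry.
  move: hL; case: (limn_esup _) => [q hL|hL|_]; last exact: leNye.
    by have := hL (1 - q); rewrite opprB lee_fin lerBrDr gerDl ler10.
  by have := hL 0; rewrite leye_eq.
Qed.

End LDPProof.

(** * Differentiability and duality *)

Section QuadraticDifferentiability.
Context {R : realType}.

Lemma quad_differentiable (V : normedModType R) (F : V -> R) (x : V)
    (df : {linear V -> R}) (del C : R) : continuous df -> 0 < del ->
  (forall h, `|h| <= del -> `|F (x + h) - F x - df h| <= C * `|h| ^+ 2) ->
  differentiable F x /\ 'd F x = df :> (V -> R).
Proof.
move=> cdf del0 hF.
have eqF : F \o shift x = cst (F x) + df +o_ 0 id.
  apply/eqaddoP => e e0; near=> h.
  have hd : `|h| <= del.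
    by near: h; apply: (@nbhs0_le _ V).
  have hC : `|h| <= e / (`|C| + 1).
    by near: h; apply: (@nbhs0_le _ V); rewrite divr_gt0// ltr_wpDl.
  rewrite /= (_ : (F \o shift x - (cst (F x) + df)) h = F (x + h) - F x - df h); last first.
    by rewrite !fctE /= (addrC x) opprD addrA.
  apply: (le_trans (hF h hd)); rewrite expr2 mulrA ler_wpM2r//.
  rewrite ler_pdivlMr ?ltr_wpDl// in hC; apply: le_trans hC.
  rewrite mulrC ler_wpM2l// (le_trans (ler_norm _))// lerDl//.
have dF := diff_unique cdf eqF.
by split => //; apply/diff_locallyP; rewrite dF; split.
Unshelve. all: by end_near. Qed.

Context {d : nat}.
Local Notation V := 'rV[R]_d.

(** The scalar product as a function of its first argument, named so that it can carry the linear
    structure that a differential must have; [mulrl] is its analogue on the line. *)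
Definition dotpr (G : V) (u : V) : R := dotp u G.

Fact dotpr_is_linear G : linear (dotpr G).
Proof. by move=> a u v; rewrite /dotpr dotpDl dotpZl. Qed.
HB.instance Definition _ G :=
  GRing.isLinear.Build R V R _ (dotpr G) (dotpr_is_linear G).

Lemma quad_grad (F : V -> R) (x G : V) (del C : R) : 0 < del ->
  (forall h, `|h| <= del -> `|F (x + h) - F x - dotp h G| <= C * `|h| ^+ 2) ->
  differentiable F x /\ grad F x = G.
Proof.
move=> del0 hF.
have cG : continuous (dotpr G).
  rewrite (_ : dotpr G = dotp G); first exact: continuous_dotp.
  by apply/funext => u; exact: dotpC.
have [dF dE] := quad_differentiable cG del0 hF.
split => //; apply/rowP => i; rewrite mxE dE /dotpr.
exact: dotp_delta.
Qed.

End QuadraticDifferentiability.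

Section Derivative1.
Context {R : realType}.

Definition mulrl (g x : R) : R := x * g.

Fact mulrl_is_linear g : linear (mulrl g).
Proof. by move=> a u v; rewrite /mulrl mulrDl -mulrA. Qed.
HB.instance Definition _ g :=
  GRing.isLinear.Build R R R _ (mulrl g) (mulrl_is_linear g).

Lemma quad_derive1 (F : R -> R) (x g : R) (del C : R) : 0 < del ->
  (forall h, `|h| <= del -> `|F (x + h) - F x - h * g| <= C * `|h| ^+ 2) ->
  derivable F x 1 /\ derive1 F x = g.
Proof.
move=> del0 hF.
have cg : continuous (mulrl g) by move=> y; exact: mulrr_continuous.
have [dF dE] := @quad_differentiable R R F x (mulrl g) del C cg del0 hF.
split; first exact: diff_derivable.
by rewrite derive1E' // dE; exact: mul1r.
Qed.

End Derivative1.

Lemma ler_dist_quad {R : realDomainType} (x y q c : R) :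
  y + q <= x -> x <= y + q + c -> `|x - y - q| <= c.
Proof. by move=> h1 h2; rewrite ger0_norm; lra. Qed.

Lemma subr_tangent {R : comPzRingType} (a b e z c : R) :
  a * b * e - a * ((1 - c) * b + z * b) = a * b * (e - (1 + (z - c))).
Proof. ring. Qed.

Lemma clip_lt {R : realType} (e t : R) : 0 < e -> t \in `[0, 1] ->
  Num.max 0 (t - e) < Num.min 1 (t + e).
Proof.
move=> e0; rewrite in_itv/= => /andP[t0 t1].
rewrite gt_max !lt_min ltr01/=; apply/andP; split; first lra.
by apply/andP; split; lra.
Qed.

Lemma open_dotp_neq {R : realType} {d : nat} (h : 'rV[R]_d) (c : R) :
  open [set x | dotp h x != c].
Proof. by apply: open_comp (@open_neq R c) => x _; exact: continuous_dotp. Qed.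

Section FullDimension.
Context {R : realType} {d : nat} {dT : measure_display}
  {T : measurableType dT} (P : probability T R) (X0 : T -> 'rV[R]_d).
Local Notation V := 'rV[R]_d.
Hypothesis mX0 : forall B, borelV B -> measurable (X0 @^-1` B).

(** If [h.X = c] almost surely, the open set where [h.x] differs from [c] is null and misses the
    support. Then [h] is orthogonal to all differences of support points, which span the space,
    hence to itself. *)
Lemma full_dim_nonconst (h : V) (c : R) : full_affine_dim (supp_law P X0) ->
  h != 0 -> (0 < P (X0 @^-1` [set x | (dotp h x != c)]))%E.
Proof.
move=> [x0 [s [Sx0 [Ss dimd]]]] h0.
rewrite lt0e measure_ge0 andbT; apply/eqP => P0.
have oO : open [set x : V | dotp h x != c].
  exact: open_dotp_neq.
have hc y : supp_law P X0 y -> dotp h y = c.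
  move=> Sy; apply/eqP; apply: contrapT => /negP yc.
  by have := Sy _ oO yc; rewrite P0 ltxx.
have sh v : v \in [seq y - x0 | y <- s] -> dotp h v = 0.
  by move=> /mapP[y ys ->]; rewrite dotpBr !hc ?subrr//; exact: Ss.
have fullE : (<<[seq y - x0 | y <- s]>> == fullv)%VS.
  rewrite eqEdim subvf dimd dimvf /=.
  by rewrite (_ : dim _ = d)//; exact: (etrans (dim_matrix R 1%N d) (mul1n d)).
have : h \in <<[seq y - x0 | y <- s]>>%VS by rewrite (eqP fullE) memvf.
move=> hs; have := @coord_span _ _ _ (in_tuple [seq y - x0 | y <- s]) h hs => hE.
move: h0; rewrite -dotp_eq0 {2}hE dotp_sumr big1 ?eqxx// => i _.
by rewrite dotpZr sh ?mulr0//; apply: mem_nth.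
Qed.

Hypothesis full : full_affine_dim (supp_law P X0).
Local Notation A := (X0 @^-1` [set: V]).

(** The defect in Jensen's inequality is the mean of [e^(c + u.X) (e^z - 1 - z)] with
    [z = (v - u).X - c]. The integrand is positive unless [z = 0], and full dimension gives positive
    probability to [z != 0]. *)
Lemma cgf_strict_jensen (u v : V) (rho : R) : 0 < rho ->
  (emom P X0 setT u rho < +oo)%E -> (mgf P X0 setT v < +oo)%E -> v != u ->
  cgf P X0 setT u + dotp (v - u) (cgrad P X0 setT u) < cgf P X0 setT v.
Proof.
move=> rho0 uoo voo vu.
have mA : measurable A by exact: (mX0 borel_setT).
have PA : (0 < P A)%E by exact: probT_gt0.
set c := dotp (v - u) (cgrad P X0 setT u).
have M0 := fine_mgf_gt0 mX0 borel_setT rho0 uoo PA.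
have vfin : mgf P X0 setT v \is a fin_num by rewrite ge0_fin_numE ?mgf_ge0.
have iu := integrable_exp0 mX0 borel_setT rho0 uoo.
have id := integrable_dotp_exp mX0 borel_setT rho0 uoo (v - u).
have iv : P.-integrable A (EFin \o (fun w => expR (dotp v (X0 w)))).
  apply/integrableP; split.
    by apply: measurable_funTS; apply/measurable_EFinP; exact: measurable_expX0.
  apply: le_lt_trans voo; rewrite le_eqVlt; apply/orP; left; apply/eqP.
  by apply: eq_integral => w _ /=; rewrite ger0_norm// expR_ge0.
pose B w := expR c * ((1 - c) * expR (dotp u (X0 w)) + dotp (v - u) (X0 w) * expR (dotp u (X0 w))).
have iB : P.-integrable A (EFin \o B).
  exact: (integrableZl mA (expR c) (integrableD mA (integrableZl mA (1 - c) iu) id)).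
have intB : \int[P]_(w in A) B w = expR c * fine (mgf P X0 setT u).
  rewrite RintegralZl//; last exact: (integrableD mA (integrableZl mA (1 - c) iu) id).
  congr (_ * _); rewrite RintegralD//; last exact: (integrableZl mA (1 - c) iu).
  rewrite RintegralZl// (dotp_mom1 mX0 borel_setT rho0 uoo).
  rewrite -[\int[P]_(w in A) _]/(fine (mgf P X0 setT u)).
  have -> : dotp (v - u) (mom1 P X0 setT u) = fine (mgf P X0 setT u) * c.
    by rewrite /c dotpZr mulrA divff ?mul1r// gt_eqF.
  by move: (fine _) => z; ring.
pose g w := expR (dotp v (X0 w)) - B w.
have gE w : g w = expR c * expR (dotp u (X0 w)) *
    (expR (dotp (v - u) (X0 w) - c) - (1 + (dotp (v - u) (X0 w) - c))).
  rewrite /g /B; have -> : dotp v (X0 w) = c + dotp u (X0 w) + (dotp (v - u) (X0 w) - c).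
    by rewrite dotpBl; ring.
  by rewrite (expRD (c + _)) (expRD c); exact: subr_tangent.
have e0 w : 0 < expR c * expR (dotp u (X0 w)) by rewrite mulr_gt0 ?expR_gt0.
have mg : measurable_fun A g.
  have := measurable_int P (integrableB mA iv iB) => h.
  by apply/measurable_EFinP.
have g0 : (0 < \int[P]_(w in A) (g w)%:E)%E.
  apply: integral_gt0 => //.
    by move=> w _; rewrite gE mulr_ge0 ?(ltW (e0 w))// subr_ge0 expR_ge1Dx.
  have vu0 : v - u != 0 by rewrite subr_eq0.
  apply: (lt_le_trans (full_dim_nonconst c full vu0)).
  apply: le_measure; rewrite ?inE.
  - apply: mX0; apply: borel_open.
    exact: open_dotp_neq.
  - exact: measurable_fun_ltr.
  - move=> w /= wc; split => //; rewrite gE mulr_gt0// subr_gt0 expR_gt1Dx//.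
    by rewrite subr_eq0.
have ig : P.-integrable A (EFin \o g) by exact: (integrableB mA iv iB).
have : 0 < \int[P]_(w in A) g w.
  by rewrite fine_gt0// g0/= ltey_eq integrable_fin_num.
rewrite RintegralB// intB subr_gt0 -[X in _ < X]/(fine (mgf P X0 setT v)) => h.
rewrite -[ltLHS]expRK ltr_ln ?posrE ?expR_gt0//; last first.
  by apply: lt_trans h; rewrite mulr_gt0// expR_gt0.
by rewrite expRD (expR_cgf mX0 borel_setT rho0 uoo PA) mulrC.
Qed.

End FullDimension.

Section Gradients.
Context {R : realType} {d : nat} {dT : measure_display}
  {T : measurableType dT} (P : probability T R) (X0 : T -> 'rV[R]_d).
Local Notation V := 'rV[R]_d.
Local Notation I01 := (`[0%R, 1%R]%classic : set R).
Local Notation leb := (@lebesgue_measure R).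
Hypothesis mX0 : forall B, borelV B -> measurable (X0 @^-1` B).
Hypothesis int0 : interior (DL P X0) 0.
Variables (f : R -> R) (Lf : R).
Hypothesis fL : forall s t, I01 s -> I01 t -> `|f s - f t| <= Lf * `|s - t|.
Implicit Types (u v l h : V).

Local Notation good := (good P X0 setT f).
Local Notation energyT := (energy P X0 setT f).
Local Notation gradT := (energy_grad P X0 setT f).
Local Notation cgfT := (cgf P X0 setT).
Local Notation cgradT := (cgrad P X0 setT).
Let PT : (0 < P (X0 @^-1` setT))%E := probT_gt0 P X0.
Let aT := adm0T mX0 int0.

Lemma Efr_good l : good l -> Efr P X0 f l = energyT l.
Proof. by move=> gl; rewrite /Efr (Ef_good mX0 int0 fL gl). Qed.

Lemma Efr_quad l : good l -> exists del C, 0 < del /\ forall h, `|h| <= del ->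
  `|Efr P X0 f (l + h) - Efr P X0 f l - dotp h (gradT l)| <= C * `|h| ^+ 2.
Proof.
move=> gl; have [del [C [d0 C0 up]]] := energy_upper mX0 borel_setT PT aT fL gl.
exists del, C; split => // h hd; have [gh uh] := up h hd.
rewrite !Efr_good//.
have := energy_jensen mX0 borel_setT PT aT fL gl gh; rewrite addrAC subrr add0r => lo.
exact: ler_dist_quad lo uh.
Qed.

Lemma Efr_grad l : good l ->
  differentiable (Efr P X0 f) l /\ grad (Efr P X0 f) l = gradT l.
Proof. by move=> /Efr_quad[del [C [d0 hq]]]; exact: quad_grad d0 hq. Qed.

Lemma Kr_quad u : interior (DL P X0) u -> exists del C, 0 < del /\ forall h, `|h| <= del ->
  `|Kr P X0 (u + h) - Kr P X0 u - dotp h (cgradT u)| <= C * `|h| ^+ 2.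
Proof.
move=> /(interior_emom mX0)[rho rho0 uoo].
have D0 : 0 < d%:R + 1 :> R by rewrite ltr_wpDl.
exists (rho / 2 / (d%:R + 1)); eexists; split; first by rewrite !divr_gt0.
move=> h; rewrite ler_pdivlMr// => hd.
have hr : d%:R * `|h| <= rho / 2.
  by apply: le_trans hd; rewrite mulrC ler_wpM2l// lerDl.
have hoo : (mgf P X0 setT (u + h) < +oo)%E.
  apply: (mgf_lty mX0 borel_setT (lexx 0)).
  apply: le_lt_trans (emom_shift P mX0 borel_setT u 0 hr) _.
  by rewrite add0r; apply: (emom_lty_le mX0 borel_setT) uoo; exact: ler_half.
have := cgf_upper mX0 borel_setT rho0 uoo PT hr.
have := cgf_jensen mX0 borel_setT rho0 uoo PT hoo; rewrite addrAC subrr add0r.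
rewrite !Kr_cgf// => lo up.
exact: ler_dist_quad lo up.
Qed.

Lemma Kr_grad u : interior (DL P X0) u ->
  differentiable (Kr P X0) u /\ grad (Kr P X0) u = cgradT u.
Proof. by move=> /Kr_quad[del [C [d0 hq]]]; exact: quad_grad d0 hq. Qed.

Lemma If_energy_grad l : good l ->
  If P X0 f (gradT l) = (dotp l (gradT l) - energyT l)%:E.
Proof.
move=> gl; apply/eqP; rewrite eq_le (If_ge mX0 int0 fL _ gl) andbT.
apply: ge_ereal_sup => _ [l' _ <-]; have := Ef_jensen mX0 int0 fL l' gl.
case: (Ef P X0 f l') => [e| |]//=; last by rewrite leNye.
rewrite -EFinB !lee_fin dotpBl; move: (dotp _ _) (dotp _ _) (energyT l) => A B C; lra.
Qed.

Lemma Irate_cgrad u : interior (DL P X0) u ->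
  Irate P X0 (cgradT u) = (dotp u (cgradT u) - cgfT u)%:E.
Proof.
move=> ui; have [rho rho0 uoo] := interior_emom mX0 ui.
apply/eqP; rewrite eq_le; apply/andP; split.
  apply: ge_ereal_sup => _ [v _ <-].
  have := Kbar_lower (mgf_jensen mX0 borel_setT rho0 uoo PT v).
  case: (Kbar P X0 v) => [e| |]//=; last by rewrite leNye.
  rewrite -EFinB !lee_fin dotpBl; move: (dotp _ _) (dotp _ _) (cgfT u) => A B C; lra.
apply: ereal_sup_ubound; exists u => //; rewrite Kbar_fin ?EFinB//.
exact: (mgf_lty mX0 borel_setT (ltW rho0) uoo).
Qed.

(** By openness [s l] still satisfies [intD] for some [s > 1]; its path lies in the domain, and
    scaling back by [1 / s] moves it into the interior. *)
Lemma intD_interior l t : intD P X0 f l -> I01 t -> interior (DL P X0) (f t *: l).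
Proof.
move=> Dl It; have [s [s1 Ds]] : exists s : R, 1 < s /\ intD P X0 f (s *: l).
  case: Dl => Dl1 Dl2.
  have near1 (C : set V) (v : V) : interior C v -> \forall s \near (1 : R), C (s *: v).
    move=> Cv; have cs : {for (1 : R), continuous (fun s : R => s *: v)} by exact: scalel_continuous.
    by apply: cs; rewrite scale1r.
  have n1 := near1 _ _ (nbhs_interior Dl1).
  have n2 := near1 _ _ (nbhs_interior Dl2).
  have [e /= e0 he] := iffLR (nbhs_ballP _ _) (filterI n1 n2).
  exists (1 + e / 2); split; first by rewrite ltrDl divr_gt0.
  have [] := he (1 + e / 2).
    rewrite /ball/= opprD addrA subrr sub0r normrN gtr0_norm ?divr_gt0//.
    by rewrite ltr_pdivrMr// ltr_pMr// ltr1n.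
  move=> h1 h2; split.
    by rewrite scalerA mulrC -scalerA.
  by rewrite scalerA mulrC -scalerA -scalerN.
have gs := intD_good mX0 fL Ds.
have s0 : 0 < s by exact: lt_trans s1.
have -> : f t *: l = s^-1 *: (f t *: (s *: l)).
  have e : s^-1 * (f t * s) = f t by rewrite mulrCA mulVf ?mulr1 ?gt_eqF.
  by rewrite (scalerA (f t)) scalerA e.
apply: (interior_DL_scale mX0 int0).
  by rewrite invr_ge0 ltW//= invf_lt1.
exact: (good_mgf_lty mX0 borel_setT PT aT fL gs It).
Qed.

Lemma legendre_path_integrable l : good l -> leb.-integrable I01
  (EFin \o (fun t => f t * dotp l (cgradT (f t *: l)) - cgfT (f t *: l))).
Proof.
move=> gl; have h1 := fcgrad_path_integrable mX0 borel_setT PT aT fL l gl.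
have h2 := cgf_path_integrable mX0 borel_setT PT aT fL gl.
exact: (integrableB _ h1 h2).
Qed.

Lemma legendre_path l : good l ->
  (\int[leb]_(t in I01) (f t * dotp l (cgradT (f t *: l)) - cgfT (f t *: l))%:E =
   (dotp l (gradT l) - energyT l)%:E)%E.
Proof.
move=> gl; rewrite (dotp_energy_grad mX0 borel_setT PT aT fL l gl).
have h1 := fcgrad_path_integrable mX0 borel_setT PT aT fL l gl.
have h2 := cgf_path_integrable mX0 borel_setT PT aT fL gl.
rewrite -RintegralB// fineK//; apply: integrable_fin_num => //.
exact: legendre_path_integrable.
Qed.

Lemma If_grad l : intD P X0 f l ->
  If P X0 f (grad (Efr P X0 f) l) =
  (\int[leb]_(t in I01) Irate P X0 (grad (Kr P X0) (f t *: l)))%E.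
Proof.
move=> Dl; have gl := intD_good mX0 fL Dl.
rewrite (Efr_grad gl).2 If_energy_grad// -legendre_path//.
apply: eq_integral => t; rewrite inE => It; have ui := intD_interior Dl It.
by rewrite (Kr_grad ui).2 Irate_cgrad// dotpZl.
Qed.

Hypothesis full : full_affine_dim (supp_law P X0).
Hypothesis f_nz : exists t, I01 t /\ f t != 0.

Lemma f_nz_measure : (0 < leb (I01 `&` [set t | (f t != 0)%R]))%E.
Proof.
have [t0 [It0 ft0]] := f_nz.
pose e := `|f t0| / (`|Lf| + 1).
have Lp : 0 < `|Lf| + 1 by rewrite ltr_wpDl.
have f0 : 0 < `|f t0| by rewrite normr_gt0.
have e0 : 0 < e by rewrite divr_gt0.
pose J := `](Num.max 0 (t0 - e)), (Num.min 1 (t0 + e))[%classic : set R.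
have mf : measurable_fun I01 f.
  have Lf0 : 0 <= Lf.
    have I0 : I01 0 by rewrite /= in_itv/= lexx ler01.
    have I1 : I01 1 by rewrite /= in_itv/= lexx ler01.
    by have := fL I1 I0; rewrite subr0 normr1 mulr1; exact: le_trans.
  by apply/measurable_EFinP; exact: (measurable_int leb (locally_lipschitz01_integrable (lipschitz_locally01 Lf0 fL))).
have mne : measurable (I01 `&` [set t | (f t != 0)%R]).
  have -> : I01 `&` [set t | (f t != 0)%R] = I01 `&` f @^-1` (~` [set 0]).
    by apply/seteqP; split => t /= [It /eqP].
  by apply: mf => //; apply: measurableC.
apply: (@lt_le_trans _ _ (leb J)); last first.
  apply: le_measure; rewrite ?inE; [exact: measurable_itv|exact: mne|].
  move=> t; rewrite /J /= in_itv/= gt_max lt_min => /andP[/andP[t1 t2] /andP[t3 t4]].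
  have It : I01 t by rewrite /= in_itv/= !ltW.
  split => //; apply/eqP => ft.
  have := fL It0 It; rewrite ft subr0; apply/negP; rewrite -ltNge.
  have te : `|t0 - t| < e by rewrite distrC ltr_distl t2.
  rewrite (@le_lt_trans _ _ ((`|Lf| + 1) * `|t0 - t|))//.
    by rewrite ler_wpM2r// (le_trans (ler_norm _))// lerDl.
  by rewrite mulrC -ltr_pdivlMr.
rewrite /J lebesgue_measure_itv/= lte_fin.
have lt0 := clip_lt e0 It0.
by rewrite lt0 -EFinB lte_fin subr_gt0.
Qed.

(** Along the path the inequality is strict exactly where [f] does not vanish, a set of positive
    measure by continuity of [f]. *)
Lemma energy_strict_jensen l l' : good l -> good l' -> l' != l ->
  energyT l + dotp (l' - l) (gradT l) < energyT l'.
Proof.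
move=> gl gl' ll.
rewrite (energy_affine mX0 borel_setT PT aT fL)// -subr_gt0.
have ia := energy_affine_integrable mX0 borel_setT PT aT fL (l' - l) gl.
have i' := cgf_path_integrable mX0 borel_setT PT aT fL gl'.
rewrite -RintegralB//.
pose g t := cgfT (f t *: l') - (cgfT (f t *: l) + f t * dotp (l' - l) (cgradT (f t *: l))).
rewrite -[X in 0 < X]/(\int[leb]_(t in I01) g t).
have ig : leb.-integrable I01 (EFin \o g) by exact: (integrableB _ i' ia).
have mg : measurable_fun I01 g by apply/measurable_EFinP; exact: (measurable_int leb ig).
have gpos t : I01 t -> f t != 0 -> 0 < g t.
  move=> It ft; rewrite /g subr_gt0 -dotpZl scalerBr.
  have [rho [C [rho0 C0 q]]] := good_quad mX0 borel_setT PT aT fL gl.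
  have [q1 _ _] := q t It.
  apply: (cgf_strict_jensen mX0 full rho0 q1).
    exact: (good_mgf_lty mX0 borel_setT PT aT fL gl' It).
  by rewrite -subr_eq0 -scalerBr scaler_eq0 negb_or ft subr_eq0.
have g0 t : I01 t -> 0 <= g t.
  move=> It; have [ft|/(gpos t It)/ltW//] := eqVneq (f t) 0.
  by rewrite /g ft !scale0r mul0r addr0 subrr.
rewrite fine_gt0// ltey_eq integrable_fin_num// andbT.
apply: integral_gt0 => //; apply: lt_le_trans f_nz_measure _.
have mpos : measurable (I01 `&` [set x | (0 < g x)%R]) by exact: measurable_fun_ltr.
rewrite (_ : I01 `&` [set t | (f t != 0)%R] = I01 `&` [set x | (0 < g x)%R])//.
apply/seteqP; split => t /= [It].
  by move=> ft; split => //; exact: gpos.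
move=> gt; split => //; apply/eqP => ft.
by move: gt; rewrite /g ft !scale0r mul0r addr0 subrr ltxx.
Qed.

(** With equal gradients, the two strict tangent inequalities between [l] and [l'] add up to a
    contradiction. *)
Lemma gradT_inj l l' : good l -> good l' -> gradT l = gradT l' -> l = l'.
Proof.
move=> gl gl' gE; apply/eqP; apply: contrapT => /negP ll.
have h1 := energy_strict_jensen gl' gl ll.
rewrite eq_sym in ll; have h2 := energy_strict_jensen gl gl' ll.
move: h1 h2; rewrite gE !dotpBl.
by move: (energyT l) (energyT l') (dotp _ _) (dotp _ _) => A B C D; lra.
Qed.

End Gradients.

(** * Dimension one *)

Section MonotoneLimit.
Context {R : realType} {I : Type} {F : set_system I} {FF : Filter F}.

Lemma cvg_ereal_squeeze (g : I -> R) (kappa : \bar R) :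
  (forall c, (c < kappa)%E -> \forall i \near F, (c <= (g i)%:E)%E) ->
  (\forall i \near F, ((g i)%:E <= kappa)%E) -> (g i)%:E @[i --> F] --> kappa.
Proof.
move=> lo hi; case: kappa lo hi => [k| |] lo hi.
- apply/fine_cvgP; split; first by near=> i.
  apply: (iffRL (@cvgrPdist_le _ _ _ F _ _ _)) => e e0; near=> i.
  rewrite /= ler_distlC; apply/andP; split.
    have : ((k - e)%:E <= (g i)%:E)%E.
      by near: i; apply: lo; rewrite lte_fin ltrBlDr ltrDl.
    by rewrite lee_fin.
  have gk : ((g i)%:E <= k%:E)%E by near: i; exact: hi.
  by rewrite lee_fin in gk; rewrite (le_trans gk)// lerDl ltW.
- apply/cvgeyPge => A; apply: lo; exact: ltry.
- apply/cvgeNyPle => A; near=> i.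
  have : ((g i)%:E <= -oo)%E by near: i; exact: hi.
  by rewrite leeNy_eq.
Unshelve. all: by end_near. Qed.

End MonotoneLimit.


Section LimitAlongFilters.
Context {R : realType}.
Implicit Types (g : R -> R) (c L : \bar R).

Lemma lim_leftP g c L : c != -oo%E ->
  (forall F : set_system R, ProperFilter F -> u%:E @[u --> F] --> c ->
     (\forall u \near F, (u%:E < c)%E) -> (g u)%:E @[u --> F] --> L) ->
  lim_left g c = L.
Proof.
case: c => [r| |]// _ h; apply: cvg_lim => //; apply: h.
- by apply: cvg_EFin; [near=> x|exact: cvg_within].
- by near=> u; rewrite lte_fin; near: u; exact: nbhs_left_lt.
- by apply/cvgeyPge => A; near=> u; rewrite lee_fin; near: u; apply: nbhs_pinfty_ge; exact: num_real.
- by near=> u; exact: ltry.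
Unshelve. all: by end_near. Qed.

Lemma lim_rightP g c L : c != +oo%E ->
  (forall F : set_system R, ProperFilter F -> u%:E @[u --> F] --> c ->
     (\forall u \near F, (c < u%:E)%E) -> (g u)%:E @[u --> F] --> L) ->
  lim_right g c = L.
Proof.
case: c => [r| |]// _ h; apply: cvg_lim => //; apply: h.
- by apply: cvg_EFin; [near=> x|exact: cvg_within].
- by near=> u; rewrite lte_fin; near: u; exact: nbhs_right_gt.
- by apply/cvgeNyPle => A; near=> u; rewrite lee_fin; near: u; apply: nbhs_ninfty_le; exact: num_real.
- by near=> u; exact: ltNyr.
Unshelve. all: by end_near. Qed.

End LimitAlongFilters.

(** * Legendre transforms of convex functions on a line *)

Section LegendreLine.
Context {R : realType}.
Implicit Types (k g : R -> R) (Kb : R -> \bar R) (p m : \bar R) (u v y : R).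

(** The left end is given by its distance [m] from 0, so that reflection merely swaps [m] and
    [p]. *)
Definition between m p : set R := [set u | (- m < u%:E)%E /\ (u%:E < p)%E].

(* A convex [k] on ]-m, p[, extended by [Kb]; the quadratic bound says that [k']
   is its derivative. *)
Definition legendre_line k k' Kb p m :=
  [/\ (0 < p)%E, (0 < m)%E,
      forall u v, between m p u -> ((k u + (v - u) * k' u)%:E <= Kb v)%E,
      forall u, between m p u -> Kb u = (k u)%:E &
      forall u, between m p u -> exists del C, 0 < del /\
        forall h, `|h| <= del -> `|k (u + h) - k u - h * k' u| <= C * `|h| ^+ 2].

(** The Legendre transform with an extended argument, because the slope at an end of the domain may
    be infinite. *)
Definition dualsup Kb (v : \bar R) : \bar R :=
  ereal_sup [set (u%:E * v - Kb u)%E | u in [set: R]].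

Definition refl k u := k (- u).
(** Applied to the derivative of [k], this is the derivative of [refl k]. *)
Definition negrefl k u := - k (- u).

Lemma betweenN m p u : between p m (- u) <-> between m p u.
Proof.
rewrite /between /= EFinN; split => -[h1 h2].
  by split; [rewrite lteNl|rewrite -lteN2].
by split; [rewrite lteN2|rewrite lteNl].
Qed.

Lemma legendre_line_refl k k' Kb p m : legendre_line k k' Kb p m ->
  legendre_line (refl k) (negrefl k') (fun u => Kb (- u)) m p.
Proof.
case=> p0 m0 tg KE qd; split => // [u v Iu|u Iu|u Iu].
- have := tg (- u) (- v) (iffRL (betweenN _ _ _) Iu); rewrite /refl /negrefl.
  by rewrite (_ : (- v - - u) * k' (- u) = (v - u) * - k' (- u))//; ring.
- exact: KE (iffRL (betweenN _ _ _) Iu).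
- have [del [C [d0 h]]] := qd (- u) (iffRL (betweenN _ _ _) Iu).
  exists del, C; split => // e; have := h (- e); rewrite normrN /refl /negrefl.
  by rewrite opprD mulrN mulNr.
Qed.

Lemma dualsup_refl Kb (v : \bar R) :
  dualsup (fun u => Kb (- u)) (- v)%E = dualsup Kb v.
Proof.
congr ereal_sup; apply/seteqP; split => _ [u _ <-]; exists (- u) => //.
  by rewrite EFinN muleN mulNe.
by rewrite EFinN muleNN opprK.
Qed.

Variables (k k' : R -> R) (Kb : R -> \bar R) (p m : \bar R).
Hypothesis LL : legendre_line k k' Kb p m.
Local Notation In := (between m p).

Let p0 : (0 < p)%E. Proof. by case: LL. Qed.
Let m0 : (0 < m)%E. Proof. by case: LL. Qed.

Lemma tangent u v : In u -> ((k u + (v - u) * k' u)%:E <= Kb v)%E.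
Proof. by move=> Iu; case: LL => _ _ h _ _; exact: h. Qed.

Lemma KbE u : In u -> Kb u = (k u)%:E.
Proof. by move=> Iu; case: LL => _ _ _ h _; exact: h. Qed.

Definition dualval u := u * k' u - k u.

Lemma between_le u v w : In u -> In v -> u <= w -> w <= v -> In w.
Proof.
move=> [u1 _] [_ v2] uw wv; split.
  by rewrite (lt_le_trans u1).
by rewrite (le_lt_trans _ v2).
Qed.

Lemma between_ge0 u : 0 <= u -> (u%:E < p)%E -> In u.
Proof.
move=> u0 up; split => //; apply: (@lt_le_trans _ _ 0%E); last by rewrite lee_fin.
by rewrite lteNl oppe0.
Qed.

Lemma between0 : In 0.
Proof. exact: between_ge0. Qed.

Lemma between_near u : In u -> \forall v \near u, In v.
Proof.
move=> [u1 u2].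
have cE : (v%:E @[v --> u] --> u%:E)%E by apply: cvg_EFin; [near=> v|exact: cvg_id].
by apply: filterI; [exact: cvge_near_gt cE u1|exact: cvge_near_lt cE u2].
Unshelve. all: by end_near. Qed.

Lemma slope_mono u v : In u -> In v -> u <= v -> k' u <= k' v.
Proof.
move=> Iu Iv; rewrite le_eqVlt => /orP[/eqP ->//|uv].
have := tangent v Iu; rewrite KbE// lee_fin => h1.
have := tangent u Iv; rewrite KbE// lee_fin => h2.
have : 0 <= (v - u) * (k' v - k' u) by lra.
by rewrite pmulr_rge0 ?subr_gt0// subr_ge0.
Qed.

Lemma dualval_mono u v : In u -> In v -> 0 <= u -> u <= v -> dualval u <= dualval v.
Proof.
move=> Iu Iv u0 uv; have := tangent u Iv; rewrite KbE// lee_fin /dualval => h.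
have := ler_wpM2l u0 (slope_mono Iu Iv uv); lra.
Qed.

Lemma dualval_dualsup u : In u -> dualsup Kb (k' u)%:E = (dualval u)%:E.
Proof.
move=> Iu; apply/eqP; rewrite eq_le; apply/andP; split.
  apply: ge_ereal_sup => _ [v _ <-]; have := tangent v Iu.
  case: (Kb v) => [e| |]//=; last by rewrite leNye.
  by rewrite -EFinM -EFinB !lee_fin /dualval => h; lra.
by apply: ereal_sup_ubound; exists u => //; rewrite KbE// -EFinM -EFinB.
Qed.

(* Testing the tangent at [v] against the point [u + h] beyond [v] turns the
   quadratic bound at [u] into [k' v - k' u <= 2 C h]. *)
Lemma slope_right_continuous u (e : R) : In u -> 0 < e ->
  exists2 del, 0 < del & forall v, u <= v <= u + del -> In v -> k' v <= k' u + e.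
Proof.
move=> Iu e0; have [del [C [d0 q]]] : exists del C, 0 < del /\
    forall h, `|h| <= del -> `|k (u + h) - k u - h * k' u| <= C * `|h| ^+ 2.
  by case: LL => _ _ _ _; exact.
have [ep /= ep0 Iball] := iffLR (nbhs_ballP _ _) (between_near Iu).
pose C' := `|C| + 1; have C0 : 0 < C' by rewrite ltr_wpDl.
pose h := Num.min (Num.min del (ep / 2)) (e / (2 * C')).
have h0 : 0 < h by rewrite !lt_min d0 !divr_gt0// mulr_gt0.
have hd : h <= del by rewrite !ge_min lexx.
have he : h <= e / (2 * C') by rewrite !ge_min lexx orbT.
have hep : h <= ep / 2 by rewrite !ge_min lexx !orbT.
have Iuh : In (u + h).
  apply: Iball; rewrite /ball/= opprD addrA subrr sub0r normrN gtr0_norm//.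
  by apply: le_lt_trans hep _; rewrite ltr_pdivrMr// ltr_pMr// ltr1n.
exists (h / 2); first by rewrite divr_gt0.
move=> v /andP[uv vh] Iv.
have := tangent (u + h) Iv; rewrite KbE// lee_fin => t1.
have := tangent v Iu; rewrite KbE// lee_fin => t2.
have := q h; rewrite gtr0_norm// => /(_ hd) /(le_trans (ler_norm _)) t3.
have CC : C * h ^+ 2 <= C' * h ^+ 2.
  by rewrite ler_wpM2r ?sqr_ge0// (le_trans (ler_norm _))// lerDl.
rewrite ler_pdivlMr ?mulr_gt0// in he.
have {}he : C' * h ^+ 2 <= e * (h / 2) by rewrite expr2; nra.
have s0 : 0 < u + h - v by lra.
have : (u + h - v) * (k' v - k' u) <= (u + h - v) * e by nra.
by rewrite ler_pM2l// lerBlDl.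
Qed.

End LegendreLine.

Section LegendreLineContinuity.
Context {R : realType}.
Variables (k k' : R -> R) (Kb : R -> \bar R) (p m : \bar R).
Hypothesis LL : legendre_line k k' Kb p m.
Local Notation In := (between m p).

Lemma slope_continuous u : In u -> {for u, continuous k'}.
Proof.
move=> Iu; apply/cvgrPdist_le => e e0.
have [d1 d10 h1] := slope_right_continuous LL Iu e0.
have [d2 d20 h2] := slope_right_continuous (legendre_line_refl LL) (iffRL (betweenN _ _ _) Iu) e0.
near=> v.
have Iv : In v by near: v; exact: between_near.
have : `|u - v| <= Num.min d1 d2.
  by near: v; apply: cvgr_dist_le; [exact: cvg_id|rewrite lt_min d10].
rewrite le_min => /andP[v1 v2]; rewrite ler_distlC.
have [uv|vu] := leP u v.
  have := slope_mono LL Iu Iv uv; have := h1 v; rewrite uv.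
  by move: v1; rewrite distrC ger0_norm ?subr_ge0// lerBlDl => -> /(_ isT Iv); lra.
have := slope_mono LL Iv Iu (ltW vu); have := h2 (- v); rewrite lerN2 (ltW vu).
move: v2; rewrite ger0_norm ?subr_ge0 ?(ltW vu)// => v2.
have -> : - v <= - u + d2 by lra.
move=> /(_ isT (iffRL (betweenN _ _ _) Iv)); rewrite /negrefl !opprK; lra.
Unshelve. all: by end_near. Qed.

Lemma slope_ivt u v y : In u -> In v -> u <= v -> k' u <= y -> y <= k' v ->
  exists2 w, In w & k' w = y.
Proof.
move=> Iu Iv uv uy yv.
have kuv := slope_mono LL Iu Iv uv.
have [||w] := @IVT R k' u v y uv.
- apply: continuous_in_subspaceT => w; rewrite inE/= in_itv/= => /andP[uw wv].
  exact: (slope_continuous (between_le Iu Iv uw wv)).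
- by rewrite (min_idPl kuv) (max_idPr kuv) uy.
- by rewrite in_itv/= => /andP[uw wv] <-; exists w => //; exact: between_le Iu Iv uw wv.
Qed.

Variables (u_ : nat -> R).
Hypotheses (u_In : forall n, In (u_ n)) (u_ge0 : forall n, 0 <= u_ n).
Hypothesis (u_nd : {homo u_ : n m / (n <= m)%N >-> n <= m}).

(** For a nondecreasing sequence in the interval, the limit of the slopes along it, possibly
    infinite. *)
Definition slope_sup : \bar R := ereal_sup (range (fun n => (k' (u_ n))%:E)).

Lemma slope_le_sup n : ((k' (u_ n))%:E <= slope_sup)%E.
Proof. by apply: ereal_sup_ubound; exists n. Qed.

(** The tangent at [u_ n] gives [v k'(u_ n) - Kb v <= dualval (u_ n)]. For [v > 0] the supremum over
    [n] passes through division by [v]; for [v <= 0] the term [n = 0] is enough. Conversely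
    [v = u_ n] is tested, where [u_ n >= 0] lets the slope be raised to its supremum. *)
Lemma dualsup_slope_sup :
  dualsup Kb slope_sup = ereal_sup (range (fun n => (dualval k k' (u_ n))%:E)).
Proof.
apply/eqP; rewrite eq_le; apply/andP; split.
  apply: ge_ereal_sup => _ [v _ <-].
  set S := ereal_sup _.
  have JS n : ((dualval k k' (u_ n))%:E <= S)%E by apply: ereal_sup_ubound; exists n.
  have := tangent LL v (u_In 0).
  case KbvE: (Kb v) => [e| |]// _; last by rewrite addeNy leNye.
  have ve n : v * k' (u_ n) - e <= dualval k k' (u_ n).
    have := tangent LL v (u_In n); rewrite KbvE lee_fin /dualval; lra.
  have [v0|v0|v0] := ltgtP v 0.
  - have := slope_le_sup 0; case: slope_sup => [c| |]//.
      rewrite lee_fin => h; apply: le_trans (JS 0%N).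
      rewrite -EFinM -EFinB lee_fin; apply: le_trans (ve 0%N).
      by rewrite lerD2r ler_wnM2l// ltW.
    by move=> _; rewrite lt0_muley ?lte_fin// addNye leNye.
  - have [Soo|] := ltP S +oo%E; last by rewrite leye_eq => /eqP ->; exact: leey.
    have : S \is a fin_num.
      by rewrite fin_numElt Soo andbT; exact: lt_le_trans (ltNyr _) (JS 0%N).
    move=> /fineK <-; set sg := fine S.
    have JS' n : dualval k k' (u_ n) <= sg.
      rewrite -lee_fin fineK//; rewrite fin_numElt Soo andbT.
      exact: lt_le_trans (ltNyr _) (JS 0%N).
    have : (slope_sup <= ((sg + e) / v)%:E)%E.
      apply: ge_ereal_sup => _ [n _ <-]; rewrite lee_fin ler_pdivlMr// mulrC.
      by rewrite -lerBlDr (le_trans (ve n)).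
    case: slope_sup => [c| |]//.
      by rewrite lee_fin ler_pdivlMr// -EFinM -EFinB lee_fin lerBlDr mulrC.
    by move=> _; rewrite gt0_muleNy ?lte_fin// addNye leNye.
  - rewrite v0 mul0e add0e; apply: le_trans (JS 0%N).
    by rewrite -EFinN lee_fin; have := ve 0%N; rewrite v0 mul0r sub0r.
apply: ge_ereal_sup => _ [n _ <-].
apply: (@le_trans _ _ ((u_ n)%:E * slope_sup - Kb (u_ n))%E); last first.
  by apply: ereal_sup_ubound; exists (u_ n).
rewrite (KbE LL)// /dualval EFinB; apply: leeB => //.
by rewrite EFinM lee_wpmul2l ?lee_fin// slope_le_sup.
Qed.


Variable U : \bar R.
Hypotheses (u_U : (u_ n)%:E @[n --> \oo] --> U) (u_ltU : forall n, ((u_ n)%:E < U)%E).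

Lemma slope_sup_continuous : (U < p)%E -> slope_sup = (k' (fine U))%:E.
Proof.
move=> Up; have U0 : (0 < U)%E by apply: le_lt_trans (u_ltU 0); rewrite lee_fin.
have Uf : U \is a fin_num.
  by rewrite fin_numElt (lt_trans (ltNyr 0) U0)/= (lt_le_trans Up) ?leey.
have UE := fineK Uf; move: Uf UE; move: (fine U) => r Uf UE.
have IU : In r by apply: (between_ge0 LL); rewrite ?UE// -lee_fin UE ltW.
have uU n : u_ n <= r by rewrite -lee_fin UE ltW.
apply/eqP; rewrite eq_le; apply/andP; split.
  by apply: ge_ereal_sup => _ [n _ <-]; rewrite lee_fin (slope_mono LL).
have cu : u_ n @[n --> \oo] --> r by apply: (@fine_cvg _ _ _ _ (fun n => (u_ n)%:E)); rewrite UE.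
have h : k' (u_ n) @[n --> \oo] --> k' r by exact: (cvg_comp _ _ cu (slope_continuous IU)).
apply/lee_subgt0Pr => e e0.
have [n _ /(_ n (leqnn n)) /= hn] := iffLR (@cvgrPdist_le _ _ _ \oo _ _ _) h e e0.
apply: le_trans (slope_le_sup n); rewrite -EFinB lee_fin lerBlDr addrC -lerBlDr.
by apply: le_trans hn; exact: ler_norm.
Qed.

Hypothesis Up : U = p.

Lemma lt_approx (c : \bar R) : (c < p)%E -> exists n, (c < (u_ n)%:E)%E.
Proof.
rewrite -Up => cU; have [n _ h] := cvge_near_gt u_U cU.
by exists n; apply: h => /=.
Qed.

Lemma slope_sup_all : ereal_sup [set (k' u)%:E | u in In] = slope_sup.
Proof.
apply/eqP; rewrite eq_le; apply/andP; split.
  apply: ge_ereal_sup => _ [u Iu <-]; have [n /ltW un] := lt_approx Iu.2.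
  by apply: le_trans (slope_le_sup n); rewrite lee_fin (slope_mono LL).
by apply: ereal_sup_le => _ [n _ <-]; exists (u_ n).
Qed.

Lemma slope_sup_limit (I : Type) (F : set_system I) (FF : Filter F) (g phi : I -> R) :
  (\forall i \near F, In (phi i) /\ g i = k' (phi i)) ->
  (phi i)%:E @[i --> F] --> p -> (g i)%:E @[i --> F] --> slope_sup.
Proof.
move=> hIn phip; apply: cvg_ereal_squeeze.
  move=> c /ereal_sup_gt[_ [n _ <-] cn]; near=> i.
  have [Ii ->] : In (phi i) /\ g i = k' (phi i) by near: i.
  apply: (le_trans (ltW cn)); rewrite lee_fin (slope_mono LL)// -lee_fin ltW//.
  by near: i; apply: (cvge_near_gt phip); rewrite -Up.
near=> i.
have [Ii ->] : In (phi i) /\ g i = k' (phi i) by near: i.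
have [n /ltW un] := lt_approx Ii.2.
by apply: le_trans (slope_le_sup n); rewrite lee_fin (slope_mono LL).
Unshelve. all: by end_near. Qed.

(** Upper bound: [u x - Kb u] is [u (x - s)] plus [u s - Kb u], and [u <= p] on the domain. Lower
    bound: the points [u_ n], whose slopes are at most [s]. For [p = +oo] and [x = s] the product is
    0. *)
Lemma dualsup_affine (s x : R) : slope_sup = s%:E -> s <= x ->
  (forall u, (Kb u < +oo)%E -> (u%:E <= p)%E) ->
  dualsup Kb x%:E = (p * (x - s)%:E + dualsup Kb s%:E)%E.
Proof.
move=> sE sx dom; have xs0 : (0 <= (x - s)%:E)%E by rewrite lee_fin subr_ge0.
have DsNy : (dualsup Kb s%:E != -oo)%E.
  rewrite -sE dualsup_slope_sup gt_eqF//; apply: (lt_le_trans (ltNyr (dualval k k' (u_ 0%N)))).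
  by apply: ereal_sup_ubound; exists 0%N.
apply/eqP; rewrite eq_le; apply/andP; split.
  apply: ge_ereal_sup => _ [u _ <-].
  have [Koo|] := ltP (Kb u) +oo%E; last first.
    by rewrite leye_eq => /eqP ->; rewrite addeNy leNye.
  have -> : (u%:E * x%:E - Kb u = u%:E * (x - s)%:E + (u%:E * s%:E - Kb u))%E.
    by rewrite addeA -!EFinM -EFinD; congr (_%:E - _)%E; ring.
  apply: leeD; first by rewrite lee_wpmul2r// dom.
  by apply: ereal_sup_ubound; exists u.
have cl : ((u_ n)%:E * (x - s)%:E + (dualval k k' (u_ n))%:E)%E @[n --> \oo] -->
    (p * (x - s)%:E + dualsup Kb s%:E)%E.
  apply: cvgeD.
  - have pxs : (0 <= p * (x - s)%:E)%E by rewrite mule_ge0// ltW//; case: LL.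
    by rewrite /adde_def (negbTE DsNy) andbF/= negb_and gt_eqF// (lt_le_trans (ltNyr 0) pxs).
  - by apply: cvgeZr => //; rewrite -Up.
  - rewrite -sE dualsup_slope_sup; apply: ereal_nondecreasing_cvgn => i j ij.
    by rewrite lee_fin (dualval_mono LL)// u_nd.
rewrite -(cvg_lim _ cl)//; apply: lime_le; [by apply/cvg_ex; eexists; exact: cl|apply: nearW => n].
apply: le_trans (ereal_sup_ubound _); last by exists (u_ n).
rewrite (KbE LL)// -!EFinM -EFinB -EFinD lee_fin /dualval.
have := slope_le_sup n; rewrite sE lee_fin => h.
have := ler_wpM2l (u_ge0 n) h; lra.
Qed.

Hypothesis strict : forall u v, In u -> In v -> u < v -> k' u < k' v.

(** If [g i] were at most some [u_ n], its slope would be at most that of [u_ n], which strict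
    monotonicity puts strictly below the limit of the slopes. *)
Lemma slope_inverse_limit (I : Type) (F : set_system I) (FF : Filter F) (g : I -> R) :
  (\forall i \near F, In (g i)) -> (k' (g i))%:E @[i --> F] --> slope_sup ->
  (g i)%:E @[i --> F] --> p.
Proof.
move=> gIn gs; apply: cvg_ereal_squeeze; last first.
  by apply: filterS gIn => i [_ /ltW].
move=> c /lt_approx[n cn]; have [n' nn'] := lt_approx (u_In n).2.
have ns : ((k' (u_ n))%:E < slope_sup)%E.
  by apply: lt_le_trans (slope_le_sup n'); rewrite lte_fin strict.
near=> i; have Ii : In (g i) by near: i.
have : ((k' (u_ n))%:E < (k' (g i))%:E)%E by near: i; exact: (cvge_near_gt gs).
rewrite lte_fin => kk; apply: (le_trans (ltW cn)); rewrite lee_fin leNgt.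
by apply/negP => /ltW /(slope_mono LL Ii (u_In n)); rewrite leNgt kk.
Unshelve. all: by end_near. Qed.

End LegendreLineContinuity.

Section Edge.
Context {R : realType}.

Lemma exists_approx (p : \bar R) : (0 < p)%E -> exists u_ : nat -> R,
  [/\ forall n, 0 <= u_ n, {homo u_ : n m / (n <= m)%N >-> n <= m},
      forall n, ((u_ n)%:E < p)%E & (u_ n)%:E @[n --> \oo] --> p].
Proof.
case: p => [r| |]// r0.
- exists (fun n => r - r * n.+1%:R^-1); rewrite lte_fin in r0; split => [n|n m nm|n|].
  + by rewrite subr_ge0 ler_piMr ?(ltW r0)// invf_le1// ler1n.
  + by rewrite lerD2l lerN2 ler_pM2l// lef_pV2 ?posrE// ler_nat.
  + by rewrite lte_fin ltrBlDr ltrDl mulr_gt0// invr_gt0.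
  + apply: cvg_EFin; first exact: nearW.
    rewrite -[X in _ --> X]subr0 -[X in _ --> _ - X](mulr0 r).
    by apply: cvgB; [exact: cvg_cst|apply: cvgMr; exact: cvg_harmonic].
- exists (fun n => n%:R); split => //.
  + by move=> n m nm; rewrite ler_nat.
  + by move=> n; exact: ltry.
  + by apply/cvgeyPge => A; near=> n; rewrite lee_fin; near: n; exact: nbhs_infty_ger.
Unshelve. all: by end_near. Qed.

Implicit Types (k : R -> R) (Kb : R -> \bar R) (p m U : \bar R) (u : R).

(** [K1'ext] with abstract end points, so that it can also be applied to the reflected line. *)
Definition slope_ext (k' : R -> R) p m U : \bar R :=
  if U == p then lim_left k' U
  else if U == (- m)%E then lim_right k' U else (k' (fine U))%:E.

Lemma slope_ext_between (k' : R -> R) p m u : between m p u -> slope_ext k' p m u%:E = (k' u)%:E.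
Proof. by move=> [u1 u2]; rewrite /slope_ext lt_eqF// gt_eqF. Qed.

Section Ray.
Variables (k k' : R -> R) (Kb : R -> \bar R) (p m : \bar R).
Hypothesis LL : legendre_line k k' Kb p m.
Variables (u_ : nat -> R) (U : \bar R).
Hypothesis (u_In : forall n, between m p (u_ n)).
Hypotheses (u_ge0 : forall n, 0 <= u_ n) (u_ltU : forall n, ((u_ n)%:E < U)%E).
Hypothesis (u_U : (u_ n)%:E @[n --> \oo] --> U).

Let p0 : (0 < p)%E. Proof. by case: LL. Qed.
Let m0 : (0 < m)%E. Proof. by case: LL. Qed.
Let U0 : (0 < U)%E. Proof. by apply: le_lt_trans (u_ltU 0); rewrite lee_fin. Qed.

Let Up : (U <= p)%E.
Proof.
rewrite -(cvg_lim _ u_U)//; apply: lime_le; first by apply/cvg_ex; exists U.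
by apply: nearW => n; exact: ltW (u_In n).2.
Qed.

Lemma slope_ext_pos : slope_ext k' p m U = slope_sup k' u_.
Proof.
rewrite /slope_ext; have [UE|Unp] := eqVneq U p; last first.
  have mU : (- m < U)%E by apply: lt_trans U0; rewrite lteNl oppe0.
  rewrite gt_eqF// (slope_sup_continuous LL u_In u_ge0 u_U u_ltU)//.
  by rewrite lt_neqAle Unp.
apply: lim_leftP => [|F FF Fp Fl]; first by rewrite gt_eqF// (lt_trans _ U0)// ltNyr.
apply: (slope_sup_limit LL u_In u_U u_ltU UE _ (phi := id)); last by rewrite -UE.
near=> u; split => //; apply: (between_ge0 LL).
  by rewrite -lee_fin ltW//; near: u; exact: (cvge_near_gt Fp).
by rewrite -UE; near: u.
Unshelve. all: by end_near. Qed.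

Lemma slope_ext_neg : slope_ext (negrefl k') m p (- U)%E = (- slope_sup k' u_)%E.
Proof.
have NU0 : (- U < 0)%E by rewrite lteNl oppe0.
rewrite /slope_ext lt_eqF ?(lt_trans NU0)// eqe_opp.
have [UE|Unp] := eqVneq U p; last first.
  rewrite (slope_sup_continuous LL u_In u_ge0 u_U u_ltU) ?lt_neqAle ?Unp//.
  by rewrite fineN /negrefl opprK.
apply: lim_rightP => [|F FF Fp Fl].
  by rewrite lt_eqF// (lt_trans NU0)// ltry.
have NF : (- u)%:E @[u --> F] --> p.
  by rewrite -UE -[U]oppeK; exact: cvgeN Fp.
rewrite (_ : (fun u => _) = (fun u => - (k' (- u))%:E)%E); last by apply/funext.
apply: cvgeN; apply: (slope_sup_limit LL u_In u_U u_ltU UE _ (phi := fun u => - u)); last exact: NF.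
near=> u; split => //; apply: (between_ge0 LL).
  by rewrite -lee_fin ltW//; near: u; exact: (cvge_near_gt NF).
by rewrite -UE EFinN lteNl; near: u.
Unshelve. all: by end_near. Qed.

End Ray.

Variables (k k' : R -> R) (Kb : R -> \bar R) (p m : \bar R).
Hypothesis LL : legendre_line k k' Kb p m.

Lemma dualval_refl u : dualval (refl k) (negrefl k') u = dualval k k' (- u).
Proof. by rewrite /dualval /refl /negrefl mulrN mulNr. Qed.

(** Legendre values increase away from 0 in both directions; the case [c < 0] is the positive side
    of the reflected line. *)
Lemma dualval_ray_mono (c s t : R) : 0 <= s <= t -> between m p (t * c) ->
  dualval k k' (s * c) <= dualval k k' (t * c).
Proof.
move=> /andP[s0 st] It; have [c0|c0] := leP 0 c.
  have h0 : 0 <= s * c by rewrite mulr_ge0.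
  have hh : s * c <= t * c by rewrite ler_wpM2r.
  have Is : between m p (s * c) by apply: (between_le (between0 LL) It).
  exact: (dualval_mono LL Is It).
rewrite -(opprK (s * c)) -(opprK (t * c)) -!dualval_refl.
have LN := legendre_line_refl LL.
have It' : between p m (- (t * c)) by apply/betweenN.
have h0 : 0 <= - (s * c) by rewrite -mulrN mulr_ge0// oppr_ge0 ltW.
have hh : - (s * c) <= - (t * c) by rewrite -!mulrN ler_wpM2r// oppr_ge0 ltW.
have Is : between p m (- (s * c)) by apply: (between_le (between0 LN) It').
exact: (dualval_mono LN Is It').
Qed.

(** Used with [c] a value of [f] up to sign. According to the sign of [c] the ray runs to the right,
    or to the right on the reflected line; for [c = 0] it stays at 0, since [M * 0 = 0] even for
    infinite [M]. *)
Lemma dualsup_slope_ext (c : R) (M : \bar R) (u_ : nat -> R) :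
  (forall n, 0 <= u_ n) -> {homo u_ : n m / (n <= m)%N >-> n <= m} ->
  (forall n, ((u_ n)%:E < M)%E) -> (u_ n)%:E @[n --> \oo] --> M ->
  (forall n, between m p (u_ n * c)) ->
  dualsup Kb (slope_ext k' p m (M * c%:E)) =
    ereal_sup (range (fun n => (dualval k k' (u_ n * c))%:E)).
Proof.
move=> u0 und uM ucvg uIn; have [->|cn0] := eqVneq c 0.
  have -> : range (fun n => (dualval k k' (u_ n * 0))%:E) = [set (dualval k k' 0)%:E].
    by apply/seteqP; split => x => [[n _ <-]|->]; [rewrite mulr0|exists 0%N; rewrite ?mulr0].
  by rewrite ereal_sup1 mule0 slope_ext_between ?(dualval_dualsup LL)//; exact: between0 LL.
have cv (x : R) : (u_ n * x)%:E @[n --> \oo] --> (M * x%:E)%E.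
  by apply: (@cvgeZr _ _ _ (fun n => (u_ n)%:E) M x%:E).
have lt (x : R) n : 0 < x -> ((u_ n * x)%:E < M * x%:E)%E.
  by move=> x0; rewrite EFinM lte_pmul2r.
have [c0|c0] := ltP 0 c.
  have v0 n : 0 <= u_ n * c by rewrite mulr_ge0// ltW.
  have vlt n := lt c n c0.
  rewrite (slope_ext_pos LL uIn v0 vlt (cv c)) (dualsup_slope_sup LL uIn v0)//.
have {}c0 : 0 < - c by rewrite oppr_gt0 lt_neqAle cn0.
have LN := legendre_line_refl LL.
have v0 n : 0 <= u_ n * - c by rewrite mulr_ge0// ltW.
have vlt n := lt (- c) n c0.
have vIn n : between p m (u_ n * - c) by rewrite mulrN; apply/betweenN.
have := slope_ext_neg LN vIn v0 vlt (cv (- c)).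
rewrite EFinN muleN oppeK.
rewrite (_ : negrefl (negrefl k') = k'); last by apply/funext => u; rewrite /negrefl !opprK.
move=> ->; rewrite -dualsup_refl oppeK (dualsup_slope_sup LN vIn v0).
by congr ereal_sup; apply/seteqP; split => _ [n _ <-]; exists n => //;
  rewrite dualval_refl mulrN opprK.
Qed.

End Edge.

(** * Row vectors of length one, and the identification with the abstract line *)

Section LineVectors.
Context {R : realType}.
Local Notation V := 'rV[R]_1.
Local Notation cv := (@cv R 1).
Implicit Types (u h a : R) (v w : V).

Lemma cv_surj v : v = cv (v 0 0).
Proof. by apply/rowP => i; rewrite mxE ord1. Qed.

Lemma cvZ a u : a *: cv u = cv (a * u).
Proof. by apply/rowP => i; rewrite !mxE. Qed.

Lemma cvD u h : cv (u + h) = cv u + cv h.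
Proof. by apply/rowP => i; rewrite !mxE. Qed.

Lemma cvN u : cv (- u) = - cv u.
Proof. by apply/rowP => i; rewrite !mxE. Qed.

Lemma norm_cv u : `|cv u| = `|u|.
Proof.
apply/eqP; rewrite eq_le; apply/andP; split.
  by apply: norm_leP => // i; rewrite mxE.
by have := le_coord (cv u) 0; rewrite mxE.
Qed.

Lemma dotp_cv u w : dotp (cv u) w = u * w 0 0.
Proof. by rewrite /dotp big_ord1 mxE. Qed.

Lemma interior_cv (C : set V) u : interior C (cv u) <-> \forall v \near u, C (cv v).
Proof.
split => [/nbhs_ballP|/nbhs_ballP] [e /= e0 h]; apply/nbhs_ballP; exists e => // y.
  rewrite /ball/= => uy; apply: h; rewrite -ball_normE/= -norm_cv in uy *.
  by rewrite cvD cvN in uy.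
rewrite -ball_normE/= => uy; rewrite (cv_surj y); apply: h; rewrite /ball/= -norm_cv.
by rewrite cvD cvN -cv_surj.
Qed.

End LineVectors.

(** For [a = 0] both sides hold: the quotient is infinite by convention and [A] is positive. *)
Lemma lt_ediv {R : realType} (A : \bar R) (a l : R) : 0 <= a -> (0 < A)%E ->
  (l%:E < ediv A a)%E <-> ((a * l)%:E < A)%E.
Proof.
rewrite /ediv; case: eqVneq => [-> _ A0|an0 a0 _]; first by rewrite mul0r ltry.
have {an0 a0}a0 : 0 < a by rewrite lt_neqAle eq_sym an0.
by rewrite lte_pdivlMr// -EFinM mulrC.
Qed.

Section OneDimension.
Context {R : realType} {dT : measure_display}
  {T : measurableType dT} (P : probability T R) (X0 : T -> 'rV[R]_1).
Local Notation I01 := (`[0%R, 1%R]%classic : set R).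
Local Notation leb := (@lebesgue_measure R).
Local Notation cv := (@cv R 1).
Hypothesis mX0 : forall B, borelV B -> measurable (X0 @^-1` B).
Hypothesis int0 : interior (DL P X0) 0.
Implicit Types (u v l x y : R).

Local Notation Ip := (Iinf_p P X0).
Local Notation Im := (Iinf_m P X0).
Let PT : (0 < P (X0 @^-1` setT))%E := probT_gt0 P X0.
Let aT := adm0T mX0 int0.

Lemma interior_DL_cv u : interior (DL P X0) (cv u) <-> between Im Ip u.
Proof.
split => [/interior_cv/nbhs_ballP[e /= e0 h]|[u1 u2]].
  have D h' : `|h'| < e -> DL P X0 (cv (u + h')).
    by move=> he; apply: h; rewrite /ball/= opprD addrA subrr sub0r normrN.
  have e2 : `|e / 2| < e by rewrite gtr0_norm ?divr_gt0// ltr_pdivrMr// ltr_pMr// ltr1n.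
  split.
    rewrite lteNl; apply: (@lt_le_trans _ _ (- (u - e / 2))%:E).
      by rewrite -EFinN lte_fin ltrN2 ltrBlDr ltrDl divr_gt0.
    apply: ereal_sup_ubound; exists (cv (u - e / 2)); first by apply: D; rewrite normrN.
    by rewrite dotp_cv mxE mulrN1.
  apply: (@lt_le_trans _ _ (u + e / 2)%:E); first by rewrite lte_fin ltrDl divr_gt0.
  apply: ereal_sup_ubound; exists (cv (u + e / 2)); first exact: D.
  by rewrite dotp_cv mxE mulr1.
have [_ [v Dv <-]] := ereal_sup_gt u2; rewrite dotpC dotp_cv mul1r lte_fin => uv.
move: u1; rewrite lteNl => /ereal_sup_gt[_ [w Dw <-]].
rewrite dotpC dotp_cv mulN1r -EFinN lte_fin ltrN2 => wu.
rewrite (cv_surj v) in Dv; rewrite (cv_surj w) in Dw.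
move: (v 0 0) (w 0 0) Dv Dw uv wu => b a Db Da ub au.
apply/interior_cv; near=> y.
have ay : a < y by near: y; exact: lt_nbhsr.
have yb : y < b by near: y; exact: lt_nbhsl.
have ab : 0 < b - a by rewrite subr_gt0 (lt_trans ay).
pose s := (y - a) / (b - a).
have s01 : 0 <= s <= 1.
  apply/andP; split; first by rewrite divr_ge0// ?subr_ge0 ltW// (lt_trans ay).
  by rewrite ler_pdivrMr// mul1r lerD2r ltW.
have -> : cv y = (1 - s) *: cv a + s *: cv b.
  rewrite !cvZ -cvD; congr Defs.cv; rewrite /s; field; exact: lt0r_neq0.
exact: DL_convex.
Unshelve. all: by end_near. Qed.

Lemma Iinf_gt0 : (0 < Ip)%E /\ (0 < Im)%E.
Proof.
have /interior_DL_cv[h1 h2] : interior (DL P X0) (cv 0).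
  by rewrite (_ : cv 0 = 0)//; apply/rowP => i; rewrite !mxE.
by split => //; rewrite -oppe0 lteNl in h1 *.
Qed.

Lemma K1_quad u : between Im Ip u -> exists del C, 0 < del /\ forall h, `|h| <= del ->
  `|K1 P X0 (u + h) - K1 P X0 u - h * cgrad P X0 setT (cv u) 0 0| <= C * `|h| ^+ 2.
Proof.
move=> /interior_DL_cv/(Kr_quad mX0)[del [C [d0 q]]]; exists del, C; split => // h.
by rewrite -norm_cv => /q; rewrite dotp_cv -cvD.
Qed.

Lemma K1'E u : between Im Ip u -> K1' P X0 u = cgrad P X0 setT (cv u) 0 0.
Proof. by move=> /K1_quad[del [C [d0 q]]]; have [] := quad_derive1 d0 q. Qed.

Lemma legendre_line_K :
  legendre_line (K1 P X0) (K1' P X0) (fun u => Kbar P X0 (cv u)) Ip Im.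
Proof.
have [Ip0 Im0] := Iinf_gt0; split => // [u v Iu|u Iu|u Iu].
- have /(interior_emom mX0)[rho rho0 uoo] := iffRL (interior_DL_cv u) Iu.
  have := Kbar_lower (mgf_jensen mX0 borel_setT rho0 uoo PT (cv v)).
  by rewrite -cvN -cvD dotp_cv K1'E// /K1 Kr_cgf.
- have /(interior_emom mX0)[rho rho0 uoo] := iffRL (interior_DL_cv u) Iu.
  rewrite /K1 Kr_cgf// Kbar_fin//.
  exact: (mgf_lty mX0 borel_setT (ltW rho0) uoo).
- by have := K1_quad Iu; rewrite K1'E.
Qed.

Variables (f : R -> R) (Lf : R).
Hypothesis fL : forall s t, I01 s -> I01 t -> `|f s - f t| <= Lf * `|s - t|.
Local Notation Mp := (Mplus P X0 f).
Local Notation Mm := (Mminus P X0 f).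
Local Notation E := (Ef1 P X0 f).
Local Notation E' := (Ef1' P X0 f).
Local Notation gradT := (energy_grad P X0 setT f).
Local Notation Eb := (fun l : R => Ef P X0 f (cv l)).

(** The two clauses of [intD] amount to four inequalities, two bounding [l] from above and two from
    below; the minima in [Mplus] and [Mminus] collect them. *)
Lemma intD_cv l : intD P X0 f (cv l) <-> between Mm Mp l.
Proof.
have [Ip0 Im0] := Iinf_gt0; have a0 := a_ge0 fL; have b0 := b_ge0 fL.
rewrite /intD cvZ cvZ -cvN; split.
  move=> [/interior_DL_cv[a1 a2] /interior_DL_cv[b1 b2]]; split.
    rewrite lteNl -EFinN lt_min; apply/andP; split; apply/lt_ediv => //.
      by rewrite mulrN.
    by rewrite mulrN EFinN lteNl.
  rewrite lt_min; apply/andP; split; apply/lt_ediv => //.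
  by move: b1; rewrite EFinN lteN2.
move=> [h1 h2]; move: h1; rewrite lteNl -EFinN lt_min => /andP[/lt_ediv h1 /lt_ediv h3].
move: h2; rewrite lt_min => /andP[/lt_ediv h2 /lt_ediv h4].
split; apply/interior_DL_cv; split.
- by have := h3 a0 Im0; rewrite mulrN EFinN lteNl.
- exact: h2.
- by rewrite EFinN lteN2; exact: h4.
- by have := h1 b0 Ip0; rewrite mulrN.
Qed.

Lemma intDf1E : intDf1 P X0 f = between Mm Mp.
Proof.
apply/seteqP; split => l.
  by move=> /(iffLR (interior_Df int0 fL _))/intD_cv.
by move=> /intD_cv h; exact: (iffRL (interior_Df int0 fL _) h).
Qed.

Lemma good_cv l : between Mm Mp l -> good P X0 setT f (cv l).
Proof. by move=> /intD_cv/(intD_good mX0 fL). Qed.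

Lemma Ef1_quad l : between Mm Mp l -> exists del C, 0 < del /\ forall h, `|h| <= del ->
  `|E (l + h) - E l - h * gradT (cv l) 0 0| <= C * `|h| ^+ 2.
Proof.
move=> /good_cv/(Efr_quad mX0 int0 fL)[del [C [d0 q]]]; exists del, C; split => // h.
by rewrite -norm_cv => /q; rewrite dotp_cv -cvD.
Qed.

Lemma Ef1'E l : between Mm Mp l -> E' l = gradT (cv l) 0 0.
Proof. by move=> /Ef1_quad[del [C [d0 q]]]; have [] := quad_derive1 d0 q. Qed.

Lemma between_M0 : between Mm Mp 0.
Proof.
apply/intD_cv; have c0 : cv 0 = 0 by apply/rowP => i; rewrite !mxE.
by rewrite /intD c0 !scaler0 oppr0.
Qed.

Lemma legendre_line_E : legendre_line E E' Eb Mp Mm.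
Proof.
have [M1 M2] := between_M0; split => // [|u v Iu|u Iu|u Iu].
- by rewrite -oppe0 lteNl in M1 *.
- have gu := good_cv Iu; have := Ef_jensen mX0 int0 fL (cv v) gu.
  by rewrite -cvN -cvD dotp_cv Ef1'E// /Ef1 (Efr_good mX0 int0 fL gu).
- by rewrite /Ef1 (Efr_good mX0 int0 fL (good_cv Iu)) (Ef_good mX0 int0 fL (good_cv Iu)).
- by have := Ef1_quad Iu; rewrite Ef1'E.
Qed.

Lemma dualsup_E x : dualsup Eb x%:E = If P X0 f (cv x).
Proof.
congr ereal_sup; apply/seteqP; split => _ [l _ <-].
  by exists (cv l) => //; rewrite dotp_cv mxE.
have -> : dotp l (cv x) = l 0 0 * x by rewrite dotpC dotp_cv mulrC.
by exists (l 0 0); [exact: I|rewrite -(cv_surj l)].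
Qed.

(** All [s l] with [0 <= s < 1] lie strictly inside; letting [s] tend to 1 costs only the
    strictness. *)
Lemma Ef_cv_domain l : (Eb l < +oo)%E -> (l%:E <= Mp)%E /\ ((- l)%:E <= Mm)%E.
Proof.
move=> Eoo; have D s : 0 <= s < 1 -> between Mm Mp (s * l).
  by move=> s01; apply/intD_cv; rewrite -cvZ; exact: (Ef_finite_intD mX0 int0 fL).
have lim (M : \bar R) y : (forall s : R, 0 <= s < 1 -> ((s * y)%:E <= M)%E) -> (y%:E <= M)%E.
  case: M => [r| |] h; [|exact: leey|by have := h 0; rewrite lexx ltr01 => /(_ isT)].
  rewrite lee_fin leNgt; apply/negP => ry.
  have r0 : 0 <= r by have := h 0; rewrite lexx ltr01 mul0r lee_fin; exact.
  have y0 : 0 < y by exact: le_lt_trans ry.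
  have := h ((r + y) / 2 / y); rewrite divfK ?gt_eqF// lee_fin.
  have ry2 : 0 <= (r + y) / 2 by rewrite divr_ge0// addr_ge0// ltW.
  rewrite divr_ge0 ?(ltW y0)// ltr_pdivrMr// mul1r (_ : (r + y) / 2 < y); last by lra.
  by move=> /(_ isT); lra.
split; apply: lim => s /D[h1 h2]; first exact: ltW.
by rewrite mulrN EFinN leeNl ltW.
Qed.

End OneDimension.

(** * The rate function on the line *)

Section OneDimensionRate.
Context {R : realType} {dT : measure_display}
  {T : measurableType dT} (P : probability T R) (X0 : T -> 'rV[R]_1).
Local Notation I01 := (`[0%R, 1%R]%classic : set R).
Local Notation leb := (@lebesgue_measure R).
Local Notation cv := (@cv R 1).
Hypothesis mX0 : forall B, borelV B -> measurable (X0 @^-1` B).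
Hypothesis int0 : interior (DL P X0) 0.
Variables (f : R -> R) (Lf : R).
Hypothesis fL : forall s t, I01 s -> I01 t -> `|f s - f t| <= Lf * `|s - t|.
Implicit Types (u v l x y e : R).

Local Notation Ip := (Iinf_p P X0).
Local Notation Im := (Iinf_m P X0).
Local Notation Mp := (Mplus P X0 f).
Local Notation Mm := (Mminus P X0 f).
Local Notation E := (Ef1 P X0 f).
Local Notation E' := (Ef1' P X0 f).
Local Notation Eb := (fun l : R => Ef P X0 f (cv l)).
Local Notation supE := (supEf' P X0 f).
Local Notation infE := (infEf' P X0 f).
Local Notation inv := (Ef1'inv P X0 f).
Let PT : (0 < P (X0 @^-1` setT))%E := probT_gt0 P X0.
Let aT := adm0T mX0 int0.
Let LK := legendre_line_K mX0 int0.
Let LE := legendre_line_E mX0 int0 fL.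

Lemma K1_path_between l t : between Mm Mp l -> I01 t -> between Im Ip (f t * l).
Proof.
move=> /(intD_cv mX0 int0 fL) Dl It; apply/(interior_DL_cv P mX0).
by rewrite -cvZ; exact: (intD_interior mX0 int0 fL).
Qed.

Lemma K1_path_dualval l t : between Mm Mp l -> I01 t ->
  dualval (K1 P X0) (K1' P X0) (f t * l) =
  f t * dotp (cv l) (cgrad P X0 setT (f t *: cv l)) - cgf P X0 setT (f t *: cv l).
Proof.
move=> Il It; have Iu := K1_path_between Il It.
by rewrite /dualval (K1'E mX0 Iu) cvZ dotp_cv mulrA /K1 Kr_cgf.
Qed.

Lemma integral_dualval l : between Mm Mp l ->
  (\int[leb]_(t in I01) (dualval (K1 P X0) (K1' P X0) (f t * l))%:E =
   (dualval E E' l)%:E)%E.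
Proof.
move=> Il; have gl := good_cv mX0 int0 fL Il.
rewrite /dualval (Ef1'E mX0 int0 fL Il) -dotp_cv /Ef1 (Efr_good mX0 int0 fL gl).
rewrite -(legendre_path mX0 int0 fL gl).
by apply: eq_integral => t; rewrite inE => It; rewrite -K1_path_dualval.
Qed.

Lemma measurable_dualval l : between Mm Mp l ->
  measurable_fun I01 (fun t => (dualval (K1 P X0) (K1' P X0) (f t * l))%:E).
Proof.
move=> Il; have gl := good_cv mX0 int0 fL Il.
apply: eq_measurable_fun (measurable_int leb (legendre_path_integrable mX0 int0 fL gl)).
by move=> t; rewrite inE => It /=; rewrite K1_path_dualval.
Qed.

(* [e] is the sign distinguishing the two ends of the domain of [E_f]. *)
Lemma integral_edge e (M : \bar R) (u_ : nat -> R) :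
  (forall n, 0 <= u_ n) -> {homo u_ : n m / (n <= m)%N >-> n <= m} ->
  (forall n, ((u_ n)%:E < M)%E) -> (u_ n)%:E @[n --> \oo] --> M ->
  (forall n, between Mm Mp (e * u_ n)) ->
  (\int[leb]_(t in I01) I1ext P X0 (K1'ext P X0 (M * (e * f t)%:E)) =
   ereal_sup (range (fun n => (dualval E E' (e * u_ n))%:E)))%E.
Proof.
move=> u0 und uM ucvg uD.
pose g n t := (dualval (K1 P X0) (K1' P X0) (f t * (e * u_ n)))%:E.
have eA n t : f t * (e * u_ n) = u_ n * (e * f t) by ring.
have gIn t n : I01 t -> between Im Ip (u_ n * (e * f t)).
  by move=> It; rewrite -eA; exact: K1_path_between.
have g_nd t : I01 t -> {homo g^~ t : n m / (n <= m)%N >-> (n <= m)%E}.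
  move=> It n m nm; rewrite /g lee_fin !eA; apply: (dualval_ray_mono LK).
    by rewrite u0 und.
  exact: gIn.
have g_cvg t : I01 t -> g n t @[n --> \oo] -->
    I1ext P X0 (K1'ext P X0 (M * (e * f t)%:E)).
  move=> It; have := dualsup_slope_ext LK u0 und uM ucvg (fun n => gIn t n It).
  rewrite -[dualsup _ _]/(I1ext P X0 (K1'ext P X0 (M * (e * f t)%:E))) => ->.
  rewrite (_ : (fun n => (dualval _ _ (u_ n * _))%:E) = g^~ t); last first.
    by apply/funext => n; rewrite /g eA.
  exact: ereal_nondecreasing_cvgn (g_nd t It).
(* Monotone convergence wants nonnegative terms: the Legendre value at 0 is [- K(0) = 0], and the
   values increase along the ray. *)
have g_ge0 n t : I01 t -> (0 <= g n t)%E.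
  move=> It; rewrite /g lee_fin eA.
  have := @dualval_ray_mono _ _ _ _ _ _ LK (e * f t) 0 (u_ n); rewrite lexx u0 mul0r.
  move=> /(_ isT (gIn t n It)); apply: le_trans.
  rewrite /dualval mul0r sub0r (_ : K1 P X0 0 = 0) ?oppr0//.
  rewrite /K1 (_ : Defs.cv 0 = 0); last by apply/rowP => i; rewrite !mxE.
  rewrite Kr_cgf// -[cgf P X0 setT 0]/(ln (fine (mgf P X0 setT 0))).
  by rewrite (mgf0 P mX0 borel_setT) preimage_setT probability_setT ln1.
have mg n : measurable_fun I01 (g n) by exact: measurable_dualval.
have mI : measurable I01 by exact: measurable_itv.
have cl := @cvg_monotone_convergence _ _ _ leb I01 mI g mg g_ge0 g_nd.
transitivity (\int[leb]_(t in I01) limn (g^~ t))%E.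
  apply: eq_integral => t; rewrite inE => It; apply/esym.
  exact: (cvg_lim _ (g_cvg t It)).
rewrite -(cvg_lim _ cl)// (_ : (fun n => \int[leb]_(t in I01) g n t)%E =
    (fun n => (dualval E E' (e * u_ n))%:E)); last first.
  by apply/funext => n; exact: integral_dualval.
apply: (cvg_lim _ _) => //; apply: ereal_nondecreasing_cvgn => n m nm.
have tr (a b a' b' : \bar R) : a = a' -> b = b' -> (a <= b -> a' <= b')%E by move=> -> ->.
apply: (tr _ _ _ _ (integral_dualval (uD n)) (integral_dualval (uD m))).
apply: ge0_le_integral; [exact: mI|exact: g_ge0 n|exact: mg n|exact: mg m|].
by move=> t It; exact: g_nd t It n m nm.
Qed.

Hypothesis full : full_affine_dim (supp_law P X0).
Hypothesis f_nz : exists t, I01 t /\ f t != 0.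

Lemma Ef1'_strict l l' : between Mm Mp l -> between Mm Mp l' -> l < l' -> E' l < E' l'.
Proof.
move=> Il Il' ll.
have gl := good_cv mX0 int0 fL Il; have gl' := good_cv mX0 int0 fL Il'.
rewrite lt_neqAle (slope_mono LE Il Il' (ltW ll)) andbT !(Ef1'E mX0 int0 fL)//.
apply/eqP => g00; have ge : energy_grad P X0 setT f (cv l) = energy_grad P X0 setT f (cv l').
  by rewrite (cv_surj (energy_grad _ _ _ _ _)) g00 -(cv_surj (energy_grad _ _ _ _ (cv l'))).
have /rowP/(_ 0) := gradT_inj mX0 int0 fL full f_nz gl gl' ge.
by rewrite !mxE => lE; rewrite lE ltxx in ll.
Qed.

Lemma supEE : supE = ereal_sup [set (E' u)%:E | u in between Mm Mp].
Proof. by rewrite /supEf' (intDf1E mX0 int0 fL). Qed.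

Lemma infEE : infE = ereal_inf [set (E' u)%:E | u in between Mm Mp].
Proof. by rewrite /infEf' (intDf1E mX0 int0 fL). Qed.

(** The intermediate value theorem provides a preimage, so [xget] returns a genuine one rather than
    its default 0. *)
Lemma Ef1'inv_spec y : (infE < y%:E)%E -> (y%:E < supE)%E ->
  between Mm Mp (inv y) /\ E' (inv y) = y.
Proof.
rewrite infEE supEE => /ereal_inf_lt[_ [l Il <-]] ly /ereal_sup_gt[_ [l' Il' <-]] yl.
rewrite !lte_fin in ly yl.
have ll : l <= l'.
  rewrite leNgt; apply/negP => /ltW /(slope_mono LE Il' Il); rewrite leNgt.
  by rewrite (lt_trans ly).
have [w Iw wy] := slope_ivt LE Il Il' ll (ltW ly) (ltW yl).
have Dw : intDf1 P X0 f w by rewrite (intDf1E mX0 int0 fL).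
have ex : exists l, intDf1 P X0 f l /\ E' l = y by exists w.
have [Dy yE] := xgetPex 0 ex; split; last exact: yE.
by rewrite -(intDf1E mX0 int0 fL); exact: Dy.
Qed.

(** A strictly increasing function on an open interval attains neither its supremum nor its infimum:
    a small step to either side moves beyond the given value. *)
Lemma Ef1'_bounds l : between Mm Mp l -> ((E' l)%:E < supE)%E /\ (infE < (E' l)%:E)%E.
Proof.
move=> Il.
have [e /= e0 h] := iffLR (nbhs_ballP _ _) (between_near Il).
have e2 : `|e / 2| < e by rewrite gtr0_norm ?divr_gt0// ltr_pdivrMr// ltr_pMr// ltr1n.
have e20 : 0 < e / 2 by rewrite divr_gt0.
have I1 : between Mm Mp (l + e / 2).
  by apply: h; rewrite /ball/= opprD addrA subrr sub0r normrN.
have I2 : between Mm Mp (l - e / 2).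
  by apply: h; rewrite /ball/= opprB addrCA subrr addr0.
rewrite supEE infEE; split.
  apply: (@lt_le_trans _ _ (E' (l + e / 2))%:E).
    by rewrite lte_fin Ef1'_strict// ltrDl.
  by apply: ereal_sup_ubound; exists (l + e / 2).
apply: (@le_lt_trans _ _ (E' (l - e / 2))%:E).
  by apply: ereal_inf_lbound; exists (l - e / 2).
by rewrite lte_fin Ef1'_strict// ltrBlDr ltrDl.
Qed.

Local Notation path_integral kap :=
  (\int[leb]_(t in I01) I1ext P X0 (K1'ext P X0 (kap * (f t)%:E)))%E.

Lemma If_inside x : (infE < x%:E)%E -> (x%:E < supE)%E ->
  If P X0 f (cv x) = path_integral (inv x)%:E.
Proof.
move=> x1 x2; have [Il lx] := Ef1'inv_spec x1 x2.
rewrite -(dualsup_E P X0 f x) -{1}lx (dualval_dualsup LE Il) -integral_dualval//.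
apply: eq_integral => t; rewrite inE => It; have Iu := K1_path_between Il It.
rewrite -EFinM (mulrC (inv x)).
rewrite -[K1'ext _ _ _]/(slope_ext (K1' P X0) Ip Im _) slope_ext_between//.
exact: esym (dualval_dualsup LK Iu).
Qed.

(** Being at most [x], the supremum is finite, and the inverse tends to [Mp] there. [dualsup_affine]
    splits off the linear term and leaves the value at the supremum, which [integral_edge] computes
    with sign 1. *)
Lemma If_right x : (supE <= x%:E)%E -> If P X0 f (cv x) =
  (Mp * (x%:E - supE) + path_integral (lim_left inv supE))%E.
Proof.
have [Mp0 Mm0 _ _ _] := LE.
have [u_ [u0 und uM ucvg]] := exists_approx Mp0.
have uD n : between Mm Mp (u_ n) by exact: (between_ge0 LE).
have sE : supE = slope_sup E' u_ by rewrite supEE (slope_sup_all LE uD ucvg (erefl _)).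
have [E0s iE0] := Ef1'_bounds (between0 LE).
have limE : supE != +oo%E -> lim_left inv supE = Mp.
  move=> soo; apply: lim_leftP => [|F FF Fs Fl].
    by rewrite gt_eqF// (lt_trans _ E0s)// ltNyr.
  have Fin : \forall y \near F, between Mm Mp (inv y) /\ E' (inv y) = y.
    near=> y; apply: Ef1'inv_spec.
      by apply: (lt_trans iE0); near: y; exact: (cvge_near_gt Fs).
    by near: y.
  apply: (slope_inverse_limit LE uD ucvg (erefl _) Ef1'_strict).
    by apply: filterS Fin => y [].
  rewrite -sE; apply: cvg_trans Fs; apply: near_eq_cvg.
  by apply: filterS Fin => y [_ ->].
move=> sx; have soo : supE != +oo%E by rewrite lt_eqF// (le_lt_trans sx)// ltry.
rewrite (limE soo).
have sfin : supE \is a fin_num.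
  by rewrite fin_numElt (lt_trans _ E0s) ?ltNyr//= ltey.
have := dualsup_affine LE uD u0 und ucvg (erefl _) (x := x).
move=> /(_ (fine supE)); rewrite fineK// => /(_ (esym sE)).
rewrite -lee_fin fineK// => /(_ sx (fun l h => (Ef_cv_domain mX0 int0 fL h).1)).
rewrite dualsup_E => ->; rewrite EFinB fineK//; congr (_ + _)%E.
rewrite sE (dualsup_slope_sup LE uD u0).
transitivity (\int[leb]_(t in I01) I1ext P X0 (K1'ext P X0 (Mp * (1 * f t)%:E)))%E.
  rewrite (integral_edge u0 und uM ucvg) => [|n]; last by rewrite mul1r.
  have h : (fun n => (dualval E E' (u_ n))%:E) = (fun n => (dualval E E' (1 * u_ n))%:E).
    by apply/funext => n; rewrite mul1r.
  exact: (congr1 (fun z => ereal_sup (range z)) h).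
by apply: eq_integral => t _; rewrite mul1r.
Unshelve. all: by end_near. Qed.

(** The right-hand argument on the reflected line: [- infE] is the limiting slope of the reflected
    [E_f], and the sign -1 in [integral_edge] undoes the reflection inside [K]. *)
Lemma If_left x : (x%:E <= infE)%E -> If P X0 f (cv x) =
  (Mm * (infE - x%:E) + path_integral (lim_right inv infE))%E.
Proof.
have LN := legendre_line_refl LE.
have [Mm0 Mp0 _ _ _] := LN.
have [u_ [u0 und uM ucvg]] := exists_approx Mm0.
have uD n : between Mp Mm (u_ n) by exact: (between_ge0 LN).
have negD u : between Mm Mp u -> between Mp Mm (- u) by move=> h; apply/betweenN.
have strictN u v : between Mp Mm u -> between Mp Mm v -> u < v ->
    negrefl E' u < negrefl E' v.
  move=> /betweenN Iu /betweenN Iv uv; rewrite /negrefl ltrN2.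
  by apply: Ef1'_strict => //; rewrite ltrN2.
have sE : (- infE)%E = slope_sup (negrefl E') u_.
  rewrite -(slope_sup_all LN uD ucvg (erefl _)) infEE /ereal_inf oppeK.
  congr ereal_sup; apply/seteqP; split => y.
    by move=> [_ [u Iu <-] <-]; exists (- u); [exact: negD|rewrite /negrefl opprK].
  move=> [u /betweenN Iu <-]; exists (E' (- u))%:E => //; first by exists (- u).
have [E0s iE0] := Ef1'_bounds (between0 LE).
have limE : infE != -oo%E -> lim_right inv infE = (- Mm)%E.
  move=> soo; apply: lim_rightP => [|F FF Fs Fl].
    by rewrite lt_eqF// (lt_trans iE0)// ltry.
  have Fin : \forall y \near F, between Mm Mp (inv y) /\ E' (inv y) = y.
    near=> y; apply: Ef1'inv_spec; first by near: y.
    by apply: (lt_trans _ E0s); near: y; exact: (cvge_near_lt Fs).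
  rewrite (_ : (fun y => (inv y)%:E) = (fun y => - (- inv y)%:E)%E); last first.
    by apply/funext => y; rewrite EFinN oppeK.
  apply: cvgeN; apply: (slope_inverse_limit LN uD ucvg (erefl _) strictN).
    by apply: filterS Fin => y [h _]; exact: negD.
  rewrite -sE; have NF : (- y%:E)%E @[y --> F] --> (- infE)%E by exact: cvgeN Fs.
  apply: cvg_trans NF; apply: near_eq_cvg.
  by apply: filterS Fin => y [_ yE]; rewrite /negrefl opprK yE.
move=> sx; have soo : infE != -oo%E by rewrite gt_eqF// (lt_le_trans _ sx)// ltNyr.
rewrite (limE soo).
have sfin : infE \is a fin_num.
  by rewrite fin_numElt (lt_trans iE0) ?ltry// andbT ltNye.
have := dualsup_affine LN uD u0 und ucvg (erefl _) (x := - x).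
move=> /(_ (- fine infE)); rewrite EFinN fineK// => /(_ (esym sE)).
rewrite lerN2 -lee_fin fineK// => /(_ sx) h.
rewrite -(dualsup_E P X0 f x) -dualsup_refl h; last first.
  by move=> u /(Ef_cv_domain mX0 int0 fL)[_]; rewrite opprK.
congr (_ + _)%E; first by rewrite opprK addrC EFinB fineK.
rewrite sE (dualsup_slope_sup LN uD u0).
transitivity (\int[leb]_(t in I01) I1ext P X0 (K1'ext P X0 (Mm * (-1 * f t)%:E)))%E.
  rewrite (integral_edge u0 und uM ucvg) => [|n]; last by rewrite mulN1r; apply/betweenN.
  have h' : (fun n => (dualval (refl E) (negrefl E') (u_ n))%:E) =
      (fun n => (dualval E E' (-1 * u_ n))%:E).
    by apply/funext => n; rewrite mulN1r; exact: congr1 (dualval_refl E E' (u_ n)).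
  exact: (congr1 (fun z => ereal_sup (range z)) h').
by apply: eq_integral => t _; rewrite mulN1r EFinN muleN mulNe.
Unshelve. all: by end_near. Qed.

(** At most one of the two linear terms is nonzero; the other is 0 even when its slope is infinite,
    and an infinite [supE] or [infE] gives a zero positive or negative part. *)
Theorem If_line x : If P X0 f (cv x) =
  (Mp * epos (x%:E - supE) + Mm * eneg (x%:E - infE)
   + path_integral (Ef1'inv_bar P X0 f x))%E.
Proof.
have [E0s iE0] := Ef1'_bounds (between0 (legendre_line_E mX0 int0 fL)).
have is0 : (infE < supE)%E by exact: lt_trans E0s.
have eposE (y : \bar R) : (x%:E <= y)%E -> epos (x%:E - y) = 0%E.
  by move=> xy; apply/max_idPr; rewrite sube_le0.
have enegE (y : \bar R) : (y <= x%:E)%E -> eneg (x%:E - y) = 0%E.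
  by move=> xy; apply/max_idPr; rewrite leeNl oppe0 sube_ge0 ?orbT.
rewrite /Ef1'inv_bar; have [xs|sx] := ltP x%:E supE; last first.
  rewrite andbF (enegE infE) ?(le_trans (ltW is0))// mule0 adde0 If_right//.
  by congr (_ * _ + _)%E; apply/esym/max_idPl; rewrite sube_ge0 ?orbT.
rewrite (eposE supE (ltW xs)) mule0 add0e andbT.
have [ix|xi] := ltP infE x%:E.
  by rewrite (enegE infE (ltW ix)) mule0 add0e If_inside.
rewrite If_left//; congr (_ * _ + _)%E.
rewrite /eneg oppeB ?fin_num_adde_defr// addeC; apply/esym/max_idPl.
by rewrite addeC sube_ge0 ?orbT.
Qed.

End OneDimensionRate.


Theorem theorem6p1 (R : realType) (d : nat) (dT : measure_display)
    (T : measurableType dT) (P : probability T R)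
    (X : nat -> T -> 'rV[R]_d) (f : R -> R) :
  iid_rvecs P X ->
  interior (DL P (X 0%N)) 0 ->
  (exists L : R, forall s t, `[0%R, 1%R]%classic s -> `[0%R, 1%R]%classic t ->
      `|f s - f t| <= L * `|s - t|) ->
  (exists t, `[0%R, 1%R]%classic t /\ f t != 0) ->
  LDP P (fun n w => n%:R^-1 *:
           \sum_(k < n) (f (k.+1%:R / n%:R) *: X k w))
      (If P (X 0%N) f) /\
  (full_affine_dim (supp_law P (X 0%N)) ->
     (forall l, interior (Df P (X 0%N) f) l ->
        differentiable (Efr P (X 0%N) f) l) /\
     (forall l1 l2, interior (Df P (X 0%N) f) l1 ->
        interior (Df P (X 0%N) f) l2 ->
        grad (Efr P (X 0%N) f) l1 = grad (Efr P (X 0%N) f) l2 -> l1 = l2) /\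
     (forall l, interior (Df P (X 0%N) f) l ->
        If P (X 0%N) f (grad (Efr P (X 0%N) f) l) =
        (\int[lebesgue_measure]_(t in `[0%R, 1%R]%classic)
           Irate P (X 0%N) (grad (Kr P (X 0%N)) (f t *: l)))%E) /\
     (d = 1%N ->
        forall x : R,
          If P (X 0%N) f (cv x) =
          (Mplus P (X 0%N) f * epos (x%:E - supEf' P (X 0%N) f)
           + Mminus P (X 0%N) f * eneg (x%:E - infEf' P (X 0%N) f)
           + \int[lebesgue_measure]_(t in `[0%R, 1%R]%classic)
               I1ext P (X 0%N)
                 (K1'ext P (X 0%N) (Ef1'inv_bar P (X 0%N) f x * (f t)%:E)))%E)).
Proof.
move=> iid int0 [Lf fL] f_nz; have [mX _] := iid.
have mX0 := mX 0%N.
have Df_intD l : interior (Df P (X 0%N) f) l -> intD P (X 0%N) f l.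
  by move=> Dl; exact: (iffLR (interior_Df int0 fL _) Dl).
split; first exact: (LDP_weighted iid int0 fL).
move=> full; split; [|split; [|split]].
- by move=> l /Df_intD/(intD_good mX0 fL)/(Efr_grad mX0 int0 fL)[].
- move=> l1 l2 /Df_intD/(intD_good mX0 fL) g1 /Df_intD/(intD_good mX0 fL) g2.
  rewrite (Efr_grad mX0 int0 fL g1).2 (Efr_grad mX0 int0 fL g2).2.
  exact: (gradT_inj mX0 int0 fL full f_nz g1 g2).
- by move=> l /Df_intD Dl; exact: (If_grad mX0 int0 fL Dl).
(* All data whose types mention [d] are generalised before it is replaced by 1. *)
- move=> d1; move: X iid int0 mX mX0 Df_intD full; rewrite d1 => X iid int0 mX mX0 _ full x.
  exact: (If_line mX0 int0 fL full f_nz x).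
Qed.
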